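(* Let $t \geq 1$. For simple graphs $G$ and $H$ (with non-empty vertex sets), the following are equivalent: 1. the level-$t$ Lasserre relaxation for graph isomorphism of $G$ and $H$ with non-negativity constraints is feasible; 2. $G$ and $H$ are level-$t$ $\mathcal{DNN}$-isomorphic; 3. there is a level-$t$ $\mathcal{DNN}$-isomorphism map from $G$ to $H$; 4. $G$ and $H$ are $t$-equivalent; 5. $G$ and $H$ are homomorphism indistinguishable over $\mathcal{L}_t^+$.
   Context: Graphs are finite, undirected, without multiple edges, and may have loops; simple means loopless. A homomorphism $F\to G$ is a map $V(F)\to V(G)$ sending edges to edges (looped vertices to looped vertices); $\hom(F,G)$ is the number of homomorphisms. Bilabelled graphs. A $(t,t)$-bilabelled graph is a tuple $\boldsymbol{F}=(F,\boldsymbol{u},\boldsymbol{v})$ with $F$ a graph and $\boldsymbol{u},\boldsymbol{v}\in V(F)^t$ (in-labels, out-labels; repetitions allowed). Bilabelled graphs are considered up to isomorphism. Its homomorphism tensor for a graph $G$ is $\boldsymbol{F}_G\in\mathbb{C}^{V(G)^t\times V(G)^t}$ whose $(\boldsymbol{x},\boldsymbol{y})$-entry is the number of homomorphisms $h:F\to G$ with $h(\boldsymbol{u}_i)=\boldsymbol{x}_i$ and $h(\boldsymbol{v}_i)=\boldsymbol{y}_i$ for all $i \in [t]$. $\operatorname{soe}(\boldsymbol{F}) := F$ is the underlying unlabelled graph. For $\sigma\in\mathfrak{S}_{2t}$ (symmetric group), $\boldsymbol{F}^\sigma := (F,\boldsymbol{x},\boldsymbol{y})$ where the concatenation $\boldsymbol{x}\boldsymbol{y}$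 has $i$-th entry $(\boldsymbol{u}\boldsymbol{v})_{\sigma(i)}$, $i\in[2t]$. The series composition $\boldsymbol{F}\cdot\boldsymbol{F}'$ of $\boldsymbol{F}=(F,\boldsymbol{u},\boldsymbol{v})$ and $\boldsymbol{F}'=(F',\boldsymbol{u}',\boldsymbol{v}')$ is obtained from the disjoint union of $F$ and $F'$ by identifying $\boldsymbol{v}_i$ with $\boldsymbol{u}'_i$ for all $i$, with in-labels $\boldsymbol{u}$ and out-labels $\boldsymbol{v}'$. The parallel composition $\boldsymbol{F}\odot\boldsymbol{F}'$ is obtained by identifying $\boldsymbol{u}_i$ with $\boldsymbol{u}'_i$ and $\boldsymbol{v}_i$ with $\boldsymbol{v}'_i$ for all $i$, with in-labels $\boldsymbol{u}$ and out-labels $\boldsymbol{v}$. In both cases multiple edges are removed and loops are kept. A $(t,t)$-bilabelled graph is atomic if all its vertices are labelled; $\mathcal{A}_t$ is the set of atomic $(t,t)$-bilabelled graphs. The class $\mathcal{L}_t^+$ is the class of $(t,t)$-bilabelled graphs generated by $\mathcal{A}_t$ under (arbitrary) parallel composition, series composition, and the action $\boldsymbol{F} \mapsto \boldsymbol{F}^\sigma$ of $\mathfrak{S}_{2t}$. $G$ and $H$ are homomorphism indistinguishable over $\mathcal{L}_t^+$ if $\hom(\operatorname{soe}(\boldsymbol{F}),G)=\hom(\operatorname{soe}(\boldsymbol{F}),H)$ for all $\boldsymbol{F}\in\mathcal{L}_t^+$. Atomic types. For $g_1,\dots,g_\ell \in V(G)$ and $h_1,\dots,h_\ell\in V(H)$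 write $\mathrm{atp}_G(g_1,\dots,g_\ell)=\mathrm{atp}_H(h_1,\dots,h_\ell)$ if for all $i,j$: $g_i=g_j\Leftrightarrow h_i=h_j$ and $g_ig_j\in E(G)\Leftrightarrow h_ih_j\in E(H)$; then $\{g_1h_1,\dots,g_\ell h_\ell\}\subseteq V(G)\times V(H)$ is called a partial isomorphism ($gh$ denotes the pair $(g,h)$). Level-$t$ Lasserre relaxation with non-negativity constraints. Real variables $y_I$, $I \in \binom{V(G)\times V(H)}{\leq 2t}$ (subsets of size at most $2t$), with constraints: $(y_{I\cup J})_{I,J\in\binom{V(G)\times V(H)}{\leq t}}$ is positive semidefinite; $\sum_{h\in V(H)} y_{I\cup\{gh\}} = y_I$ for all $|I| \leq 2t-2$, $g\in V(G)$; $\sum_{g\in V(G)} y_{I\cup\{gh\}} = y_I$ for all $|I|\leq 2t-2$, $h\in V(H)$; $y_I=0$ if $I$ is not a partial isomorphism; $y_\emptyset=1$; $y_I\geq 0$ for all $I$. Level-$t$ $\mathcal{K}$-isomorphic. Let $\mathcal{DNN}$ be the family of doubly non-negative matrices, i.e. entry-wise non-negative real positive semidefinite matrices. For a family of matrices $\mathcal{K}$, $G$ and $H$ are level-$t$ $\mathcal{K}$-isomorphic if there is $M\in\mathcal{K}$ with rows and columns indexed by $(V(G)\times V(H))^t$ such that, writing $M[g_1h_1\dots g_{2t}h_{2t}] := M_{g_1h_1\dots g_th_t,\,g_{t+1}h_{t+1}\dots g_{2t}h_{2t}}$, for all $g_1,\dots,g_{2t}\in V(G)$, $h_1,\dots,h_{2t}\in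 V(H)$: (a) for every $i\in[2t]$, $\sum_{g_i\in V(G)}M[g_1h_1\dots g_{2t}h_{2t}]=\sum_{h_i\in V(H)}M[g_1h_1\dots g_{2t}h_{2t}]$; (b) $\sum_{g_1,\dots,g_{2t}\in V(G)}M[g_1h_1\dots g_{2t}h_{2t}]=1=\sum_{h_1,\dots,h_{2t}\in V(H)}M[g_1h_1\dots g_{2t}h_{2t}]$; (c) $M[g_1h_1\dots g_{2t}h_{2t}]=0$ if $\mathrm{atp}_G(g_1,\dots,g_{2t})\neq\mathrm{atp}_H(h_1,\dots,h_{2t})$; (d) $M[g_1h_1\dots g_{2t}h_{2t}]=M[g_{\sigma(1)}h_{\sigma(1)}\dots g_{\sigma(2t)}h_{\sigma(2t)}]$ for all $\sigma\in\mathfrak{S}_{2t}$. Tensor action. For $A\in\mathbb{C}^{V(G)^t\times V(G)^t}$ and $\sigma\in\mathfrak{S}_{2t}$, $A^\sigma(\boldsymbol{u},\boldsymbol{v}) := A(\boldsymbol{x},\boldsymbol{y})$ where $(\boldsymbol{x}\boldsymbol{y})_i=(\boldsymbol{u}\boldsymbol{v})_{\sigma^{-1}(i)}$ for $i\in[2t]$. $\odot$ on matrices is the entrywise (Schur) product; $J$ is the all-ones and $I$ the identity matrix; $*$ on matrices is the conjugate transpose. Level-$t$ $\mathcal{K}$-isomorphism map from $G$ to $H$. A linear map $\Phi:\mathbb{C}^{V(G)^t\times V(G)^t}\to\mathbb{C}^{V(H)^t\times V(H)^t}$ such that: $\Phi$ is completely $\mathcal{K}$-preserving (i.e. for all $r\in\mathbb{N}$,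 $\mathrm{id}_r\otimes\Phi$ maps matrices in $\mathcal{K}$ to matrices in $\mathcal{K}$); $\Phi(\boldsymbol{A}_G\odot X)=\boldsymbol{A}_H\odot\Phi(X)$ for all $\boldsymbol{A}\in\mathcal{A}_t$ and all $X$; $\Phi(J)=J=\Phi^*(J)$, where $\Phi^*$ is the adjoint of $\Phi$ with respect to $\langle A,B\rangle=\operatorname{tr}(AB^* )$; $\Phi(X^\sigma)=\Phi(X)^\sigma$ for all $\sigma\in\mathfrak{S}_{2t}$ and all $X$. $t$-equivalence. The $t$-adjacency algebra $\mathcal{A}^t_G$ is the smallest linear subspace of $\mathbb{C}^{V(G)^t\times V(G)^t}$ containing $I$, $J$, and $\boldsymbol{A}_G$ for all $\boldsymbol{A}\in\mathcal{A}_t$, and closed under matrix multiplication, conjugate transposes, Schur products, and $A\mapsto A^\sigma$ for all $\sigma\in\mathfrak{S}_{2t}$. $G$ and $H$ are $t$-equivalent if $|V(G)|=|V(H)|$ and there is a vector space isomorphism $\phi:\mathcal{A}^t_G\to\mathcal{A}^t_H$ such that for all $M,N\in\mathcal{A}^t_G$, $\boldsymbol{A}\in\mathcal{A}_t$, $\sigma\in\mathfrak{S}_{2t}$: $\phi(M^* )=\phi(M)^*$; $\phi(MN)=\phi(M)\phi(N)$; $\phi(I)=I$, $\phi(\boldsymbol{A}_G)=\boldsymbol{A}_H$, $\phi(J)=J$; $\phi(M\odot N)=\phi(M)\odot\phi(N)$; $\phi(M^\sigma)=\phi(M)^\sigma$. *)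

(* Defs.v *)
From HB Require Import structures.
From mathcomp Require Import all_boot all_order all_fingroup all_algebra.
From mathcomp Require Import complex mxtens.
From mathcomp Require Import reals.

Set Implicit Arguments.
Unset Strict Implicit.
Unset Printing Implicit Defensive.

Import Order.TTheory GRing.Theory Num.Theory.
Local Open Scope ring_scope.
Local Open Scope complex_scope.
Local Open Scope sesquilinear_scope.
Local Open Scope quotient_scope.

(** * Graphs *)

Record graph := Graph {
  vertex :> finType;
  edge : rel vertex;
  edge_sym : symmetric edge }.

Definition simple (G : graph) : Prop := irreflexive (@edge G).

Definition is_hom (F G : graph) (h : {ffun F -> G}) : bool :=
  [forall x, forall y, edge x y ==> edge (h x) (h y)].

Definition hom (F G : graph) : nat := #|[set h : {ffun F -> G} | is_hom h]|.

Definition same_atp (G H : graph) (l : nat)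
    (g : {ffun 'I_l -> G}) (h : {ffun 'I_l -> H}) : Prop :=
  forall i j : 'I_l, (g i = g j <-> h i = h j) /\
                     (edge (g i) (g j) <-> edge (h i) (h j)).

Definition partial_iso (G H : graph) (I : {set G * H}) : Prop :=
  exists (l : nat) (g : {ffun 'I_l -> G}) (h : {ffun 'I_l -> H}),
    same_atp g h /\ I = [set (g i, h i) | i : 'I_l].

Section DisjointUnion.
Variables F F' : graph.

Definition dunion_edge : rel (F + F')%type := fun a b =>
  match a, b with
  | inl x, inl y => edge x y
  | inr x, inr y => edge x y
  | _, _ => false
  end.

Lemma dunion_edge_sym : symmetric dunion_edge.
Proof. by case=> x [] y //=; rewrite edge_sym. Qed.

Definition dunion : graph := Graph dunion_edge_sym.
End DisjointUnion.

(* Identification of vertices: [glue e] is the quotient of [F] by the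
   equivalence relation generated by [e].  As edges form a relation, parallel
   edges are merged; an edge inside a class becomes a loop. *)
Section Glue.
Variables (F : graph) (e : rel F).

Definition glue_rel : rel F := connect [rel x y | e x y || e y x].

Lemma glue_rel_sym : symmetric glue_rel.
Proof. by apply: sym_connect_sym => x y /=; rewrite orbC. Qed.

Definition glue_equiv : equiv_rel F :=
  EquivRel glue_rel (@connect0 _ _) glue_rel_sym (@connect_trans _ _).

Definition glue_vertex : finType := quot_type {eq_quot glue_equiv}.

Definition glue_map (x : F) : glue_vertex := \pi_({eq_quot glue_equiv}) x.

Definition glue_edge : rel glue_vertex := fun p q =>
  [exists x, exists y, [&& glue_map x == p, glue_map y == q & edge x y]].

Lemma glue_edge_sym : symmetric glue_edge.
Proof.
move=> p q; apply/existsP/existsP => -[x /existsP[y /and3P[px qy xy]]];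
  by exists y; apply/existsP; exists x; rewrite px qy edge_sym.
Qed.

Definition glue : graph := Graph glue_edge_sym.
End Glue.

(** * Tuples and bilabelled graphs *)

Definition fcat (T : Type) (m n : nat)
    (u : {ffun 'I_m -> T}) (v : {ffun 'I_n -> T}) : {ffun 'I_(m + n) -> T} :=
  [ffun i => match split i with inl j => u j | inr j => v j end].

Definition flsub (T : Type) (m n : nat) (w : {ffun 'I_(m + n) -> T}) :
  {ffun 'I_m -> T} := [ffun i => w (lshift n i)].

Definition frsub (T : Type) (m n : nat) (w : {ffun 'I_(m + n) -> T}) :
  {ffun 'I_n -> T} := [ffun i => w (rshift m i)].

Definition fperm (T : Type) (n : nat) (s : 'S_n) (w : {ffun 'I_n -> T}) :
  {ffun 'I_n -> T} := [ffun i => w (s i)].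

Record bgraph (t : nat) := BGraph {
  soe : graph;
  inlab : {ffun 'I_t -> soe};
  outlab : {ffun 'I_t -> soe} }.

Section BilabelledOperations.
Variable t : nat.
Implicit Types F : bgraph t.

Definition atomic F : Prop :=
  forall x : soe F, exists i, x = inlab F i \/ x = outlab F i.

Definition bgraph_iso F F' : Prop :=
  exists f : soe F -> soe F',
    [/\ bijective f,
        forall x y, edge (f x) (f y) = edge x y,
        forall i, f (inlab F i) = inlab F' i &
        forall i, f (outlab F i) = outlab F' i].

Definition bgraph_act (s : 'S_(t + t)) F : bgraph t :=
  let w := fperm s (fcat (inlab F) (outlab F)) in BGraph (flsub w) (frsub w).

Definition series_ident F F' : rel (dunion (soe F) (soe F')) := fun a b =>
  [exists i, (a == inl (outlab F i)) && (b == inr (inlab F' i))].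

Definition series F F' : bgraph t :=
  let p := @glue_map (dunion (soe F) (soe F')) (@series_ident F F') in
  @BGraph t (glue (@series_ident F F'))
    [ffun i => p (inl (inlab F i))] [ffun i => p (inr (outlab F' i))].

Definition parallel_ident F F' : rel (dunion (soe F) (soe F')) := fun a b =>
  [exists i, (a == inl (inlab F i)) && (b == inr (inlab F' i))
          || (a == inl (outlab F i)) && (b == inr (outlab F' i))].

Definition parallel F F' : bgraph t :=
  let p := @glue_map (dunion (soe F) (soe F')) (@parallel_ident F F') in
  @BGraph t (glue (@parallel_ident F F'))
    [ffun i => p (inl (inlab F i))] [ffun i => p (inl (outlab F i))].

(* [Lplus_iso]: bilabelled graphs are considered up to isomorphism. *)
Inductive Lplus : bgraph t -> Prop :=
| Lplus_atomic F of atomic F : Lplus F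
| Lplus_parallel F F' of Lplus F & Lplus F' : Lplus (parallel F F')
| Lplus_series F F' of Lplus F & Lplus F' : Lplus (series F F')
| Lplus_act s F of Lplus F : Lplus (bgraph_act s F)
| Lplus_iso F F' of Lplus F & bgraph_iso F F' : Lplus F'.

End BilabelledOperations.

Definition hom_indistinguishable (t : nat) (C : bgraph t -> Prop)
    (G H : graph) : Prop :=
  forall F : bgraph t, C F -> hom (soe F) G = hom (soe F) H.

(** * Matrices indexed by finite types *)

(* A matrix with rows and columns indexed by a finite type [S] is an element
   of ['M_#|S|], through the canonical enumeration of [S]. *)
Definition entry (K : Type) (S : finType) (A : 'M[K]_#|S|) (x y : S) : K :=
  A (enum_rank x) (enum_rank y).

Definition mx_of (K : Type) (S : finType) (f : S -> S -> K) : 'M[K]_#|S| :=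
  \matrix_(i, j) f (enum_val i) (enum_val j).

Definition schur (K : pzRingType) (m n : nat) (A B : 'M[K]_(m, n)) :=
  map2_mx *%R A B.

Definition tact (K : Type) (t : nat) (V : finType) (s : 'S_(t + t))
    (A : 'M[K]_#|{ffun 'I_t -> V}|) : 'M[K]_#|{ffun 'I_t -> V}| :=
  mx_of (fun u v => let w := fperm (s^-1)%g (fcat u v) in
                    entry A (flsub w) (frsub w)).

Definition htensor (K : pzRingType) (t : nat) (F : bgraph t) (G : graph) :
    'M[K]_#|{ffun 'I_t -> G}| :=
  mx_of (fun x y : {ffun 'I_t -> G} =>
    #|[set h : {ffun soe F -> G} | is_hom h &&
        [forall i, (h (inlab F i) == x i) && (h (outlab F i) == y i)]]|%:R).

Definition psd (R : realType) (n : nat) (M : 'M[R]_n) : Prop :=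
  M^T = M /\ forall v : 'cV[R]_n, 0 <= (v^T *m M *m v) 0 0.

Definition mxfamily (R : realType) := forall n : nat, 'M[R[i]]_n -> Prop.

Definition DNN (R : realType) : mxfamily R := fun n M =>
  exists N : 'M[R]_n,
    [/\ M = map_mx (real_complex R) N, psd N & forall i j, 0 <= N i j].

(** * The Lasserre relaxation *)

(* The variables [y I] with [2 * t < #|I|] are unconstrained, that is, they
   are not part of the program. *)
Definition lasserre_nonneg_feasible (R : realType) (t : nat) (G H : graph) :
    Prop :=
  exists y : {set G * H} -> R,
    [/\ psd (mx_of (fun I J : {I : {set G * H} | #|I| <= t}%N =>
               y (val I :|: val J))),
        (forall (I : {set G * H}) (g : G), (#|I| <= 2 * t - 2)%N ->
           \sum_(h : H) y (I :|: [set (g, h)]) = y I) /\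
        (forall (I : {set G * H}) (h : H), (#|I| <= 2 * t - 2)%N ->
           \sum_(g : G) y (I :|: [set (g, h)]) = y I),
        forall I : {set G * H}, (#|I| <= 2 * t)%N -> ~ partial_iso I -> y I = 0,
        y set0 = 1 &
        forall I : {set G * H}, (#|I| <= 2 * t)%N -> 0 <= y I].

(** * Level-t K-isomorphic graphs *)

Section LevelIsomorphic.
Variables (R : realType) (t : nat) (G H : graph).

Definition fset_at (T : Type) (n : nat) (w : {ffun 'I_n -> T}) (i : 'I_n)
  (x : T) : {ffun 'I_n -> T} := [ffun j => if j == i then x else w j].

Definition fpair (A B : Type) (n : nat) (g : {ffun 'I_n -> A})
  (h : {ffun 'I_n -> B}) : {ffun 'I_n -> A * B} := [ffun i => (g i, h i)].

Definition ghentry (M : 'M[R[i]]_#|{ffun 'I_t -> G * H}|)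
    (g : {ffun 'I_(t + t) -> G}) (h : {ffun 'I_(t + t) -> H}) : R[i] :=
  entry M (flsub (fpair g h)) (frsub (fpair g h)).

Definition level_isomorphic (K : mxfamily R) : Prop :=
  exists M : 'M[R[i]]_#|{ffun 'I_t -> G * H}|,
    [/\ K _ M,
        forall g h i, \sum_(x : G) ghentry M (fset_at g i x) h =
                      \sum_(x : H) ghentry M g (fset_at h i x),
        (forall h, \sum_g ghentry M g h = 1) /\
        (forall g, \sum_h ghentry M g h = 1),
        forall g h, ~ same_atp g h -> ghentry M g h = 0 &
        forall g h s, ghentry M g h = ghentry M (fperm s g) (fperm s h)].

End LevelIsomorphic.

(** * Level-t K-isomorphism maps *)

Section LinearMaps.
Variables (R : realType) (m n : nat).
Implicit Type Phi : {linear 'M[R[i]]_m -> 'M[R[i]]_n}.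

(* [ampl r Phi] is the map id_r (x) Phi, with id_r the identity map of the
   r-by-r matrices; see [ampl_tens]. *)
Definition ampl (r : nat) Phi (X : 'M[R[i]]_(r * m)) : 'M[R[i]]_(r * n) :=
  \sum_(a < r) \sum_(b < r)
    delta_mx a b *t
    Phi (\matrix_(i, j) X (mxtens_index (a, i)) (mxtens_index (b, j))).

Lemma ampl_tens r Phi (A : 'M[R[i]]_r) (B : 'M[R[i]]_m) :
  ampl Phi (A *t B) = A *t Phi B.
Proof.
apply/matrixP => p q; rewrite summxE; case: (mxtens_indexP p) => a i.
case: (mxtens_indexP q) => b j; rewrite tensmxE (bigD1 a) //= summxE.
rewrite (bigD1 b) //= !big1 ?addr0; first last.
- move=> b' b'b; rewrite tensmxE mxE [b == _]eq_sym (negbTE b'b) andbF.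
  by rewrite mul0r.
- move=> a' a'a; rewrite summxE big1 // => b' _.
  by rewrite tensmxE mxE [a == _]eq_sym (negbTE a'a) mul0r.
rewrite tensmxE mxE !eqxx mul1r.
suff -> : \matrix_(k, l) (A *t B) (mxtens_index (a, k)) (mxtens_index (b, l))
    = A a b *: B by rewrite linearZ mxE.
by apply/matrixP => k l; rewrite mxE tensmxE mxE.
Qed.

Definition completely_preserving (K : mxfamily R) Phi : Prop :=
  forall (r : nat) (X : 'M[R[i]]_(r * m)), K _ X -> K _ (ampl Phi X).

Definition inner (p : nat) (A B : 'M[R[i]]_p) : R[i] := \tr (A *m B^t*).

Lemma innerE p (A B : 'M[R[i]]_p) :
  inner A B = \sum_i \sum_j A i j * (B i j)^*%R.
Proof.
by apply: eq_bigr => i _; rewrite mxE; apply: eq_bigr => j _; rewrite !mxE.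
Qed.

(* The (i, j) entry of [Phi^* Y] is <Phi^* Y, E_ij> = <Y, Phi E_ij>. *)
Definition adjoint Phi (Y : 'M[R[i]]_n) : 'M[R[i]]_m :=
  \matrix_(i, j) inner Y (Phi (delta_mx i j)).

Lemma adjointP Phi X Y : inner (Phi X) Y = inner X (adjoint Phi Y).
Proof.
rewrite [RHS]innerE {1}(matrix_sum_delta X) linear_sum /= /inner mulmx_suml.
rewrite linear_sum; apply: eq_bigr => k _ /=.
rewrite linear_sum /= mulmx_suml linear_sum; apply: eq_bigr => l _ /=.
rewrite linearZ /= -scalemxAl linearZ /= mxE; congr (_ * _).
rewrite -!/(inner _ _) !innerE rmorph_sum; apply: eq_bigr => i _ /=.
rewrite rmorph_sum; apply: eq_bigr => j _ /=.
by rewrite rmorphM mulrC; congr (_ * _); exact: esym (conjCK _).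
Qed.

End LinearMaps.

Section IsomorphismMap.
Variables (R : realType) (t : nat) (G H : graph).

Record is_isomorphism_map (K : mxfamily R)
    (Phi : {linear 'M[R[i]]_#|{ffun 'I_t -> G}| ->
                   'M[R[i]]_#|{ffun 'I_t -> H}|}) : Prop := {
  isomap_preserving : completely_preserving K Phi;
  isomap_schur : forall (A : bgraph t) X, atomic A ->
    Phi (schur (htensor _ A G) X) = schur (htensor _ A H) (Phi X);
  isomap_J : Phi (const_mx 1) = const_mx 1;
  isomap_adjJ : adjoint Phi (const_mx 1) = const_mx 1;
  isomap_act : forall (s : 'S_(t + t)) X, Phi (tact s X) = tact s (Phi X) }.

(** * t-equivalence *)

Inductive adj_alg (G : graph) : 'M[R[i]]_#|{ffun 'I_t -> G}| -> Prop :=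
| adj_alg_I : adj_alg 1%:M
| adj_alg_J : adj_alg (const_mx 1)
| adj_alg_atomic A of atomic A : adj_alg (htensor _ A G)
| adj_alg_lin a M N of adj_alg M & adj_alg N : adj_alg (a *: M + N)
| adj_alg_mul M N of adj_alg M & adj_alg N : adj_alg (M *m N)
| adj_alg_adj M of adj_alg M : adj_alg (M^t*)
| adj_alg_schur M N of adj_alg M & adj_alg N : adj_alg (schur M N)
| adj_alg_act s M of adj_alg M : adj_alg (tact s M).

(* [phi] is only considered on [adj_alg G]; the first four fields say that it
   restricts to a linear bijection onto [adj_alg H]. *)
Record is_t_equivalence
    (phi : 'M[R[i]]_#|{ffun 'I_t -> G}| -> 'M[R[i]]_#|{ffun 'I_t -> H}|) :
    Prop := {
  teq_into : forall M, adj_alg M -> adj_alg (phi M);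
  teq_lin : forall a M N, adj_alg M -> adj_alg N ->
    phi (a *: M + N) = a *: phi M + phi N;
  teq_inj : forall M N, adj_alg M -> adj_alg N -> phi M = phi N -> M = N;
  teq_onto : forall N, adj_alg N -> exists2 M, adj_alg M & phi M = N;
  teq_adj : forall M, adj_alg M -> phi (M^t*) = (phi M)^t*;
  teq_mul : forall M N, adj_alg M -> adj_alg N ->
    phi (M *m N) = phi M *m phi N;
  teq_I : phi 1%:M = 1%:M;
  teq_atomic : forall A, atomic A -> phi (htensor _ A G) = htensor _ A H;
  teq_J : phi (const_mx 1) = const_mx 1;
  teq_schur : forall M N, adj_alg M -> adj_alg N ->
    phi (schur M N) = schur (phi M) (phi N);
  teq_act : forall s M, adj_alg M -> phi (tact s M) = tact s (phi M) }.

Definition t_equivalent : Prop :=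
  #|G| = #|H| /\ exists phi, is_t_equivalence phi.

End IsomorphismMap.

(* Main.v *)
From HB Require Import structures.
Require Import Defs.
From mathcomp Require Import all_boot all_order all_fingroup all_algebra.
From mathcomp Require Import complex mxtens boolp reals ring lra zify.

(* All conditions are compared with the existence of a coupling: a real DNN
   matrix [N] on pairs [(g, h)] of [t]-tuples satisfying (b), (c) and (d).
   Write [v (g, h)] for the Gram vectors of [N].

   By (b) the sums of [v (g, h)] over [g], and over [h], are one and the same
   vector; with (c) and (d) this forces (a) and makes the entries of [N] depend
   on the set of the [2 t] pairs only, which is a Lasserre solution.

   Call matrices [X], [Y] related if [X g g' = Y h h'] whenever
   [N (g, h) (g', h') <> 0].  By (c) this means that [X U = U Y] for the matrix
   of vectors [U g h = v (g, h)], so being related is compatible with matrix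
   products, and trivially with all other operations of the adjacency algebras:
   it is the graph of a [t]-equivalence.

   Conversely, let [P] be the span of the pairs of homomorphism tensors of
   graphs in [Lplus].  Equality of homomorphism counts says that [X] and [Y]
   have the same sum of entries for [(X, Y)] in [P].  The [P]-classes of
   positions are thus equally large on both sides, and
   [N (g, h) (g', h') = [(g, g') ~ (h, h')] / class size]
   satisfies (b), (c) and (d).  It is positive semidefinite because
   [N ^ 2 = Z N] for a positive definite [Z] commuting with [N]. *)

Set Implicit Arguments.
Unset Strict Implicit.
Unset Printing Implicit Defensive.

Import Order.TTheory GRing.Theory Num.Theory.
Local Open Scope ring_scope.
Local Open Scope complex_scope.
Local Open Scope sesquilinear_scope.

(** Positive semidefiniteness forces equalities through one fact: combinations [a], [b] of Gram
    vectors with [<a, a> = <a, b> = <b, b>] coincide. The inner products needed are known from (b),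
    or vanish by (c) because of a conflict, that is, two pairs agreeing in exactly one coordinate.

    The obstacle in reaching t-equivalence is that the algebra carries two products. Entrywise
    relatedness suits the Schur product, intertwining suits the matrix product, and each implies the
    other. Returning from intertwining to entries uses that [N] is entrywise non-negative: an
    [N]-weighted sum of squares vanishes, hence so does every term.

    On the way back, positivity of the kernel is obtained without decomposing the algebra into
    simple blocks. In [N ^ 2] one factor is a class indicator divided by a size; intertwining moves
    it from the [G] side to the [H] side, and what is left in front of [N] is an explicit [Z], whose
    form is a sum of squares over classes. *)

Lemma sum_pair (M : nmodType) (A B : finType) (F : A * B -> M) :
  \sum_p F p = \sum_a \sum_b F (a, b).
Proof. by rewrite pair_bigA; apply: eq_bigr => -[]. Qed.

(** * Positive semidefinite kernels *)

Section Kernels.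
Variable R : realType.

Definition fpsd (T : finType) (f : T -> T -> R) : Prop :=
  (forall x y, f x y = f y x) /\
  forall c : T -> R, 0 <= \sum_x \sum_y c x * f x y * c y.

Lemma fpsd_diag_ge0 (T : finType) (f : T -> T -> R) x : fpsd f -> 0 <= f x x.
Proof.
case=> _ /(_ (fun y => (y == x)%:R)).
rewrite (bigD1 x) //= (bigD1 x) //= eqxx !mul1r mulr1 !big1 ?addr0 //.
- by move=> y /negbTE yx; rewrite big1 // => z _; rewrite yx !mul0r.
- by move=> y /negbTE yx; rewrite yx mulr0.
Qed.

(** Move [c] by [l] times the unit vector at [z]: the form becomes [2 l b + l ^ 2 f z z] with [b]
    the claimed zero, and it is non-negative for all [l] only if [b = 0]. *)
Lemma fpsd_kernel (T : finType) (f : T -> T -> R) (c : T -> R) :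
  fpsd f -> \sum_x \sum_y c x * f x y * c y = 0 ->
  forall x, \sum_y f x y * c y = 0.
Proof.
move=> fP c0 z; have fzz := fpsd_diag_ge0 z fP; case: fP => fsym fpos.
set b := \sum_y _; apply/eqP; apply: contraT => b0.
have Q l : 0 <= 2 * l * b + l ^+ 2 * f z z.
  have := fpos (fun x => c x + l * (x == z)%:R).
  have -> : \sum_x \sum_y (c x + l * (x == z)%:R) * f x y *
        (c y + l * (y == z)%:R) =
      \sum_x \sum_y c x * f x y * c y + l * (\sum_x c x * f x z)
      + l * (\sum_y f z y * c y) + l ^+ 2 * f z z.
    under eq_bigr => x _.
      rewrite (eq_bigr (fun y => c x * f x y * c y
         + (y == z)%:R * (l * (c x * f x y)) + (x == z)%:R * (l * (f x y * c y))
         + (y == z)%:R * ((x == z)%:R * (l ^+ 2 * f x y)))); last first.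
        by move=> y _; ring.
      rewrite !big_split /=.
      over.
    rewrite !big_split /=; congr (_ + _ + _ + _).
    - rewrite mulr_sumr; apply: eq_bigr => x _.
      rewrite (bigD1 z) //= eqxx mul1r big1 ?addr0 // => y /negbTE ->.
      by rewrite mul0r.
    - rewrite (bigD1 z) //= [X in _ + X]big1 ?addr0; last first.
        by move=> x /negbTE ->; apply: big1 => y _; rewrite mul0r.
      by rewrite mulr_sumr; apply: eq_bigr => y _; rewrite eqxx mul1r.
    - rewrite (bigD1 z) //= [X in _ + X]big1 ?addr0; last first.
        by move=> x /negbTE ->; apply: big1 => y _; rewrite mul0r mulr0.
      rewrite (bigD1 z) //= eqxx !mul1r big1 ?addr0 // => y /negbTE ->.
      by rewrite mul0r.
  have -> : \sum_x c x * f x z = b.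
    by apply: eq_bigr => x _; rewrite mulrC fsym.
  rewrite c0 add0r.
  by rewrite -/b; lra.
(* The form is smallest at [l = - b / f z z]; the added 1 keeps the denominator positive when
   [f z z = 0]. *)
have k0 : f z z + 1 != 0 by rewrite gt_eqF // ltr_wpDl.
have := Q (- b / (f z z + 1)).
have -> : 2 * (- b / (f z z + 1)) * b + (- b / (f z z + 1)) ^+ 2 * f z z =
    - (b ^+ 2 * (f z z + 2) / (f z z + 1) ^+ 2) by field.
rewrite oppr_ge0 leNgt => /negP[].
have b2 : 0 < b ^+ 2 by rewrite exprn_even_gt0.
have k2 : 0 < (f z z + 1) ^+ 2 by rewrite exprn_even_gt0.
by rewrite divr_gt0 // mulr_gt0 // ltr_wpDl.
Qed.

Lemma fpsd_diag0 (T : finType) (f : T -> T -> R) x y :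
  fpsd f -> f x x = 0 -> f y x = 0.
Proof.
move=> fP fxx; have /(_ _ y) := fpsd_kernel (c := fun z => (z == x)%:R) fP.
have sum1 (F : T -> R) : \sum_z F z * (z == x)%:R = F x.
  rewrite (bigD1 x) //= eqxx mulr1 big1 ?addr0 // => z /negbTE ->.
  by rewrite mulr0.
rewrite (sum1 (f y)); apply.
rewrite (eq_bigr (fun x' => f x' x * (x' == x)%:R)) => [|x' _].
  by rewrite (sum1 (f^~ x)).
by rewrite (sum1 (fun z => _ * f x' z)) mulrC.
Qed.

(** Cholesky elimination: removing the rank one part through a non-zero diagonal entry leaves a
    semidefinite Schur complement with fewer non-zero diagonal entries. *)
Lemma fpsd_gram (T : finType) (f : T -> T -> R) : fpsd f ->
  exists s : seq (T -> R), forall x y, f x y = \sum_(b <- s) b x * b y.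
Proof.
have [n] := ubnP #|[set x | f x x != 0]|.
elim: n f => // n IHn f; rewrite ltnS => fn fP.
have [/existsP[z fzz]|/existsPn f0] := boolP [exists z, f z z != 0]; last first.
  exists [::] => x y; rewrite big_nil; apply: (fpsd_diag0 x fP).
  by apply/eqP/negbNE/f0.
have fzz_gt0 : 0 < f z z by rewrite lt_neqAle eq_sym fzz fpsd_diag_ge0.
pose f' x y := f x y - f x z * f z y / f z z.
have [fsym fpos] := fP.
have f'P : fpsd f'.
  split=> [x y|c].
    by rewrite /f' fsym; congr (_ - _ / _); rewrite mulrC (fsym x) (fsym y).
  (* The form of [f'] at [c] is the minimum of the form of [f] over all shifts of [c] along [z]; [a]
     is the minimising shift. *)
  have [a aE] : exists a, \sum_y f z y * c y = a * f z z.
    by exists ((\sum_y f z y * c y) / f z z); rewrite divfK.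
  have := fpos (fun x => c x - a * (x == z)%:R).
  have -> // : \sum_x \sum_y (c x - a * (x == z)%:R) * f x y *
        (c y - a * (y == z)%:R) = \sum_x \sum_y c x * f' x y * c y.

  transitivity (\sum_x \sum_y c x * f x y * c y - a * (\sum_x c x * f x z)
      - a * (\sum_y f z y * c y) + a ^+ 2 * f z z).
    under eq_bigr => x _.
      rewrite (eq_bigr (fun y => c x * f x y * c y
         + (y == z)%:R * (- a * (c x * f x y))
         + (x == z)%:R * (- a * (f x y * c y))
         + (y == z)%:R * ((x == z)%:R * (a ^+ 2 * f x y)))); last first.
        by move=> y _; ring.
      rewrite !big_split /=.
      over.
    rewrite !big_split /= -!mulNr; congr (_ + _ + _ + _).
    - rewrite mulr_sumr; apply: eq_bigr => x _.
      rewrite (bigD1 z) //= eqxx mul1r big1 ?addr0 // => y /negbTE ->.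
      by rewrite mul0r.
    - rewrite (bigD1 z) //= [X in _ + X]big1 ?addr0; last first.
        by move=> x /negbTE ->; apply: big1 => y _; rewrite mul0r.
      by rewrite mulr_sumr; apply: eq_bigr => y _; rewrite eqxx mul1r.
    - rewrite (bigD1 z) //= [X in _ + X]big1 ?addr0; last first.
        by move=> x /negbTE ->; apply: big1 => y _; rewrite mul0r mulr0.
      rewrite (bigD1 z) //= eqxx !mul1r big1 ?addr0 // => y /negbTE ->.
      by rewrite mul0r.
  have -> : \sum_x c x * f x z = \sum_y f z y * c y.
    by apply: eq_bigr => x _; rewrite mulrC fsym.
  rewrite aE /f'.
  under [RHS]eq_bigr => x _.
    rewrite (eq_bigr (fun y => c x * f x y * c y
       + (- (c x * f x z / f z z)) * (f z y * c y))); last by move=> y _; ring.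
    rewrite big_split /= -mulr_sumr aE.
    rewrite (_ : _ * (a * f z z) = - a * (f z x * c x)); last first.
      by rewrite (fsym x z); field.
    over.
  by rewrite big_split /= -mulr_sumr aE; ring.
have f'n : (#|[set x | f' x x != 0%R]| < n)%N.
  apply: leq_trans fn; apply: proper_card; apply/properP; split; last first.
    by exists z; rewrite !inE // /f' mulfK // subrr eqxx.
  apply/subsetP => x; rewrite !inE; apply: contra => /eqP fxx.
  by rewrite /f' fxx (fsym x z) (fpsd_diag0 z fP fxx) !mul0r subrr.
have [s sE] := IHn f' f'n f'P.
exists ((fun x => f x z / Num.sqrt (f z z)) :: s) => x y.
rewrite big_cons -sE /f' mulrACA -invfM -expr2 sqr_sqrtr ?ltW //.
by rewrite (fsym z y) [RHS]addrC subrK.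
Qed.

(** Schur product theorem: a Gram factorization of [f] turns the form at [c] into a sum of forms of
    [g] at the vectors [c * b]. *)
Lemma fpsd_schur (T : finType) (f g : T -> T -> R) :
  fpsd f -> fpsd g -> fpsd (fun x y => f x y * g x y).
Proof.
move=> fP [gsym gpos]; have [s sE] := fpsd_gram fP.
split=> [x y|c]; first by rewrite gsym (proj1 fP).
rewrite (eq_bigr (fun x => \sum_(b <- s) \sum_y
    (c x * b x) * g x y * (c y * b y))) => [|x _].
  by rewrite exchange_big; apply: sumr_ge0 => b _; apply: gpos.
rewrite exchange_big; apply: eq_bigr => y _ /=.
rewrite sE mulr_suml mulr_sumr mulr_suml; apply: eq_bigr => b _; ring.
Qed.

(** The form at [c] is the form of [f] at the push-forward of [c], its sums over the fibres of
    [p]. *)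
Lemma fpsd_pull (T S : finType) (f : T -> T -> R) (p : S -> T) :
  fpsd f -> fpsd (fun x y => f (p x) (p y)).
Proof.
case=> fsym fpos; split=> // c.
have fib (F : S -> R) : \sum_x \sum_(s | p s == x) F s = \sum_s F s.
  by rewrite [RHS](partition_big p xpredT).
have := fpos (fun x => \sum_(s | p s == x) c s).
congr (0 <= _); transitivity (\sum_x \sum_(s | p s == x) \sum_y
    \sum_(s' | p s' == y) c s * f (p s) (p s') * c s').
  apply: eq_bigr => x _; rewrite exchange_big; apply: eq_bigr => y _ /=.
  rewrite -mulrA mulr_suml; apply: eq_bigr => s /eqP <-.
  rewrite mulrA mulr_sumr; apply: eq_bigr => s' /eqP <-; ring.
by rewrite fib; apply: eq_bigr => s _; rewrite fib.
Qed.

Lemma fpsd_sum_snd (T S : finType) (f : T * S -> T * S -> R) :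
  fpsd f -> fpsd (fun x y => \sum_s \sum_s' f (x, s) (y, s')).
Proof.
case=> fsym fpos; split=> [x y|c].
  by rewrite exchange_big; apply: eq_bigr => s _; apply: eq_bigr.
have := fpos (fun p => c p.1); congr (0 <= _).
rewrite sum_pair; apply: eq_bigr => x _ /=.
transitivity (\sum_s \sum_y \sum_s' c x * f (x, s) (y, s') * c y).
  by apply: eq_bigr => s _; rewrite sum_pair.
rewrite exchange_big; apply: eq_bigr => y _ /=.
by rewrite mulr_sumr mulr_suml; apply: eq_bigr => s _;
  rewrite mulr_sumr mulr_suml.
Qed.

(* [Z] commutes with [M], so [M = M Z^-1 M]. *)
Lemma psd_of_square (n : nat) (M Z : 'M[R]_n) :
  M^T = M -> Z^T = Z -> M *m M = Z *m M ->
  (forall v : 'cV[R]_n, v != 0 -> 0 < (v^T *m Z *m v) 0 0) -> psd M.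
Proof.
move=> MT ZT MZ Zpos; split=> // v.
have Zu : Z \in unitmx.
  rewrite -row_free_unit -kermx_eq0; apply/eqP/row_matrixP => i.
  rewrite row0; apply/eqP; apply: contraT => ri.
  have := Zpos (row i (kermx Z))^T; rewrite trmxK trmx_eq0 => /(_ ri).
  have /sub_kermxP -> : (row i (kermx Z) <= kermx Z)%MS by apply: row_sub.
  by rewrite mul0mx mxE ltxx.
have ZM : Z *m M = M *m Z.
  by rewrite -MZ; have := congr1 trmx MZ; rewrite !trmx_mul MT ZT.
pose u := invmx Z *m (M *m v).
have uE : Z *m u = M *m v by rewrite mulKVmx.
have key : M *m invmx Z *m M = M.
  have <- : invmx Z *m M = M *m invmx Z.
    by rewrite -{2}(mulKmx Zu M) ZM !mulmxA mulmxK.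
  by rewrite -mulmxA MZ mulKmx.
have -> : v^T *m M *m v = u^T *m Z *m u.
  rewrite -[in RHS]mulmxA uE /u !trmx_mul trmx_inv MT ZT.
  by rewrite -{1}key !mulmxA.
have [->|u0] := eqVneq u 0; last by rewrite ltW ?Zpos.
by rewrite mulmx0 mxE.
Qed.
End Kernels.

(** * Tuples and matrices indexed by finite types *)

Section Tuples.
Implicit Types (T A B : Type).

Lemma flsubE T m n (w : {ffun 'I_(m + n) -> T}) i : flsub w i = w (lshift n i).
Proof. exact: ffunE. Qed.

Lemma frsubE T m n (w : {ffun 'I_(m + n) -> T}) i : frsub w i = w (rshift m i).
Proof. exact: ffunE. Qed.

Lemma fpermE T n (s : 'S_n) (w : {ffun 'I_n -> T}) i : fperm s w i = w (s i).
Proof. exact: ffunE. Qed.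

Lemma flsub_fcat T m n (u : {ffun 'I_m -> T}) (v : {ffun 'I_n -> T}) :
  flsub (fcat u v) = u.
Proof.
apply/ffunP => i; rewrite !ffunE; case: splitP => j /= ij.
  by congr (u _); apply: val_inj.
by have := ltn_ord i; rewrite ij ltnNge leq_addr.
Qed.

Lemma frsub_fcat T m n (u : {ffun 'I_m -> T}) (v : {ffun 'I_n -> T}) :
  frsub (fcat u v) = v.
Proof.
apply/ffunP => i; rewrite !ffunE; case: splitP => [j|j] /= ij.
  by have := ltn_ord j; rewrite -ij ltnNge leq_addr.
by congr (v _); apply/val_inj/(@addnI m).
Qed.

Lemma fcat_lshift T m n (u : {ffun 'I_m -> T}) (v : {ffun 'I_n -> T}) i :
  fcat u v (lshift n i) = u i.
Proof. by rewrite -flsubE flsub_fcat. Qed.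

Lemma fcat_rshift T m n (u : {ffun 'I_m -> T}) (v : {ffun 'I_n -> T}) i :
  fcat u v (rshift m i) = v i.
Proof. by rewrite -frsubE frsub_fcat. Qed.

Lemma fcat_sub T m n (w : {ffun 'I_(m + n) -> T}) :
  fcat (flsub w) (frsub w) = w.
Proof.
apply/ffunP => i; rewrite ffunE; case: splitP => j ij; rewrite ffunE;
  by congr (w _); apply: val_inj.
Qed.

Lemma fpermM T n (s r : 'S_n) (w : {ffun 'I_n -> T}) :
  fperm s (fperm r w) = fperm (s * r)%g w.
Proof. by apply/ffunP => i; rewrite !ffunE permM. Qed.

Lemma fperm1 T n (w : {ffun 'I_n -> T}) : fperm 1%g w = w.
Proof. by apply/ffunP => i; rewrite ffunE perm1. Qed.

Definition ffst A B n (p : {ffun 'I_n -> A * B}) : {ffun 'I_n -> A} :=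
  [ffun i => (p i).1].
Definition fsnd A B n (p : {ffun 'I_n -> A * B}) : {ffun 'I_n -> B} :=
  [ffun i => (p i).2].

Lemma ffstE A B n (p : {ffun 'I_n -> A * B}) i : ffst p i = (p i).1.
Proof. exact: ffunE. Qed.

Lemma fsndE A B n (p : {ffun 'I_n -> A * B}) i : fsnd p i = (p i).2.
Proof. exact: ffunE. Qed.

Lemma fpair_eta A B n (p : {ffun 'I_n -> A * B}) : fpair (ffst p) (fsnd p) = p.
Proof. by apply/ffunP => i; rewrite !ffunE -surjective_pairing. Qed.

Lemma ffst_fpair A B n (g : {ffun 'I_n -> A}) (h : {ffun 'I_n -> B}) :
  ffst (fpair g h) = g.
Proof. by apply/ffunP => i; rewrite !ffunE. Qed.

Lemma fsnd_fpair A B n (g : {ffun 'I_n -> A}) (h : {ffun 'I_n -> B}) :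
  fsnd (fpair g h) = h.
Proof. by apply/ffunP => i; rewrite !ffunE. Qed.

Lemma fcat_fpair A B m n (g : {ffun 'I_m -> A}) (h : {ffun 'I_m -> B})
    (g' : {ffun 'I_n -> A}) (h' : {ffun 'I_n -> B}) :
  fcat (fpair g h) (fpair g' h') = fpair (fcat g g') (fcat h h').
Proof. by apply/ffunP => i; rewrite !ffunE; case: split => j;
  rewrite ffunE. Qed.

Lemma fpair_fcat A B m n (w : {ffun 'I_(m + n) -> A})
    (w' : {ffun 'I_(m + n) -> B}) :
  (flsub (fpair w w') = fpair (flsub w) (flsub w')) *
  (frsub (fpair w w') = fpair (frsub w) (frsub w')).
Proof. by split; apply/ffunP => i; rewrite !ffunE. Qed.

Lemma ffst_fcat A B m n (w : {ffun 'I_(m + n) -> A * B}) :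
  (ffst (flsub w) = flsub (ffst w)) * (ffst (frsub w) = frsub (ffst w)).
Proof. by split; apply/ffunP => i; rewrite !ffunE. Qed.

Lemma fsnd_fcat A B m n (w : {ffun 'I_(m + n) -> A * B}) :
  (fsnd (flsub w) = flsub (fsnd w)) * (fsnd (frsub w) = frsub (fsnd w)).
Proof. by split; apply/ffunP => i; rewrite !ffunE. Qed.

Lemma ffst_fperm A B n (s : 'S_n) (w : {ffun 'I_n -> A * B}) :
  ffst (fperm s w) = fperm s (ffst w).
Proof. by apply/ffunP => i; rewrite !ffunE. Qed.

Lemma fsnd_fperm A B n (s : 'S_n) (w : {ffun 'I_n -> A * B}) :
  fsnd (fperm s w) = fperm s (fsnd w).
Proof. by apply/ffunP => i; rewrite !ffunE. Qed.

Lemma fperm_fpair A B n (s : 'S_n) (g : {ffun 'I_n -> A}) (h : {ffun 'I_n ->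
  B}) :
  fperm s (fpair g h) = fpair (fperm s g) (fperm s h).
Proof. by apply/ffunP => i; rewrite !ffunE. Qed.
End Tuples.

Lemma eq_fcat (T : eqType) m n (v w : {ffun 'I_(m + n) -> T}) :
  (v == w) = (flsub v == flsub w) && (frsub v == frsub w).
Proof.
apply/eqP/andP => [->//|[/eqP vwl /eqP vwr]].
by rewrite -[v]fcat_sub vwl vwr fcat_sub.
Qed.

Lemma eq_fperm (T : eqType) n (s : 'S_n) (v w : {ffun 'I_n -> T}) :
  (fperm s v == fperm s w) = (v == w).
Proof.
by rewrite (can_eq (g := fperm s^-1)) // => z; rewrite fpermM mulVg fperm1.
Qed.

Lemma ffun_neq (A : finType) (B : eqType) (f g : {ffun A -> B}) :
  f != g -> exists k, f k != g k.
Proof.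
move=> fg; apply/existsP; apply: contraR fg => /existsPn fg.
by apply/eqP/ffunP => k; apply/eqP/negbNE/fg.
Qed.

Lemma sum_fcat (M : nmodType) (T : finType) m n (F : {ffun 'I_(m + n) ->
  T} -> M) :
  \sum_w F w = \sum_u \sum_v F (fcat u v).
Proof.
rewrite -(sum_pair (fun p => F (fcat p.1 p.2))).
rewrite (reindex (fun p : {ffun 'I_m -> T} * {ffun 'I_n ->
  T} => fcat p.1 p.2)) //.
exists (fun w => (flsub w, frsub w)) => [[u v] _|w _] /=.
  by rewrite flsub_fcat frsub_fcat.
by rewrite fcat_sub.
Qed.

Lemma sum_fpair (M : nmodType) (A B : finType) n (F : {ffun 'I_n -> A * B} ->
  M) :
  \sum_p F p = \sum_g \sum_h F (fpair g h).
Proof.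
rewrite -(sum_pair (fun p => F (fpair p.1 p.2))).
rewrite (reindex (fun p : {ffun 'I_n -> A} * {ffun 'I_n ->
  B} => fpair p.1 p.2)) //.
exists (fun p => (ffst p, fsnd p)) => [[u v] _|w _] /=.
  by rewrite ffst_fpair fsnd_fpair.
by rewrite fpair_eta.
Qed.

Lemma sum_fperm (M : nmodType) (T : finType) n (s : 'S_n)
    (F : {ffun 'I_n -> T} -> M) :
  \sum_w F (fperm s w) = \sum_w F w.
Proof.
rewrite [RHS](reindex (fperm s)) //.
by exists (fperm s^-1) => w _; rewrite fpermM ?mulgV ?mulVg fperm1.
Qed.

Section Entries.
Variable S : finType.

Lemma entry_mx_of K (f : S -> S -> K) x y : entry (mx_of f) x y = f x y.
Proof. by rewrite /entry mxE !enum_rankK. Qed.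

Lemma entry_inj K (A B : 'M[K]_#|S|) :
  (forall x y, entry A x y = entry B x y) -> A = B.
Proof.
move=> AB; apply/matrixP => i j.
by have := AB (enum_val i) (enum_val j); rewrite /entry !enum_valK.
Qed.

Lemma entry_mul (K : pzSemiRingType) (A B : 'M[K]_#|S|) x y :
  entry (A *m B) x y = \sum_z entry A x z * entry B z y.
Proof.
rewrite /entry mxE (reindex enum_rank) //.
by exists enum_val => z _; rewrite ?enum_rankK ?enum_valK.
Qed.

Lemma entry_schur (K : pzRingType) (A B : 'M[K]_#|S|) x y :
  entry (schur A B) x y = entry A x y * entry B x y.
Proof. by rewrite /entry mxE. Qed.

Lemma entry_lin (K : pzRingType) a (A B : 'M[K]_#|S|) x y :
  entry (a *: A + B) x y = a * entry A x y + entry B x y.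
Proof. by rewrite /entry !mxE. Qed.

Lemma entry_const K (a : K) (x y : S) : entry (const_mx a) x y = a.
Proof. by rewrite /entry mxE. Qed.

Lemma entry_1 (K : pzRingType) (x y : S) :
  entry (1%:M : 'M[K]_#|S|) x y = (x == y)%:R.
Proof. by rewrite /entry mxE (inj_eq enum_rank_inj). Qed.

Lemma entry_delta (K : pzRingType) (g g' x y : S) :
  entry (delta_mx (enum_rank g) (enum_rank g') : 'M[K]_#|S|) x y =
  ((x == g) && (y == g'))%:R.
Proof. by rewrite /entry mxE !(inj_eq enum_rank_inj). Qed.

Lemma entry_tr K (A : 'M[K]_#|S|) x y : entry A^T x y = entry A y x.
Proof. by rewrite /entry mxE. Qed.
End Entries.

Lemma entry_tact K t (V : finType) (s : 'S_(t + t))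
    (A : 'M[K]_#|{ffun 'I_t -> V}|) (w : {ffun 'I_(t + t) -> V}) :
  entry (tact s A) (flsub w) (frsub w) =
  entry A (flsub (fperm s^-1 w)) (frsub (fperm s^-1 w)).
Proof. by rewrite entry_mx_of fcat_sub. Qed.

Lemma entry_inj_cat K t (V : finType) (A B : 'M[K]_#|{ffun 'I_t -> V}|) :
  (forall w : {ffun 'I_(t + t) -> V},
    entry A (flsub w) (frsub w) = entry B (flsub w) (frsub w)) -> A = B.
Proof.
move=> AB; apply: entry_inj => u v.
by have := AB (fcat u v); rewrite flsub_fcat frsub_fcat.
Qed.

Section PsdMatrices.
Variable R : realType.

Lemma psd_fpsd n (M : 'M[R]_n) : psd M <-> fpsd (fun i j => M i j).
Proof.
have QE (v : 'cV[R]_n) : (v^T *m M *m v) 0 0 =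
    \sum_i \sum_j v i 0 * M i j * v j 0.
  rewrite mxE exchange_big; apply: eq_bigr => j _ /=.
  by rewrite mxE mulr_suml; apply: eq_bigr => i _; rewrite mxE.
split=> -[Msym Mpos]; split.
- by move=> i j; rewrite -[in LHS]Msym mxE.
- move=> c; have := Mpos (\col_i c i); rewrite QE; congr (0 <= _).
  by apply: eq_bigr => i _; apply: eq_bigr => j _; rewrite !mxE.
- by apply/matrixP => i j; rewrite mxE.
- by move=> v; rewrite QE; apply: Mpos.
Qed.

Lemma psd_mx_of (S : finType) (f : S -> S -> R) : psd (mx_of f) <-> fpsd f.
Proof.
split=> [/psd_fpsd MP|fP].
  have := fpsd_pull (@enum_rank S) MP.
  by congr (fpsd _); apply/funext => x; apply/funext => y;
    rewrite mxE !enum_rankK.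
apply/psd_fpsd; have := fpsd_pull (@enum_val S predT) fP.
by congr (fpsd _); apply/funext => i; apply/funext => j; rewrite mxE.
Qed.
End PsdMatrices.

(** * Counting homomorphisms *)

Section Homomorphisms.
Variable t : nat.
Implicit Types (F : bgraph t) (G : graph).

Definition labelled_hom F G (x y : {ffun 'I_t -> G}) (h : {ffun soe F -> G}) :
    bool :=
  is_hom h && [forall i, (h (inlab F i) == x i) && (h (outlab F i) == y i)].

Definition hcount F G (x y : {ffun 'I_t -> G}) : nat :=
  #|[set h | labelled_hom (F := F) x y h]|.

Lemma entry_htensor (K : pzRingType) F G x y :
  entry (htensor K F G) x y = (hcount F x y)%:R.
Proof. by rewrite entry_mx_of. Qed.

Lemma labelsP F G (x y : {ffun 'I_t -> G}) (h : {ffun soe F -> G}) :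
  reflect ((forall i, h (inlab F i) = x i) /\ (forall i, h (outlab F i) = y i))
    [forall i, (h (inlab F i) == x i) && (h (outlab F i) == y i)].
Proof.
apply: (iffP forallP) => [xy|[hx hy] i]; last by rewrite hx hy !eqxx.
by split=> i; have /andP[/eqP ? /eqP ?] := xy i.
Qed.

Lemma is_homP (F G : graph) (h : {ffun F -> G}) :
  reflect (forall x y, edge x y -> edge (h x) (h y)) (is_hom h).
Proof.
apply: (iffP forallP) => [hP x y|hP x]; first by move/forallP: (hP x) =>
  /(_ y)/implyP.
by apply/forallP => y; apply/implyP/hP.
Qed.

Lemma hom_sum_hcount F G : Defs.hom (soe F) G = (\sum_x \sum_y hcount (G := G) F
  x y)%N.
Proof.
rewrite -(sum_pair (fun p => hcount F p.1 p.2)) /Defs.hom -sum1_card.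
rewrite (partition_big (fun h : {ffun soe F -> G} =>
  ([ffun i => h (inlab F i)], [ffun i => h (outlab F i)])) xpredT) //=.
apply: eq_bigr => -[x y] _; rewrite sum1_card; apply: eq_card => h.
rewrite !inE unfold_in /= !inE; congr (_ && _).
rewrite xpair_eqE; apply/andP/labelsP => -[].
  by move=> /eqP/ffunP hx /eqP/ffunP hy; split=> i; rewrite -?hx -?hy ffunE.
by move=> hx hy; split; apply/eqP/ffunP => i; rewrite ffunE.
Qed.

(** A homomorphism out of a quotient is a homomorphism constant on classes. The predicate [P] is
    carried along so that label conditions are transferred too. *)
Lemma card_hom_glue (F G : graph) (e : rel F) (P : pred {ffun F -> G}) :
  #|[set h : {ffun glue e -> G} | is_hom h && P [ffun x => h (glue_map e x)]]| =
  #|[set f : {ffun F -> G} | [&& is_hom f,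
      [forall x, forall y, e x y ==> (f x == f y)] & P f]]|.
Proof.
pose lift (h : {ffun glue e -> G}) := [ffun x => h (glue_map e x)].
pose rep (q : glue e) : F :=
  generic_quotient.repr (q : {eq_quot (glue_equiv e)}%qT).
have mapK (q : glue e) : glue_map e (rep q) = q by apply: reprK.
have lift_inj : injective lift.
  by move=> h h' /ffunP hh; apply/ffunP => q; move: (hh (rep q));
    rewrite !ffunE mapK.
have mapE x y : e x y -> glue_map e x = glue_map e y.
  by move=> exy; apply/eqmodP/connect1; rewrite /= exy.
rewrite -(card_imset _ lift_inj); apply: eq_card => f; rewrite [RHS]inE.
apply/imsetP/and3P => [[h]|[fhom fe Pf]].
  rewrite inE => /andP[/is_homP hhom Ph] ->; split=> //.
    apply/is_homP => x y xy; rewrite !ffunE; apply: hhom.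
    by apply/existsP; exists x; apply/existsP; exists y; rewrite !eqxx.
  apply/forallP => x; apply/forallP => y; apply/implyP => exy.
  by rewrite !ffunE (mapE _ _ exy).
(* Only generating pairs are known to have equal images, so equality within a class follows a path
   that uses them in both directions. *)
have fglue x : f (rep (glue_map e x)) = f x.
  have : glue_rel e (rep (glue_map e x)) x.
    by apply/(@eqmodP _ (glue_equiv e)); apply: mapK.
  move: (rep _) => z /connectP[p]; elim: p z => [|y p IHp] z /= => [_ ->//|].
  move=> /andP[zy yp] xE; rewrite -(IHp y yp xE); apply/eqP.
  move/forallP: fe => fe; case/orP: zy => ezy.
    by move/forallP: (fe z) => /(_ y); rewrite ezy.
  by move/forallP: (fe y) => /(_ z); rewrite ezy eq_sym.
have liftE : lift [ffun q => f (rep q)] = f.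
  by apply/ffunP => x; rewrite !ffunE fglue.
exists [ffun q => f (rep q)]; last by rewrite liftE.
rewrite inE -/(lift _) liftE Pf andbT; apply/is_homP => p q.
case/existsP => x /existsP[y /and3P[/eqP <- /eqP <- xy]].
by rewrite !ffunE !fglue; move/is_homP: fhom; apply.
Qed.

Lemma card_hom_dunion (F F' G : graph)
    (P : {ffun F -> G} -> {ffun F' -> G} -> bool) :
  #|[set f : {ffun dunion F F' -> G} |
      is_hom f && P [ffun x => f (inl x)] [ffun x => f (inr x)]]| =
  #|[set p : {ffun F -> G} * {ffun F' -> G} |
      [&& is_hom p.1, is_hom p.2 & P p.1 p.2]]|.
Proof.
pose parts (f : {ffun dunion F F' -> G}) : {ffun F -> G} * {ffun F' -> G} :=
  ([ffun x => f (inl x)], [ffun x => f (inr x)]).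
have parts_inj : injective parts.
  move=> f f' [/ffunP fl /ffunP fr]; apply/ffunP => -[x|x].
    by move: (fl x); rewrite !ffunE.
  by move: (fr x); rewrite !ffunE.
rewrite -(card_imset _ parts_inj); apply: eq_card => -[a b];
  rewrite [RHS]inE /=.
apply/imsetP/and3P => [[f]|[ahom bhom Pab]].
  rewrite inE => /andP[/is_homP fhom Pf] [-> ->]; split=> //;
    by apply/is_homP => x y xy; rewrite !ffunE; apply: fhom.
pose f : {ffun dunion F F' -> G} :=
  [ffun x => match x with inl x => a x | inr x => b x end].
have fE : parts f = (a, b).
  by congr (_, _); apply/ffunP => x; rewrite !ffunE.
exists f; last by rewrite fE.
case: fE => fl fr; rewrite inE fl fr Pab andbT; apply/is_homP.
move=> [x|x] [y|y] //= xy; rewrite !ffunE;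
  [move/is_homP: ahom | move/is_homP: bhom]; exact.
Qed.

(** The identified labels have a common image tuple [z]; sorting pairs of homomorphisms by it yields
    the entry of a matrix product. *)
Lemma hcount_series F F' G (x y : {ffun 'I_t -> G}) :
  hcount (series F F') x y = (\sum_z hcount F x z * hcount F' z y)%N.
Proof.
pose P (f : {ffun soe F -> G}) (f' : {ffun soe F' -> G}) :=
  [&& [forall i, f (outlab F i) == f' (inlab F' i)],
      [forall i, f (inlab F i) == x i] & [forall i, f' (outlab F' i) == y i]].
transitivity #|[set p : {ffun soe F -> G} * {ffun soe F' -> G} |
      [&& is_hom p.1, is_hom p.2 & P p.1 p.2]]|.
  rewrite -card_hom_dunion.
  pose Q (f : {ffun dunion (soe F) (soe F') -> G}) :=
    [forall i, (f (inl (inlab F i)) == x i) && (f (inr (outlab F' i)) == y i)].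
  transitivity #|[set f : {ffun dunion (soe F) (soe F') -> G} |
    [&& is_hom f, [forall a, forall b, series_ident a b ==> (f a == f b)] &
      Q f]]|.
    rewrite -card_hom_glue; apply: eq_card => h; rewrite !inE; congr (_ && _).
    by apply: eq_forallb => i; rewrite !ffunE.
  apply: eq_card => f; rewrite !inE; congr (_ && _).
  apply/andP/and3P => [[/forallP fe /forallP fQ]|].
    split; apply/forallP => i; rewrite !ffunE.
    - have /forallP/(_ (inr (inlab F' i)))/implyP := fe (inl (outlab F i)).
      by apply; apply/existsP; exists i; rewrite !eqxx.
    - by have /andP[] := fQ i.
    - by have /andP[] := fQ i.
  move=> [/forallP fe /forallP fx /forallP fy]; split.
    apply/forallP => a; apply/forallP => b; apply/implyP => /existsP[k].
    by case/andP => /eqP -> /eqP ->; move: (fe k); rewrite !ffunE.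
  by apply/forallP => i; move: (fx i) (fy i); rewrite !ffunE => -> ->.
rewrite -sum1_card (partition_big (fun p : {ffun soe F ->
  G} * {ffun soe F' -> G} =>
  [ffun i => p.1 (outlab F i)]) xpredT) //=.
apply: eq_bigr => z _; rewrite sum1_card -cardsX; apply: eq_card => -[a b].
rewrite !inE unfold_in /= !inE /=; apply/idP/idP.
  case/andP => /and3P[ahom bhom /and3P[/forallP ab /forallP ax /forallP bx]].
  move=> /eqP/ffunP az; apply/andP; split; apply/andP; split=> //;
    apply/labelsP.
    by split=> i; [apply/eqP | rewrite -az ffunE].
  by split=> i; [rewrite -az ffunE; apply/esym/eqP | apply/eqP].
move=> /andP[/andP[ahom /labelsP[ax az]] /andP[bhom /labelsP[bz yb]]].
apply/andP; split; last by apply/eqP/ffunP => i; rewrite ffunE.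
by apply/and3P; split=> //; apply/and3P; split; apply/forallP => i;
  rewrite ?ax ?az ?bz ?yb.
Qed.

(** Gluing amounts to prescribing the same images [x], [y] for the labels of [F'], so the count
    factors. *)
Lemma hcount_parallel F F' G (x y : {ffun 'I_t -> G}) :
  hcount (parallel F F') x y = (hcount F x y * hcount F' x y)%N.
Proof.
pose P (f : {ffun soe F -> G}) (f' : {ffun soe F' -> G}) :=
  [forall i, (f (inlab F i) == x i) && (f (outlab F i) == y i)] &&
  [forall i, (f' (inlab F' i) == x i) && (f' (outlab F' i) == y i)].
transitivity #|[set p : {ffun soe F -> G} * {ffun soe F' -> G} |
      [&& is_hom p.1, is_hom p.2 & P p.1 p.2]]|; last first.
  rewrite -cardsX; apply: eq_card => -[a b]; rewrite !inE /=.
  by rewrite andbACA andbA.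
rewrite -card_hom_dunion.
pose Q (f : {ffun dunion (soe F) (soe F') -> G}) :=
  [forall i, (f (inl (inlab F i)) == x i) && (f (inl (outlab F i)) == y i)].
transitivity #|[set f : {ffun dunion (soe F) (soe F') -> G} |
  [&& is_hom f, [forall a, forall b, parallel_ident a b ==> (f a == f b)] &
    Q f]]|.
  rewrite -card_hom_glue; apply: eq_card => h; rewrite !inE; congr (_ && _).
  by apply: eq_forallb => i; rewrite !ffunE.
apply: eq_card => f; rewrite !inE; congr (_ && _).
apply/andP/andP => [[/forallP fe /forallP fQ]|].
  split; apply/forallP => i; rewrite !ffunE //.
  have /andP[/eqP <- /eqP <-] := fQ i; apply/andP; split; rewrite eq_sym.
    have /forallP/(_ (inr (inlab F' i)))/implyP := fe (inl (inlab F i)).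
    by apply; apply/existsP; exists i; rewrite !eqxx.
  have /forallP/(_ (inr (outlab F' i)))/implyP := fe (inl (outlab F i)).
  by apply; apply/existsP; exists i; rewrite !eqxx orbT.
move=> [/forallP fx /forallP fy]; split; last first.
  by apply/forallP => i; move: (fx i); rewrite !ffunE.
apply/forallP => a; apply/forallP => b; apply/implyP => /existsP[k].
move: (fx k) (fy k); rewrite !ffunE => /andP[/eqP fx1 /eqP fx2] /andP[/eqP fy1
  /eqP fy2].
by case/orP => /andP[/eqP -> /eqP ->]; rewrite ?fx1 ?fy1 ?fx2 ?fy2.
Qed.

Lemma hcount_act (s : 'S_(t + t)) F G (w : {ffun 'I_(t + t) -> G}) :
  hcount (bgraph_act s F) (flsub w) (frsub w) =
  hcount F (flsub (fperm s^-1 w)) (frsub (fperm s^-1 w)).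
Proof.
apply: eq_card => h; rewrite !inE /labelled_hom; congr (_ && _).
pose lab := fcat (inlab F) (outlab F).
transitivity [forall k, h (lab (s k)) == w k].
  apply/labelsP/forallP => /= [[hx hy] k|hk].
    have [j ->|j ->] := split_ordP k; [move: (hx j)|move: (hy j)];
      by rewrite ?flsubE ?frsubE fpermE => ->.
  by split=> i; rewrite ?flsubE ?frsubE fpermE; apply/eqP.
transitivity [forall k, h (lab k) == fperm s^-1 w k].
  apply/forallP/forallP => hk k.
    by move: (hk (s^-1%g k)); rewrite permKV fpermE.
  by move: (hk (s k)); rewrite fpermE permK.
apply/forallP/labelsP => [hk|[hx hy] k].
  split=> i; apply/eqP.
    by move: (hk (lshift t i)); rewrite fcat_lshift flsubE.
  by move: (hk (rshift t i)); rewrite fcat_rshift frsubE.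
have [j ->|j ->] := split_ordP k.
  by rewrite fcat_lshift hx flsubE.
by rewrite fcat_rshift hy frsubE.
Qed.

Lemma hcount_iso F F' G (x y : {ffun 'I_t -> G}) :
  bgraph_iso F F' -> hcount F x y = hcount F' x y.
Proof.
case=> f [[g fK gK] fedge fin fout].
pose comp (h : {ffun soe F' -> G}) : {ffun soe F -> G} := [ffun v => h (f v)].
have comp_inj : injective comp.
  by move=> h h' /ffunP hh; apply/ffunP => v; move: (hh (g v));
    rewrite !ffunE gK.
rewrite /hcount -(card_imset [set h | _ h] comp_inj); apply: eq_card => h.
rewrite [LHS]inE; apply/idP/imsetP => [/andP[/is_homP hhom /labelsP[hx hy]]|].
  exists [ffun v => h (g v)]; last by apply/ffunP => v; rewrite !ffunE fK.
  rewrite inE; apply/andP; split.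
    by apply/is_homP => a b ab; rewrite !ffunE; apply: hhom; rewrite -fedge !gK.
  by apply/labelsP; split=> i; rewrite ffunE -?fin -?fout fK.
case=> h'; rewrite inE => /andP[/is_homP hhom /labelsP[hx hy]] ->.
apply/andP; split.
  by apply/is_homP => a b ab; rewrite !ffunE; apply: hhom; rewrite fedge.
by apply/labelsP; split=> i; rewrite ffunE ?fin ?fout.
Qed.

Definition label_graph (adj : rel 'I_(t + t)) : graph :=
  @Graph 'I_(t + t) (fun i j => adj i j || adj j i) (fun i j => orbC _ _).

(** Each label position starts as a vertex of its own; [e] prescribes equalities and [adj]
    adjacencies, so the tensor is the 0/1 indicator that a tuple satisfies them. *)
Definition atom (e adj : rel 'I_(t + t)) : bgraph t :=
  @BGraph t (glue (F := label_graph adj) e)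
    [ffun i => glue_map (F := label_graph adj) e (lshift t i)]
    [ffun i => glue_map (F := label_graph adj) e (rshift t i)].

Lemma atom_atomic e adj : atomic (atom e adj).
Proof.
move=> q; rewrite -(reprK (q : {eq_quot (glue_equiv (F := label_graph adj)
  e)}%qT)).
move: (generic_quotient.repr _) => /= k.
by have [j ->|j ->] := split_ordP k; exists j; [left | right]; rewrite ffunE.
Qed.

Lemma hcount_atom e adj G (w : {ffun 'I_(t + t) -> G}) :
  hcount (atom e adj) (flsub w) (frsub w) =
  [forall i, forall j, (e i j ==> (w i == w j)) && (adj i j ==> edge (w i) (w
    j))].
Proof.
pose Q (f : {ffun label_graph adj -> G}) := [forall i, f i == w i].
transitivity #|[set f : {ffun label_graph adj -> G} |
  [&& is_hom f, [forall i, forall j, e i j ==> (f i == f j)] & Q f]]|.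
  rewrite -card_hom_glue; apply: eq_card => h; rewrite !inE; congr (_ && _).
  apply/labelsP/forallP => /= [[hx hy] k|hk].
    have [j ->|j ->] := split_ordP k; [move: (hx j)|move: (hy j)];
      by rewrite ?flsubE ?frsubE !ffunE => ->.
  by split=> i; [move: (hk (lshift t i))|move: (hk (rshift t i))];
    rewrite !ffunE => /eqP.
case: forallP => [ewP|]; last first.
  move=> ew; apply: eq_card0 => f; rewrite !inE; apply/negP.
  case/and3P => /is_homP fhom /forallP fe /forallP fw; apply: ew => i.
  apply/forallP => j; rewrite -!(eqP (fw _)); apply/andP; split.
    by have /forallP := fe i; apply.
  by apply/implyP => ij; apply: fhom; rewrite /= ij.
rewrite -[RHS](cards1 (w : {ffun label_graph adj -> G})).
apply: eq_card => f; rewrite !inE; apply/and3P/eqP => [[_ _ /forallP fw]|->].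
  by apply/ffunP => i; apply/eqP.
have wP i j : (e i j ==> (w i == w j)) && (adj i j ==> edge (w i) (w j)).
  by have /forallP := ewP i; apply.
split; last by apply/forallP.
  apply/is_homP => i j /orP[] ij.
    by have /andP[_] := wP i j; rewrite ij.
  by rewrite edge_sym; have /andP[_] := wP j i; rewrite ij.
by apply/forallP => i; apply/forallP => j; have /andP[] := wP i j.
Qed.

(** Every vertex is labelled, so the labels determine the homomorphism: the count is 0 or 1, and
    whether the forced map exists depends on the atomic type only. *)
Lemma hcount_atomic F (G H : graph) (w : {ffun 'I_(t + t) ->
  G}) (w' : {ffun 'I_(t + t) -> H}) :
  atomic F -> same_atp w w' ->
  hcount F (flsub w) (frsub w) = hcount F (flsub w') (frsub w').
Proof.
move=> Fat ww'.
pose lab := fcat (inlab F) (outlab F).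
have labP v : exists k, lab k == v.
  have [i [->|->]] := Fat v.
    by exists (lshift t i); rewrite fcat_lshift.
  by exists (rshift t i); rewrite fcat_rshift.
pose idx v := xchoose (labP v).
have idxK v : lab (idx v) = v by apply/eqP; apply: (xchooseP (labP v)).
have homE (K : graph) (u : {ffun 'I_(t + t) -> K}) h :
    labelled_hom (F := F) (flsub u) (frsub u) h =
    is_hom h && [forall k, h (lab k) == u k].
  congr (_ && _); apply/labelsP/forallP => [[hx hy] k|hk].
    have [j ->|j ->] := split_ordP k.
      by rewrite fcat_lshift hx flsubE.
    by rewrite fcat_rshift hy frsubE.
  split=> i; apply/eqP.
    by move: (hk (lshift t i)); rewrite fcat_lshift flsubE.
  by move: (hk (rshift t i)); rewrite fcat_rshift frsubE.
have le (K K' : graph) (u : {ffun 'I_(t + t) -> K}) (u' : {ffun 'I_(t + t) ->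
  K'}) :
    same_atp u u' ->
    (hcount F (flsub u) (frsub u) <= hcount F (flsub u') (frsub u'))%N.
  move=> uu'; rewrite {1}/hcount.
  have [->|[h0]] := set_0Vmem [set h | labelled_hom (F := F) (flsub u) (frsub u)
    h].
    by rewrite cards0.
  rewrite inE => h0P; apply: (@leq_trans 1).
    rewrite -(cards1 h0) subset_leq_card //; apply/subsetP => h.
    move: h0P; rewrite !inE !homE => /andP[_ /forallP h0w] /andP[_ /forallP hw].
    by apply/eqP/ffunP => v; rewrite -(idxK v) (eqP (hw _)) (eqP (h0w _)).
  (* [idx] chooses one label position per vertex; equality types make the choice agree with the
     other labels, edge types make it a homomorphism. *)
  rewrite card_gt0; apply/set0Pn; exists [ffun v => u' (idx v)].
  move: h0P; rewrite inE !homE => /andP[/is_homP h0hom /forallP h0w].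
  have uE v : u (idx v) = h0 v by rewrite -(eqP (h0w _)) idxK.
  apply/andP; split.
    apply/is_homP => a b ab; rewrite !ffunE; apply/(uu' _ _).2.
    by rewrite !uE; apply: h0hom.
  apply/forallP => k; rewrite ffunE; apply/eqP/(uu' _ _).1.
  by rewrite uE; apply/eqP.
apply/eqP; rewrite eqn_leq !le // => i j.
by have [? ?] := ww' i j; split; apply: iff_sym.
Qed.
End Homomorphisms.

(** * Doubly non-negative couplings *)

Section Couplings.
Variables (R : realType) (t : nat) (G H : graph).
Local Notation tup := {ffun 'I_t -> G * H}.

(* A level-[t] DNN-isomorphism matrix with real entries, condition (a) left
   out. *)
Record coupling (N : tup -> tup -> R) : Prop := Coupling {
  cpl_psd : fpsd N;
  cpl_ge0 : forall x y, 0 <= N x y;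
  cpl_sumG : forall h h', \sum_g \sum_g' N (fpair g h) (fpair g' h') = 1;
  cpl_sumH : forall g g', \sum_h \sum_h' N (fpair g h) (fpair g' h') = 1;
  cpl_atp : forall w : {ffun 'I_(t + t) -> G * H},
    ~ same_atp (ffst w) (fsnd w) -> N (flsub w) (frsub w) = 0;
  cpl_perm : forall (s : 'S_(t + t)) w,
    N (flsub (fperm s w)) (frsub (fperm s w)) = N (flsub w) (frsub w) }.

Lemma DNN_mx_of (N : tup -> tup -> R) :
  fpsd N -> (forall x y, 0 <= N x y) ->
  DNN (mx_of (fun x y => (N x y)%:C)).
Proof.
move=> NP N0; exists (mx_of N); split.
- by apply/matrixP => i j; rewrite !mxE.
- exact/psd_mx_of.
- by move=> i j; rewrite mxE.
Qed.

Lemma real_complex_inj : injective (@real_complex R).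
Proof. by move=> x y []. Qed.

Lemma ghentry_real (N : tup -> tup -> R) g h :
  ghentry (mx_of (fun x y : tup => (N x y)%:C)) g h =
  (N (flsub (fpair g h)) (frsub (fpair g h)))%:C.
Proof. by rewrite /ghentry entry_mx_of. Qed.

Lemma sum_pairs_fcat (N : tup -> tup -> R) (h : {ffun 'I_(t + t) -> H}) :
  \sum_g N (flsub (fpair g h)) (frsub (fpair g h)) =
  \sum_g \sum_g' N (fpair g (flsub h)) (fpair g' (frsub h)).
Proof.
rewrite sum_fcat; apply: eq_bigr => g _; apply: eq_bigr => g' _.
by rewrite !fpair_fcat flsub_fcat frsub_fcat.
Qed.

Lemma sum_pairs_fcatH (N : tup -> tup -> R) (g : {ffun 'I_(t + t) -> G}) :
  \sum_h N (flsub (fpair g h)) (frsub (fpair g h)) =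
  \sum_h \sum_h' N (fpair (flsub g) h) (fpair (frsub g) h').
Proof.
rewrite sum_fcat; apply: eq_bigr => h _; apply: eq_bigr => h' _.
by rewrite !fpair_fcat flsub_fcat frsub_fcat.
Qed.

Lemma level_isomorphic_coupling :
  level_isomorphic t G H (@DNN R) -> exists N : tup -> tup -> R, coupling N.
Proof.
case=> M [[M' [ME M'psd M'0]] _ [sumG sumH] Matp Mperm].
pose N x y := entry M' x y.
have MN : M = mx_of (fun x y : tup => (N x y)%:C).
  by apply: entry_inj => x y; rewrite entry_mx_of ME /entry mxE.
have NE g h : ghentry M g h = (N (flsub (fpair g h)) (frsub (fpair g h)))%:C.
  by rewrite MN ghentry_real.
exists N; split.
- by apply/psd_mx_of; have -> // : mx_of N = M'; apply: entry_inj => x y;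
    rewrite entry_mx_of.
- by move=> x y; apply: M'0.
- move=> h h'; have := sumG (fcat h h'); under eq_bigr do rewrite NE.
  rewrite -rmorph_sum => /(@real_complex_inj _ 1) /=.
  by rewrite sum_pairs_fcat flsub_fcat frsub_fcat.
- move=> g g'; have := sumH (fcat g g'); under eq_bigr do rewrite NE.
  rewrite -rmorph_sum => /(@real_complex_inj _ 1) /=.
  by rewrite sum_pairs_fcatH flsub_fcat frsub_fcat.
- move=> w /Matp; rewrite NE fpair_eta => /(@real_complex_inj _ 0) //.
- move=> s w; have := Mperm (ffst w) (fsnd w) s.
  by rewrite !NE -fperm_fpair fpair_eta => /real_complex_inj.
Qed.

(** * From a coupling to an isomorphism map *)

Section IsomorphismMap.
Variable N : tup -> tup -> R.
Hypothesis NP : coupling N.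

(** The linear map with Choi matrix [N]. *)
Definition coupling_map (X : 'M[R[i]]_#|{ffun 'I_t -> G}|) :
    'M[R[i]]_#|{ffun 'I_t -> H}| :=
  mx_of (fun h h' => \sum_g \sum_g'
    (N (fpair g h) (fpair g' h'))%:C * entry X g g').

Lemma entry_coupling_map X h h' : entry (coupling_map X) h h' =
  \sum_g \sum_g' (N (fpair g h) (fpair g' h'))%:C * entry X g g'.
Proof. exact: entry_mx_of. Qed.

Lemma coupling_map_linear : linear coupling_map.
Proof.
move=> a X Y; apply: entry_inj => h h'.
rewrite entry_lin !entry_coupling_map mulr_sumr -big_split;
  apply: eq_bigr => g _ /=.
rewrite mulr_sumr -big_split; apply: eq_bigr => g' _ /=.
by rewrite entry_lin mulrDr mulrCA.
Qed.

HB.instance Definition _ := GRing.isLinear.Build R[i] _ _ *:%R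
  coupling_map coupling_map_linear.

Lemma amplE m n (Phi : {linear 'M[R[i]]_m -> 'M[R[i]]_n}) r (X : 'M_(r * m)) a i
  b j :
  ampl Phi X (mxtens_index (a, i)) (mxtens_index (b, j)) =
  Phi (\matrix_(i, j) X (mxtens_index (a, i)) (mxtens_index (b, j))) i j.
Proof.
rewrite summxE (bigD1 a) //= summxE (bigD1 b) //= !big1 ?addr0; first last.
- by move=> b' b'b; rewrite tensmxE mxE [b == _]eq_sym (negbTE b'b) andbF mul0r.
- move=> a' a'a; rewrite summxE big1 // => b' _.
  by rewrite tensmxE mxE [a == _]eq_sym (negbTE a'a) mul0r.
by rewrite tensmxE mxE !eqxx mul1r.
Qed.

(** Up to reindexing, the amplified image is the Schur product of pullbacks of [N] and [X], with the
    [G] components of rows and columns summed out; each step keeps the matrix doubly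
    non-negative. *)
Lemma coupling_map_preserving : completely_preserving (@DNN R) coupling_map.
Proof.
move=> r X [X' [XE /psd_fpsd X'psd X'0]].
pose Y (p q : 'I_(r * #|{ffun 'I_t -> H}|)) : R :=
  let: (a, i) := mxtens_unindex p in let: (b, j) := mxtens_unindex q in
  \sum_g \sum_g' N (fpair g (enum_val i)) (fpair g' (enum_val j)) *
    X' (mxtens_index (a, enum_rank g)) (mxtens_index (b, enum_rank g')).
exists (\matrix_(p, q) Y p q); split.
- apply/matrixP => p q; case: (mxtens_indexP p) => a i.
  case: (mxtens_indexP q) => b j; rewrite amplE !mxE /Y !mxtens_indexK.
  rewrite rmorph_sum; apply: eq_bigr => g _.
  rewrite rmorph_sum; apply: eq_bigr => g' _.
  by rewrite rmorphM /entry mxE XE mxE.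
- apply/psd_fpsd.
  pose pr1 (z : 'I_(r * #|{ffun 'I_t -> H}|) * {ffun 'I_t -> G}) :=
    fpair z.2 (enum_val (mxtens_unindex z.1).2).
  pose pr2 (z : 'I_(r * #|{ffun 'I_t -> H}|) * {ffun 'I_t -> G}) :=
    mxtens_index ((mxtens_unindex z.1).1, enum_rank z.2).
  have := fpsd_sum_snd (fpsd_schur (fpsd_pull pr1 (cpl_psd NP)) (fpsd_pull pr2
    X'psd)).
  congr fpsd; apply/funext => p; apply/funext => q; rewrite mxE /Y /pr1 /pr2 /=.
  by case: (mxtens_unindex p) => a i; case: (mxtens_unindex q).
- move=> p q; rewrite mxE /Y; case: (mxtens_unindex p) => a i.
  case: (mxtens_unindex q) => b j.
  by do 2![apply: sumr_ge0 => ? _]; rewrite mulr_ge0 ?(cpl_ge0 NP).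
Qed.

Lemma coupling_atomic (A : bgraph t) g g' h h' : atomic A ->
  N (fpair g h) (fpair g' h') != 0 -> hcount A g g' = hcount A h h'.
Proof.
move=> Aat N0; have := @hcount_atomic _ A _ _ (fcat g g') (fcat h h') Aat.
rewrite !flsub_fcat !frsub_fcat; apply; apply/not_notP => atp.
case/eqP: N0; rewrite -(flsub_fcat (fpair g h) (fpair g' h')).
rewrite -[X in N _ X](frsub_fcat (fpair g h) (fpair g' h')) fcat_fpair.
by apply: (cpl_atp NP); rewrite ffst_fpair fsnd_fpair.
Qed.

Lemma coupling_map_isomorphism : is_isomorphism_map (@DNN R) coupling_map.
Proof.
split.
- exact: coupling_map_preserving.
- move=> A X Aat; apply: entry_inj => h h'.
  rewrite entry_schur !entry_coupling_map mulr_sumr; apply: eq_bigr => g _.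
  rewrite mulr_sumr; apply: eq_bigr => g' _.
  rewrite entry_schur !entry_htensor mulrCA.
  have [->|/(coupling_atomic Aat) ->//] := eqVneq (N (fpair g h) (fpair g' h'))
    0.
  by rewrite !(mul0r, mulr0).
- apply: entry_inj => h h'; rewrite entry_coupling_map entry_const.
  have := congr1 (@real_complex R) (cpl_sumG NP h h'); rewrite rmorph1 => E;
    rewrite -[RHS]E.
  rewrite rmorph_sum; apply: eq_bigr => g _; rewrite rmorph_sum.
  by apply: eq_bigr => g' _; rewrite entry_const mulr1.
- apply: entry_inj => g g'; rewrite entry_const /entry mxE innerE.
  have := congr1 (@real_complex R) (cpl_sumH NP g g'); rewrite rmorph1 => E;
    rewrite -[RHS]E.
  rewrite rmorph_sum (reindex enum_rank) /=; last first.
    by exists enum_val => z _; rewrite ?enum_rankK ?enum_valK.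
  apply: eq_bigr => h _; rewrite rmorph_sum (reindex enum_rank) /=; last first.
    by exists enum_val => z _; rewrite ?enum_rankK ?enum_valK.
  apply: eq_bigr => h' _; rewrite mxE mul1r.
  rewrite -/(entry _ h h') entry_coupling_map (bigD1 g) //= (bigD1 g') //=.
  rewrite entry_delta !eqxx /= mulr1 !big1 ?addr0 /=.
  + by rewrite geC0_conj // lecR (cpl_ge0 NP).
  + move=> g2 /negbTE gg; apply: big1 => g3 _.
    by rewrite entry_delta gg mulr0.
  + by move=> g3 /negbTE gg; rewrite entry_delta gg andbF mulr0.
- move=> s X; apply: entry_inj_cat => w.
  rewrite entry_tact !entry_coupling_map.
  pose F (w : {ffun 'I_(t + t) -> H}) (X : 'M[R[i]]_#|{ffun 'I_t -> G}|)
    (v : {ffun 'I_(t + t) -> G}) :=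
    (N (flsub (fpair v w)) (frsub (fpair v w)))%:C * entry X (flsub v) (frsub
      v).
  have FE (X' : 'M[R[i]]_#|{ffun 'I_t -> G}|) (u : {ffun 'I_(t + t) ->
    H}) : \sum_g \sum_g'
      (N (fpair g (flsub u)) (fpair g' (frsub u)))%:C * entry X' g g' =
      \sum_v F u X' v.
    rewrite sum_fcat; apply: eq_bigr => g _; apply: eq_bigr => g' _.
    by rewrite /F !fpair_fcat flsub_fcat frsub_fcat.
  rewrite !FE -[RHS](sum_fperm s^-1); apply: eq_bigr => v _; rewrite /F.
  by rewrite entry_tact -fperm_fpair (cpl_perm NP).
Qed.
End IsomorphismMap.
End Couplings.

(** * Atoms that detect equality and adjacency *)

Section AtomicTypes.
Variable t : nat.
Implicit Types G H : graph.

Definition eq_atom (i j : 'I_(t + t)) : bgraph t :=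
  atom [rel a b | (a == i) && (b == j)] [rel a b | false].
Definition edge_atom (i j : 'I_(t + t)) : bgraph t :=
  atom [rel a b | false] [rel a b | (a == i) && (b == j)].
Definition I_atom : bgraph t :=
  atom [rel a b | [exists i, (a == lshift t i) && (b == rshift t i)]]
    [rel a b | false].
Definition J_atom : bgraph t := atom [rel a b | false] [rel a b | false].

Lemma hcount_eq_atom G i j (w : {ffun 'I_(t + t) -> G}) :
  hcount (eq_atom i j) (flsub w) (frsub w) = (w i == w j).
Proof.
rewrite hcount_atom; congr nat_of_bool; apply/forallP/idP => [|wij a].
  by move=> /(_ i)/forallP/(_ j); rewrite /= !eqxx andbT.
apply/forallP => b; rewrite andbT; apply/implyP.
by move=> /andP[/eqP -> /eqP ->].
Qed.

Lemma hcount_edge_atom G i j (w : {ffun 'I_(t + t) -> G}) :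
  hcount (edge_atom i j) (flsub w) (frsub w) = edge (w i) (w j).
Proof.
rewrite hcount_atom; congr nat_of_bool; apply/forallP/idP => [|wij a].
  by move=> /(_ i)/forallP/(_ j); rewrite /= !eqxx.
apply/forallP => b; apply/implyP.
by move=> /andP[/eqP -> /eqP ->].
Qed.

Lemma hcount_I G (x y : {ffun 'I_t -> G}) : hcount I_atom x y = (x == y).
Proof.
have := hcount_atom [rel a b | [exists i, (a == lshift t i) && (b == rshift t
  i)]]
  [rel a b | false] (fcat x y); rewrite flsub_fcat frsub_fcat => ->.
congr nat_of_bool; apply/forallP/eqP => [xy|-> a].
  apply/ffunP => i; have /forallP/(_ (rshift t i)) := xy (lshift t i).
  rewrite fcat_lshift fcat_rshift andbT => /implyP xyi; apply/eqP/xyi.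
  by apply/existsP; exists i; rewrite !eqxx.
apply/forallP => b; rewrite andbT; apply/implyP => /existsP[k].
by case/andP => /eqP -> /eqP ->; rewrite fcat_lshift fcat_rshift.
Qed.

Lemma hcount_J G (x y : {ffun 'I_t -> G}) : hcount J_atom x y = 1.
Proof.
have := hcount_atom [rel a b | false] [rel a b | false] (fcat x y).
rewrite flsub_fcat frsub_fcat => ->.
by case: forallP => // -[]a; apply/forallP.
Qed.

(** Converse of [hcount_atomic]: atoms with a single prescribed equality or edge already see the
    whole atomic type. *)
Lemma same_atp_atomic G H (w : {ffun 'I_(t + t) ->
  G}) (w' : {ffun 'I_(t + t) -> H}) :
  (forall A : bgraph t, atomic A ->
    hcount A (flsub w) (frsub w) = hcount A (flsub w') (frsub w')) ->
  same_atp w w'.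
Proof.
move=> ww' i j; have := ww' (eq_atom i j); have := ww' (edge_atom i j).
rewrite !hcount_eq_atom !hcount_edge_atom.
move=> /(_ (@atom_atomic _ _ _)) edgeE /(_ (@atom_atomic _ _ _)) eqE.
split; last by move: edgeE; do 2![case: edge].
by move: eqE; case: eqP => wij; case: eqP.
Qed.
End AtomicTypes.

(** * From an isomorphism map back to a coupling *)

Section IsomorphismMapCoupling.
Variables (R : realType) (t : nat) (G H : graph).
Variable Phi : {linear 'M[R[i]]_#|{ffun 'I_t -> G}| ->
                       'M[R[i]]_#|{ffun 'I_t -> H}|}.

Lemma fpsd_rank1 (T : finType) (u : T -> R) : fpsd (fun x y => u x * u y).
Proof.
split=> [x y|c]; first by rewrite mulrC.
rewrite (_ : \sum_x _ = (\sum_x c x * u x) ^+ 2) ?sqr_ge0 //.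
rewrite expr2 mulr_suml; apply: eq_bigr => x _; rewrite mulr_sumr.
by apply: eq_bigr => y _; ring.
Qed.

Local Notation m := #|{ffun 'I_t -> G}|.

(* [N] is the Choi matrix of [Phi]. *)
Lemma isomorphism_map_coupling : is_isomorphism_map (@DNN R) Phi ->
  exists N : {ffun 'I_t -> G * H} -> {ffun 'I_t -> G * H} -> R, coupling N.
Proof.
case=> Ppsd Pschur PJ PadjJ Pact.
(* [u] is the sum of the vectors [e_i] tensor [e_i], so block [(a, b)] of [X] is the matrix unit at
   [(a, b)], and the amplification of [X] has the blocks [Phi (delta_mx a b)]. *)
pose u (p : 'I_(m * m)) : R :=
  ((mxtens_unindex p).1 == (mxtens_unindex p).2)%:R.
pose X := \matrix_(p, q) (u p * u q)%:C.
have [|N' [N'E /psd_fpsd N'psd N'0]] := Ppsd m X.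
  exists (\matrix_(p, q) (u p * u q)); split.
  - by apply/matrixP => p q; rewrite !mxE.
  - apply/psd_fpsd; have := fpsd_rank1 u; congr fpsd.
    by apply/funext => p; apply/funext => q; rewrite mxE.
  - by move=> p q; rewrite mxE mulr_ge0 // ler0n.
pose idx (x : {ffun 'I_t -> G * H}) :=
  mxtens_index (enum_rank (ffst x), enum_rank (fsnd x)).
pose N x y := N' (idx x) (idx y).
have NE x y : (N x y)%:C = entry
    (Phi (delta_mx (enum_rank (ffst x)) (enum_rank (ffst y)))) (fsnd x) (fsnd
      y).
  have := congr1 (fun M : 'M__ => M (idx x) (idx y)) N'E.
  rewrite amplE mxE => <-; rewrite /entry; congr (Phi _ _ _).
  apply/matrixP => i j; rewrite !mxE /u !mxtens_indexK /= -natrM mulnb.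
  by rewrite rmorph_nat ![_ == enum_rank _]eq_sym.
exists N; split.
- exact: (fpsd_pull idx N'psd).
- by move=> x y; apply: N'0.
- move=> h h'; apply: (@real_complex_inj R); rewrite rmorph1 -[RHS](entry_const
    1 h h').
  rewrite -PJ.
  have -> : const_mx 1 = \sum_(g : {ffun 'I_t -> G}) \sum_(g' : {ffun 'I_t ->
    G})
      delta_mx (enum_rank g) (enum_rank g') :> 'M[R[i]]_m.
    rewrite {1}[const_mx 1]matrix_sum_delta (reindex enum_rank) /=; last first.
      by exists enum_val => z _; rewrite ?enum_rankK ?enum_valK.
    apply: eq_bigr => g _; rewrite (reindex enum_rank) /=; last first.
      by exists enum_val => z _; rewrite ?enum_rankK ?enum_valK.
    by apply: eq_bigr => g' _; rewrite mxE scale1r.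
  rewrite rmorph_sum linear_sum /entry summxE; apply: eq_bigr => g _.
  rewrite rmorph_sum linear_sum summxE; apply: eq_bigr => g' _.
  by rewrite [LHS]NE !ffst_fpair !fsnd_fpair.
- move=> g g'; have := congr1 (fun M : 'M__ => M (enum_rank g) (enum_rank g'))
    PadjJ.
  rewrite !mxE innerE => E; apply: (@real_complex_inj R);
    rewrite rmorph1 -[RHS]E.
  rewrite [RHS](reindex enum_rank) /=; last first.
    by exists enum_val => z _; rewrite ?enum_rankK ?enum_valK.
  rewrite rmorph_sum; apply: eq_bigr => h _.
  rewrite [RHS](reindex enum_rank) /=; last first.
    by exists enum_val => z _; rewrite ?enum_rankK ?enum_valK.
  rewrite rmorph_sum; apply: eq_bigr => h' _.
  have := NE (fpair g h) (fpair g' h'); rewrite !ffst_fpair !fsnd_fpair /entry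
    mxE mul1r.
  by move=> <-; rewrite geC0_conj // lecR; apply: N'0.
- move=> w watp; apply/eqP; apply: contra_notT watp => N0.
  apply: same_atp_atomic => A Aat.
  (* On a matrix unit the Schur condition reads [A_G g g' * N = A_H h h' * N], so all atomic tensors
     agree where [N] is non-zero. *)
  have delta_schur (B : 'M[R[i]]_m) g g' :
      schur B (delta_mx g g') = B g g' *: delta_mx g g'.
    apply/matrixP => i j; rewrite !mxE.
    by case: eqP => [->|_]; [case: eqP => [->|_]|]; rewrite ?mulr0.
  have := Pschur A (delta_mx (enum_rank (ffst (flsub w))) (enum_rank (ffst
    (frsub w)))) Aat.
  rewrite delta_schur linearZ => /(congr1 (fun M =>
    entry M (fsnd (flsub w)) (fsnd (frsub w)))).
  rewrite entry_schur /entry mxE -!/(entry _ _ _) -NE.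
  rewrite !entry_htensor => /mulIf; rewrite fmorph_eq0 => /(_ N0)/eqP.
  by rewrite eqr_nat !ffst_fcat !fsnd_fcat => /eqP.
- move=> s w; apply: (@real_complex_inj R); rewrite !NE !ffst_fcat !fsnd_fcat.
  rewrite !ffst_fperm !fsnd_fperm.
  have -> : delta_mx (enum_rank (flsub (ffst w))) (enum_rank (frsub (ffst w))) =
    tact s^-1 (delta_mx (enum_rank (flsub (fperm s (ffst w))))
      (enum_rank (frsub (fperm s (ffst w))))) :> 'M[R[i]]_m.
    apply: entry_inj_cat => v; rewrite entry_tact invgK !entry_delta.
    by rewrite -!eq_fcat eq_fperm.
  by rewrite Pact entry_tact invgK.
Qed.
End IsomorphismMapCoupling.

(** * From couplings to t-equivalence *)

Section KernelFamilies.
Variables (R : realType) (T : finType) (f : T -> T -> R).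
Hypothesis fP : fpsd f.

(** The difference of the two combinations of Gram vectors has squared norm [c - 2 c + c = 0]. *)
Lemma fpsd_family_eq (K L : finType) (p : K -> T) (q : L -> T)
    (a : K -> R) (b : L -> R) (c : R) :
  \sum_k \sum_k' a k * a k' * f (p k) (p k') = c ->
  \sum_k \sum_l a k * b l * f (p k) (q l) = c ->
  \sum_l \sum_l' b l * b l' * f (q l) (q l') = c ->
  forall x, \sum_k a k * f (p k) x = \sum_l b l * f (q l) x.
Proof.
move=> aa ab bb x; have [fsym _] := fP.
(* The point [x] is added with coefficient 0, so that the kernel property can be evaluated there. *)
pose e (z : K + L + unit) :=
  match z with inl (inl k) => p k | inl (inr l) => q l | inr _ => x end.
pose w (z : K + L + unit) :=
  match z with inl (inl k) => a k | inl (inr l) => - b l | inr _ => 0 end.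
have sumE (F : K + L + unit -> R) : F (inr tt) = 0 ->
    \sum_z F z = \sum_k F (inl (inl k)) + \sum_l F (inl (inr l)).
  move=> F0; rewrite big_sumType /= big_sumType /= [X in _ + X]big1 ?addr0 //.
  by case.
have inner z : \sum_z' w z * f (e z) (e z') * w z' =
    w z * (\sum_k a k * f (e z) (p k) - \sum_l b l * f (e z) (q l)).
  rewrite sumE ?mulr0 //= mulrBr !mulr_sumr -sumrN.
  by congr (_ + _); apply: eq_bigr => y _; ring.
have w0 : \sum_z \sum_z' w z * f (e z) (e z') * w z' = 0.
  under eq_bigr do rewrite inner.
  rewrite sumE ?mul0r //=.
  rewrite (eq_bigr (fun k => (\sum_k' a k * a k' * f (p k) (p k')) -
      (\sum_l a k * b l * f (p k) (q l)))) => [|k _]; last first.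
    by rewrite mulrBr !mulr_sumr; congr (_ - _); apply: eq_bigr => y _; ring.
  rewrite sumrB aa ab subrr add0r.
  rewrite (eq_bigr (fun l => (\sum_l' b l * b l' * f (q l) (q l')) -
      (\sum_k a k * b l * f (p k) (q l)))) => [|l _]; last first.
    rewrite mulNr mulrBr opprB !mulr_sumr; congr (_ - _); apply: eq_bigr => y _.
      by ring.
    by rewrite (fsym (q l)); ring.
  by rewrite sumrB bb exchange_big ab subrr.
have := fpsd_kernel (fpsd_pull e fP) w0 (inr tt).
rewrite sumE ?mulr0 //= => xE; apply/eqP; rewrite -subr_eq0 -sumrN; apply/eqP.
by rewrite -[RHS]xE; congr (_ + _); apply: eq_bigr => y _; rewrite fsym; ring.
Qed.

Lemma fpsd_family_eq1 (K L : finType) (p : K -> T) (q : L -> T) (c : R) :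
  \sum_k \sum_k' f (p k) (p k') = c -> \sum_k \sum_l f (p k) (q l) = c ->
  \sum_l \sum_l' f (q l) (q l') = c ->
  forall x, \sum_k f (p k) x = \sum_l f (q l) x.
Proof.
move=> aa ab bb x.
have /(_ (fun=> 1) (fun=> 1) c _ _ _ x) := @fpsd_family_eq _ _ p q.
have E (I : finType) (F : I -> R) : \sum_i 1 * F i = \sum_i F i.
  by apply: eq_bigr => i _; rewrite mul1r.
rewrite !E; apply.
- by rewrite -[RHS]aa; apply: eq_bigr => k _; apply: eq_bigr => l _;
    rewrite !mul1r.
- by rewrite -[RHS]ab; apply: eq_bigr => k _; apply: eq_bigr => l _;
    rewrite !mul1r.
- by rewrite -[RHS]bb; apply: eq_bigr => k _; apply: eq_bigr => l _;
    rewrite !mul1r.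
Qed.

Lemma fpsd_family_single (K : finType) (p : K -> T) (q : T) (c : R) :
  \sum_k \sum_k' f (p k) (p k') = c -> \sum_k f (p k) q = c -> f q q = c ->
  forall x, \sum_k f (p k) x = f q x.
Proof.
move=> aa ab bb x; have sum1 (F : unit -> R) : \sum_l F l = F tt.
  by rewrite (bigD1 tt) //= big1 ?addr0 //; case.
rewrite -(sum1 (fun=> f q x)); apply: (fpsd_family_eq1 (c := c)) => //.
  by under eq_bigr do rewrite sum1.
by rewrite !sum1.
Qed.
End KernelFamilies.

(** * Margins of a coupling *)

Section Marginals.
Variables (R : realType) (t : nat) (G H : graph).
Local Notation tup := {ffun 'I_t -> G * H}.
Variable N : tup -> tup -> R.
Hypothesis NP : coupling N.

Lemma cpl_sym x y : N x y = N y x.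
Proof. by case: (cpl_psd NP). Qed.

Lemma cpl_conflict (x y : tup) i j :
  ((x i).1 == (y j).1) != ((x i).2 == (y j).2) -> N x y = 0.
Proof.
move=> xy; rewrite -{1}(flsub_fcat x y) -{2}(frsub_fcat x y).
apply: (cpl_atp NP) => /(_ (lshift t i) (rshift t j))[+ _].
rewrite !ffstE !fsndE fcat_lshift fcat_rshift => E.
by case/negP: xy; apply/eqP; apply/idP/idP => /eqP/E/eqP.
Qed.

Lemma cpl_conflictG h g g' : g != g' -> N (fpair g h) (fpair g' h) = 0.
Proof.
by move=> /ffun_neq[k gk]; apply: (@cpl_conflict _ _ k k);
  rewrite !ffunE /= eqxx (negbTE gk).
Qed.

Lemma cpl_conflictH g h h' : h != h' -> N (fpair g h) (fpair g h') = 0.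
Proof.
by move=> /ffun_neq[k hk]; apply: (@cpl_conflict _ _ k k);
  rewrite !ffunE /= eqxx (negbTE hk).
Qed.

(** By [cpl_sumG] all inner products among the vectors [\sum_g v (g, h)] are 1, so these are one
    vector. *)
Lemma cpl_marginG_const h h' x :
  \sum_g N (fpair g h) x = \sum_g N (fpair g h') x.
Proof. by apply: (fpsd_family_eq1 (cpl_psd NP)); apply: (cpl_sumG NP). Qed.

Lemma cpl_marginH_const g g' x :
  \sum_h N (fpair g h) x = \sum_h N (fpair g' h) x.
Proof. by apply: (fpsd_family_eq1 (cpl_psd NP)); apply: (cpl_sumH NP). Qed.

Lemma sum_const (A : finType) (c : R) : \sum_(a : A) c = #|A|%:R * c.
Proof. by rewrite sumr_const mulr_natl. Qed.

(** Double counting of the total of [N]: grouping by [h, h'] or by [g, g'] yields the two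
    squares. *)
Lemma cpl_card_tuples : #|{ffun 'I_t -> G}| = #|{ffun 'I_t -> H}|.
Proof.
apply/eqP; rewrite -(@eqn_exp2r _ _ 2) //; apply/eqP.
apply: (@mulrIn R 1); first exact: oner_neq0.
rewrite !natrX !expr2.
have E1 : \sum_(x : tup) \sum_(y : tup) N x y = #|{ffun 'I_t ->
  H}|%:R * #|{ffun 'I_t -> H}|%:R.
  rewrite sum_fpair exchange_big /= -sum_const; apply: eq_bigr => h _.
  rewrite (eq_bigr (fun g => \sum_h' \sum_g' N (fpair g h) (fpair g' h')));
    last first.
    by move=> g _; rewrite sum_fpair exchange_big.
  rewrite exchange_big -[RHS]mulr1 -sum_const; apply: eq_bigr => h' _.
  exact: (cpl_sumG NP).
rewrite -E1 sum_fpair -sum_const; apply: eq_bigr => g _.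
rewrite (eq_bigr (fun h => \sum_g' \sum_h' N (fpair g h) (fpair g' h')));
  last first.
  by move=> h _; rewrite sum_fpair.
rewrite exchange_big -[LHS]mulr1 -sum_const; apply: eq_bigr => g' _.
by rewrite (cpl_sumH NP).
Qed.

(** Both margins have norm 1, and their mutual inner product remains to be found. It does not depend
    on [g], so it is summed over all [g0], where (b) evaluates the sums over [g0] and [g']. *)
Lemma cpl_margin_eq g h x : \sum_g' N (fpair g' h) x = \sum_h' N (fpair g h') x.
Proof.
apply: (fpsd_family_eq1 (cpl_psd NP) (c := 1)); last 1 first.
- exact: (cpl_sumH NP).
- exact: (cpl_sumG NP).
pose k : R := #|{ffun 'I_t -> H}|%:R.
have k0 : k != 0.
  by rewrite pnatr_eq0 -lt0n; apply/card_gt0P; exists h.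
apply: (mulfI k0); rewrite mulr1 /k -{1}cpl_card_tuples -sum_const.
transitivity (\sum_(g0 : {ffun 'I_t -> G}) \sum_g' \sum_h' N (fpair g' h) (fpair
  g0 h')).
  apply: eq_bigr => g0 _; apply: eq_bigr => g' _.
  by under eq_bigr do rewrite cpl_sym;
    rewrite (cpl_marginH_const g g0); under eq_bigr do rewrite cpl_sym.
under eq_bigr do rewrite exchange_big.
rewrite exchange_big -[RHS]mulr1 -sum_const; apply: eq_bigr => h' _.
transitivity (\sum_g0 \sum_g' N (fpair g' h') (fpair g0 h')).
  by apply: eq_bigr => g0 _; apply: cpl_marginG_const.
by rewrite exchange_big (cpl_sumG NP).
Qed.

(** The margin may be taken at the [H] part of [x], where every term but that of [x] conflicts with
    [x]. *)
Lemma cpl_marginG h x : \sum_g N (fpair g h) x = N x x.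
Proof.
rewrite (cpl_marginG_const h (fsnd x)) (bigD1 (ffst x)) //= fpair_eta.
rewrite big1 ?addr0 // => g gx.
by rewrite -{2}[x]fpair_eta cpl_conflictG.
Qed.

Lemma cpl_marginH g x : \sum_h N (fpair g h) x = N x x.
Proof. by rewrite -(cpl_margin_eq g (fsnd x)) cpl_marginG. Qed.

Lemma cpl_diag_sumG h : \sum_g N (fpair g h) (fpair g h) = 1.
Proof.
rewrite -(cpl_sumG NP h h); apply: eq_bigr => g _.
by rewrite -[LHS](cpl_marginG h); apply: eq_bigr => g' _; rewrite cpl_sym.
Qed.

Lemma cpl_diag_sumH g : \sum_h N (fpair g h) (fpair g h) = 1.
Proof.
rewrite -(cpl_sumH NP g g); apply: eq_bigr => h _.
by rewrite -[LHS](cpl_marginH g); apply: eq_bigr => h' _; rewrite cpl_sym.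
Qed.

(** * Related matrices and the t-equivalence *)

Section Related.
Local Notation VG := {ffun 'I_t -> G}.
Local Notation VH := {ffun 'I_t -> H}.

Definition related (K : Type) (X : VG -> VG -> K) (Y : VH -> VH -> K) : Prop :=
  forall g g' h h', N (fpair g h) (fpair g' h') != 0 -> X g g' = Y h h'.

(* In terms of a Gram factorization [N x y = <v x, v y>], this says that
   [X * U = U * Y] for the matrix of vectors [U g h = v (fpair g h)]. *)
Definition intertwined (X : VG -> VG -> R) (Y : VH -> VH -> R) : Prop :=
  forall g h' x, \sum_g' X g g' * N (fpair g' h') x =
                 \sum_h Y h h' * N (fpair g h) x.

Lemma related_scale (X : VG -> VG -> R) (Y : VH -> VH -> R) g g' h h' :
  related X Y -> X g g' * N (fpair g h) (fpair g' h') =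
                 Y h h' * N (fpair g h) (fpair g' h').
Proof.
move=> XY; have [->|/XY ->//] := eqVneq (N (fpair g h) (fpair g' h')) 0.
by rewrite !mulr0.
Qed.

(** The squared norms of both sides reduce to diagonal terms by conflicts; expanding [N x x] as a
    margin and trading one [X] for a [Y], or conversely, gives the mixed inner product. *)
Lemma related_intertwined X Y : related X Y -> intertwined X Y.
Proof.
move=> XY g h'.
apply: (fpsd_family_eq (cpl_psd NP) (c := \sum_g' \sum_h X g g' * Y h h' *
  N (fpair g' h') (fpair g h))) => //.
- apply: eq_bigr => g' _; rewrite (bigD1 g') //= [X in _ + X]big1 ?addr0;
    last first.
    by move=> g2 gg; rewrite cpl_conflictG ?mulr0 // eq_sym.
  rewrite -(cpl_marginH g) mulr_sumr; apply: eq_bigr => h _.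
  by rewrite -!mulrA (cpl_sym (fpair g' h')) -(related_scale _ _ _ _ XY).
- rewrite [RHS]exchange_big; apply: eq_bigr => h _.
  rewrite (bigD1 h) //= [X in _ + X]big1 ?addr0; last first.
    by move=> h2 hh; rewrite cpl_conflictH ?mulr0 // eq_sym.
  rewrite -(cpl_marginG h') mulr_sumr; apply: eq_bigr => g' _.
  rewrite ![X g g' * _]mulrC -!mulrA (cpl_sym (fpair g' h')).
  by rewrite -(related_scale _ _ _ _ XY).
Qed.

Lemma intertwined_mul X Y X' Y' : intertwined X Y -> intertwined X' Y' ->
  intertwined (fun g g' => \sum_z X g z * X' z g')
              (fun h h' => \sum_z Y h z * Y' z h').
Proof.
move=> XY XY' g h'' x.
transitivity (\sum_g' X g g' * \sum_h' Y' h' h'' * N (fpair g' h') x).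
  under eq_bigr do rewrite mulr_suml.
  rewrite exchange_big; apply: eq_bigr => g' _; rewrite -XY' mulr_sumr.
  by apply: eq_bigr => g'' _; rewrite mulrA.
under eq_bigr do rewrite mulr_sumr.
transitivity (\sum_h' Y' h' h'' * \sum_h Y h h' * N (fpair g h) x).
  rewrite exchange_big; apply: eq_bigr => h' _; rewrite -XY mulr_sumr.
  by apply: eq_bigr => g' _; rewrite mulrCA.
under eq_bigr do rewrite mulr_sumr.
rewrite exchange_big; apply: eq_bigr => h _; rewrite mulr_suml.
by apply: eq_bigr => h' _; ring.
Qed.

(* The [N]-weighted sum of [(X - Y)^2] is [0], as the sums of [N X] and [N Y]
   along pairs are [Y] and [X]. *)
Lemma intertwined_related X Y : intertwined X Y -> related X Y.
Proof.
move=> XY.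
have PhiX h h' : \sum_g \sum_g' N (fpair g h) (fpair g' h') * X g g' = Y h h'.
  transitivity (\sum_g Y h h' * N (fpair g h) (fpair g h)).
    apply: eq_bigr => g _; transitivity (\sum_g' X g g' * N (fpair g' h') (fpair
      g h)).
      by apply: eq_bigr => g' _; rewrite mulrC cpl_sym.
    rewrite XY (bigD1 h) //= big1 ?addr0 // => h2 hh.
    by rewrite cpl_conflictH ?mulr0.
  by rewrite -mulr_sumr cpl_diag_sumG mulr1.
have PhiY g g' : \sum_h \sum_h' N (fpair g h) (fpair g' h') * Y h h' = X g g'.
  rewrite exchange_big; transitivity (\sum_h' X g g' * N (fpair g' h') (fpair g'
    h')).
    apply: eq_bigr => h' _; transitivity (\sum_h Y h h' * N (fpair g h) (fpair
      g' h')).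
      by apply: eq_bigr => h _; rewrite mulrC.
    rewrite -XY (bigD1 g') //= big1 ?addr0 // => g2 gg.
    by rewrite cpl_conflictG ?mulr0.
  by rewrite -mulr_sumr cpl_diag_sumH mulr1.
pose W (x y : tup) := N x y * (X (ffst x) (ffst y) - Y (fsnd x) (fsnd y)) ^+ 2.
have W0 x y : 0 <= W x y by rewrite mulr_ge0 ?(cpl_ge0 NP) ?sqr_ge0.
have sumW : \sum_x \sum_y W x y = 0.
  pose S (A B : VG -> VG -> VH -> VH -> R) := \sum_x \sum_y N x y *
    (A (ffst x) (ffst y) (fsnd x) (fsnd y) * B (ffst x) (ffst y) (fsnd x) (fsnd
      y)).
  pose X' g g' (h h' : VH) := X g g'; pose Y' (g g' : VG) h h' := Y h h'.
  have SG A : S A Y' = \sum_h \sum_h' (\sum_g \sum_g'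
      N (fpair g h) (fpair g' h') * A g g' h h') * Y h h'.
    rewrite /S sum_fpair exchange_big; apply: eq_bigr => h _ /=.
    transitivity (\sum_g \sum_h' \sum_g'
        N (fpair g h) (fpair g' h') * A g g' h h' * Y h h').
      apply: eq_bigr => g _; rewrite sum_fpair exchange_big.
      apply: eq_bigr => h' _; apply: eq_bigr => g' _.
      by rewrite !ffst_fpair !fsnd_fpair mulrA.
    rewrite exchange_big; apply: eq_bigr => h' _ /=; rewrite mulr_suml.
    by apply: eq_bigr => g _; rewrite mulr_suml.
  have SH B : S X' B = \sum_g \sum_g' (\sum_h \sum_h'
      N (fpair g h) (fpair g' h') * B g g' h h') * X g g'.
    rewrite /S sum_fpair; apply: eq_bigr => g _ /=.
    transitivity (\sum_h \sum_g' \sum_h'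
        N (fpair g h) (fpair g' h') * B g g' h h' * X g g').
      apply: eq_bigr => h _; rewrite sum_fpair.
      apply: eq_bigr => h' _; apply: eq_bigr => g' _.
      by rewrite !ffst_fpair !fsnd_fpair mulrCA mulrC.
    rewrite exchange_big; apply: eq_bigr => h' _ /=; rewrite mulr_suml.
    by apply: eq_bigr => h _; rewrite mulr_suml.
  have SYY : S Y' Y' = S X' Y'.
    rewrite !SG; apply: eq_bigr => h _; apply: eq_bigr => h' _.
    rewrite PhiX; congr (_ * _); rewrite -[RHS]mul1r -(cpl_sumG NP h h')
      mulr_suml.
    by apply: eq_bigr => g _; rewrite mulr_suml.
  have SXX : S X' X' = S X' Y'.
    rewrite !SH; apply: eq_bigr => g _; apply: eq_bigr => g' _.
    rewrite PhiY; congr (_ * _); rewrite -[RHS]mul1r -(cpl_sumH NP g g')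
      mulr_suml.
    by apply: eq_bigr => h _; rewrite mulr_suml.
  transitivity (S X' X' + S Y' Y' - 2 * S X' Y'); last by rewrite SXX SYY; ring.
  rewrite /S mulr_sumr -sumrN -!big_split; apply: eq_bigr => x _ /=.
  rewrite mulr_sumr -sumrN -!big_split; apply: eq_bigr => y _ /=.
  by rewrite /W /X' /Y'; ring.
move=> g g' h h' N0; have /eqP : W (fpair g h) (fpair g' h') = 0.
  have := psumr_eq0P (fun x _ => sumr_ge0 _ (fun y _ => W0 x y)) sumW.
  by move=> /(_ (fpair g h) isT)/(psumr_eq0P (fun y _ =>
    W0 _ y))/(_ (fpair g' h') isT).
rewrite mulf_eq0 (negbTE N0) sqrf_eq0 subr_eq0 !ffst_fpair !fsnd_fpair.
by move=> /eqP.
Qed.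

Lemma related_mul (X X' : VG -> VG -> R) (Y Y' : VH -> VH -> R) :
  related X Y -> related X' Y' ->
  related (fun g g' => \sum_z X g z * X' z g')
          (fun h h' => \sum_z Y h z * Y' z h').
Proof.
move=> /related_intertwined XY /related_intertwined XY'.
exact/intertwined_related/intertwined_mul.
Qed.
Lemma related_complex (X : VG -> VG -> R[i]) (Y : VH -> VH -> R[i]) :
  related X Y <->
  related (fun g g' => complex.Re (X g g')) (fun h h' => complex.Re (Y h h')) /\
  related (fun g g' => complex.Im (X g g')) (fun h h' => complex.Im (Y h h')).
Proof.
split=> [XY|[re im] g g' h h' N0].
  by split=> g g' h h' /XY ->.
by apply/eqP; rewrite eq_complex (re _ _ _ _ N0) (im _ _ _ _ N0) !eqxx.
Qed.

Lemma Re_sum (I : finType) (F : I -> R[i]) :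
  complex.Re (\sum_i F i) = \sum_i complex.Re (F i).
Proof. exact: (big_morph _ (fun x y => raddfD _ x y) (raddf0 _)). Qed.

Lemma Im_sum (I : finType) (F : I -> R[i]) :
  complex.Im (\sum_i F i) = \sum_i complex.Im (F i).
Proof. exact: (big_morph _ (fun x y => raddfD _ x y) (raddf0 _)). Qed.

(** As [N] is real, real and imaginary parts are related separately, which reduces the complex
    product to four real ones. *)
Lemma related_mulC (X X' : VG -> VG -> R[i]) (Y Y' : VH -> VH -> R[i]) :
  related X Y -> related X' Y' ->
  related (fun g g' => \sum_z X g z * X' z g')
          (fun h h' => \sum_z Y h z * Y' z h').
Proof.
move=> /related_complex[reX imX] /related_complex[reX' imX'].
have ReM (x y : R[i]) : complex.Re (x * y) =
    complex.Re x * complex.Re y - complex.Im x * complex.Im y.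
  by case: x y => [a b] [c d].
have ImM (x y : R[i]) : complex.Im (x * y) =
    complex.Re x * complex.Im y + complex.Im x * complex.Re y.
  by case: x y => [a b] [c d].
apply/related_complex; split=> g g' h h' N0; rewrite ?Re_sum ?Im_sum.
  under eq_bigr do rewrite ReM; under [RHS]eq_bigr do rewrite ReM.
  rewrite !sumrB (related_mul reX reX' N0).
  by rewrite (related_mul imX imX' N0).
under eq_bigr do rewrite ImM; under [RHS]eq_bigr do rewrite ImM.
rewrite !big_split /= (related_mul reX imX' N0).
by rewrite (related_mul imX reX' N0).
Qed.

Definition related_mx (X : 'M[R[i]]_#|VG|) (Y : 'M[R[i]]_#|VH|) : Prop :=
  related (entry X) (entry Y).

Lemma related_mx_atomic A : atomic A ->
  related_mx (htensor _ A G) (htensor _ A H).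
Proof. by move=> Aat g g' h h' /(coupling_atomic NP Aat) E;
  rewrite !entry_htensor E. Qed.

Lemma related_mx_1 : related_mx 1%:M 1%:M.
Proof.
move=> g g' h h' /(coupling_atomic NP (@atom_atomic _ _ _)) E.
by rewrite !entry_1 -[(g == g') : nat]hcount_I E hcount_I.
Qed.

Lemma related_mx_const a : related_mx (const_mx a) (const_mx a).
Proof. by move=> g g' h h' _; rewrite !entry_const. Qed.

Lemma related_mx_lin a X X' Y Y' : related_mx X Y -> related_mx X' Y' ->
  related_mx (a *: X + X') (a *: Y + Y').
Proof.
by move=> XY XY' g g' h h' N0; rewrite !entry_lin (XY _ _ _ _ N0) (XY' _ _ _ _
  N0).
Qed.

Lemma related_mx_mul X X' Y Y' : related_mx X Y -> related_mx X' Y' ->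
  related_mx (X *m X') (Y *m Y').
Proof.
by move=> XY XY' g g' h h' N0; rewrite !entry_mul; apply: related_mulC N0.
Qed.

Lemma related_mx_schur X X' Y Y' : related_mx X Y -> related_mx X' Y' ->
  related_mx (schur X X') (schur Y Y').
Proof.
by move=> XY XY' g g' h h' N0; rewrite !entry_schur (XY _ _ _ _ N0) (XY' _ _ _ _
  N0).
Qed.

Lemma related_mx_adj X Y : related_mx X Y -> related_mx (X^t*) (Y^t*).
Proof.
move=> XY g g' h h'; rewrite cpl_sym => /XY; rewrite /entry !mxE.
by move=> ->.
Qed.

Lemma related_mx_act s X Y : related_mx X Y -> related_mx (tact s X) (tact s Y).
Proof.
move=> XY g g' h h' N0; rewrite !entry_mx_of; apply: XY.
rewrite -!fpair_fcat -fperm_fpair (cpl_perm NP).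
by rewrite !fpair_fcat !flsub_fcat !frsub_fcat.
Qed.

(** Each entry of the image is a mean, with weights from [N], of entries all equal to [Y h h']. Thus
    the partner of [X] is unique and linear in [X]. *)
Lemma related_mx_map X Y : related_mx X Y -> coupling_map N X = Y.
Proof.
move=> XY; apply: entry_inj => h h'; rewrite entry_coupling_map.
have := congr1 (@real_complex R) (cpl_sumG NP h h'); rewrite rmorph1 => E.
rewrite -[RHS]mul1r -E rmorph_sum mulr_suml; apply: eq_bigr => g _.
rewrite rmorph_sum mulr_suml; apply: eq_bigr => g' _.
have [->|/XY ->//] := eqVneq (N (fpair g h) (fpair g' h')) 0.
by rewrite !mul0r.
Qed.

(** By [cpl_sumH] every position [(g, g')] has a partner [(h, h')] with non-zero [N]. *)
Lemma related_mx_inj X X' Y : related_mx X Y -> related_mx X' Y -> X = X'.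
Proof.
move=> XY XY'; apply: entry_inj => g g'.
suff [h [h' N0]] : exists h h', N (fpair g h) (fpair g' h') != 0.
  by rewrite (XY _ _ _ _ N0) (XY' _ _ _ _ N0).
apply/not_notP => noN; have /eqP[] := oner_neq0 R; rewrite -(cpl_sumH NP g g').
apply: big1 => h _; apply: big1 => h' _; apply/eqP.
by apply: contra_notT noN => N0; exists h, h'.
Qed.

Lemma adj_alg_related_l X : adj_alg X -> exists2 Y, adj_alg Y & related_mx X Y.
Proof.
elim=> {X}.
- by exists 1%:M; [exact: adj_alg_I | exact: related_mx_1].
- by exists (const_mx 1); [exact: adj_alg_J | exact: related_mx_const].
- by move=> A Aat; exists (htensor _ A H);
    [exact: adj_alg_atomic | exact: related_mx_atomic].
- move=> a X X' _ [Y ? ?] _ [Y' ? ?]; exists (a *: Y + Y').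
    exact: adj_alg_lin.
  exact: related_mx_lin.
- move=> X X' _ [Y ? ?] _ [Y' ? ?]; exists (Y *m Y').
    exact: adj_alg_mul.
  exact: related_mx_mul.
- by move=> X _ [Y ? ?]; exists (Y^t*); [exact: adj_alg_adj | exact:
    related_mx_adj].
- move=> X X' _ [Y ? ?] _ [Y' ? ?]; exists (schur Y Y').
    exact: adj_alg_schur.
  exact: related_mx_schur.
- by move=> s X _ [Y ? ?]; exists (tact s Y);
    [exact: adj_alg_act | exact: related_mx_act].
Qed.

Lemma adj_alg_related_r Y : adj_alg Y -> exists2 X, adj_alg X & related_mx X Y.
Proof.
elim=> {Y}.
- by exists 1%:M; [exact: adj_alg_I | exact: related_mx_1].
- by exists (const_mx 1); [exact: adj_alg_J | exact: related_mx_const].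
- by move=> A Aat; exists (htensor _ A G);
    [exact: adj_alg_atomic | exact: related_mx_atomic].
- move=> a Y Y' _ [X ? ?] _ [X' ? ?]; exists (a *: X + X').
    exact: adj_alg_lin.
  exact: related_mx_lin.
- move=> Y Y' _ [X ? ?] _ [X' ? ?]; exists (X *m X').
    exact: adj_alg_mul.
  exact: related_mx_mul.
- by move=> Y _ [X ? ?]; exists (X^t*); [exact: adj_alg_adj | exact:
    related_mx_adj].
- move=> Y Y' _ [X ? ?] _ [X' ? ?]; exists (schur X X').
    exact: adj_alg_schur.
  exact: related_mx_schur.
- by move=> s Y _ [X ? ?]; exists (tact s X);
    [exact: adj_alg_act | exact: related_mx_act].
Qed.

Lemma coupling_t_equivalent : (0 < t)%N -> t_equivalent R t G H.
Proof.
move=> t_gt0; split.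
  apply/eqP; rewrite -(@eqn_exp2r _ _ t) //; apply/eqP.
  by have := cpl_card_tuples; rewrite !card_ffun !card_ord.
pose phi X := coupling_map N X.
have rel X : adj_alg X -> adj_alg (phi X) /\ related_mx X (phi X).
  by case/adj_alg_related_l => Y Yalg XY; rewrite /phi (related_mx_map XY).
exists phi; split.
- by move=> X /rel[].
- move=> a X X' /rel[_ XY] /rel[_ XY'].
  exact/related_mx_map/related_mx_lin.
- move=> X X' /rel[_ XY] /rel[_ XY'] E.
  by apply: (related_mx_inj XY); rewrite E.
- by move=> Y /adj_alg_related_r[X Xalg XY]; exists X => //;
    apply: related_mx_map.
- by move=> X /rel[_ XY]; apply/related_mx_map/related_mx_adj.
- by move=> X X' /rel[_ XY] /rel[_ XY']; apply/related_mx_map/related_mx_mul.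
- exact/related_mx_map/related_mx_1.
- by move=> A Aat; apply/related_mx_map/related_mx_atomic.
- exact/related_mx_map/related_mx_const.
- by move=> X X' /rel[_ XY] /rel[_ XY']; apply/related_mx_map/related_mx_schur.
- by move=> s X /rel[_ XY]; apply/related_mx_map/related_mx_act.
Qed.
End Related.
End Marginals.

(** * Homomorphism tensors and t-equivalence *)

Section TensorOperations.
Variables (K : pzRingType) (t : nat) (G : graph).
Implicit Types F : bgraph t.

Lemma htensor_series F F' :
  htensor K (series F F') G = htensor K F G *m htensor K F' G.
Proof.
apply: entry_inj => x y; rewrite entry_mul entry_htensor hcount_series natr_sum.
by apply: eq_bigr => z _; rewrite !entry_htensor natrM.
Qed.

Lemma htensor_parallel F F' :
  htensor K (parallel F F') G = schur (htensor K F G) (htensor K F' G).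
Proof.
apply: entry_inj => x y.
by rewrite entry_schur !entry_htensor hcount_parallel natrM.
Qed.

Lemma htensor_act s F : htensor K (bgraph_act s F) G = tact s (htensor K F G).
Proof.
by apply: entry_inj_cat => w; rewrite entry_tact !entry_htensor hcount_act.
Qed.

Lemma htensor_iso F F' : bgraph_iso F F' -> htensor K F G = htensor K F' G.
Proof.
by move=> FF'; apply: entry_inj => x y; rewrite !entry_htensor (hcount_iso _ _
  FF').
Qed.

Lemma sum_htensor F :
  \sum_x \sum_y entry (htensor K F G) x y = (Defs.hom (soe F) G)%:R.
Proof.
rewrite hom_sum_hcount natr_sum; apply: eq_bigr => x _.
by rewrite natr_sum; apply: eq_bigr => y _; rewrite entry_htensor.
Qed.
End TensorOperations.

(** [J F J] is the homomorphism count times [J], so a linear map preserving products, [J] and the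
    tensors preserves the count. *)
Lemma t_equivalent_hom (R : realType) (t : nat) (G H : graph) : (0 < #|H|)%N ->
  t_equivalent R t G H -> hom_indistinguishable (@Lplus t) G H.
Proof.
move=> /card_gt0P[v _] [_ [phi phiP]] F FL.
have [phiF Falg] : phi (htensor _ F G) = htensor _ F H /\ adj_alg (htensor R[i]
  F G).
  elim: FL => {F} [F Fat|F F' _ [E A] _ [E' A']|F F' _ [E A] _ [E' A']|s F _ [E
    A]
    |F F' _ [E A] FF'].
  - by split; [apply: (teq_atomic phiP) | apply: adj_alg_atomic].
  - rewrite !htensor_parallel (teq_schur phiP) // E E'; split=> //.
    exact: adj_alg_schur.
  - rewrite !htensor_series (teq_mul phiP) // E E'; split=> //.
    exact: adj_alg_mul.
  - rewrite !htensor_act (teq_act phiP) // E; split=> //; exact: adj_alg_act.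
  - by rewrite -!(htensor_iso _ _ FF').
have JFJ (K : graph) : const_mx 1 *m htensor _ F K *m const_mx 1 =
    (Defs.hom (soe F) K)%:R *: const_mx 1 :> 'M[R[i]]_#|{ffun 'I_t -> K}|.
  apply: entry_inj => x y; rewrite /entry [RHS]mxE -/(entry _ x y) !entry_mul.
  rewrite -sum_htensor mxE mulr1 exchange_big; apply: eq_bigr => z _ /=.
  rewrite entry_mul entry_const mulr1; apply: eq_bigr => z' _.
  by rewrite entry_const mul1r.
have J_alg := @adj_alg_J R t G.
(* Linearity is given for [a *: M + N] only; scaling [J] alone takes [N = 0], whose image and
   membership come from [- J + J]. *)
have phi0 : phi 0 = 0.
  have -> : 0 = (-1) *: const_mx 1 + const_mx 1 :> 'M[R[i]]_#|{ffun 'I_t -> G}|.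
    by rewrite scaleN1r addNr.
  by rewrite (teq_lin phiP) // (teq_J phiP) scaleN1r addNr.
have alg0 : adj_alg (0 : 'M[R[i]]_#|{ffun 'I_t -> G}|).
  by rewrite -(addNr (const_mx 1)) -scaleN1r; apply: adj_alg_lin.
have := congr1 phi (JFJ G).
rewrite (teq_mul phiP) ?(teq_mul phiP) //; last exact: adj_alg_mul.
rewrite phiF (teq_J phiP) JFJ -[_ *: const_mx 1 in RHS]addr0 (teq_lin phiP) //.
rewrite phi0 addr0 (teq_J phiP).
(* Comparing the coefficients of [J] requires a position, here the constant tuples at a vertex of
   [H]. *)
move=> /(congr1 (fun M => entry M [ffun=> v] [ffun=> v])).
by rewrite /entry !mxE !mulr1 => /eqP; rewrite eqr_nat => /eqP.
Qed.

(** * From homomorphism counts to couplings *)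

Lemma fpsd_of_square (R : realType) (T : finType) (M Z : T -> T -> R) :
  (forall x y, M x y = M y x) -> (forall x y, Z x y = Z y x) ->
  (forall x y, \sum_z M x z * M z y = \sum_z Z x z * M z y) ->
  (forall c : T -> R, (exists x, c x != 0) -> 0 < \sum_x \sum_y c x * Z x y * c
    y) ->
  fpsd M.
Proof.
move=> Msym Zsym MZ Zpos; apply/psd_mx_of.
apply: (@psd_of_square _ _ _ (mx_of Z)).
- by apply/matrixP => i j; rewrite !mxE.
- by apply/matrixP => i j; rewrite !mxE.
- apply: entry_inj => x y; rewrite !entry_mul.
  under eq_bigr do rewrite !entry_mx_of.
  by under [RHS]eq_bigr do rewrite !entry_mx_of.
move=> v v0; have -> : (v^T *m mx_of Z *m v) 0 0 =
    \sum_x \sum_y v (enum_rank x) 0 * Z x y * v (enum_rank y) 0.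
  have reix (F : 'I_#|T| -> R) : \sum_i F i = \sum_x F (enum_rank x).
    rewrite [LHS](reindex enum_rank) //.
    by exists enum_val => z _; rewrite ?enum_rankK ?enum_valK.
  rewrite mxE reix exchange_big; apply: eq_bigr => y _ /=.
  rewrite mxE reix mulr_suml; apply: eq_bigr => x _.
  by rewrite !mxE !enum_rankK.
apply: Zpos; apply/existsP; apply: contraR v0 => /existsPn v0.
apply/eqP/matrixP => i j; rewrite ord1 mxE -(enum_valK i).
by apply/eqP/negbNE/v0.
Qed.

(** * Classes of positions and the kernel they define *)

Section PairAlgebra.
Variables (R : realType) (A B : finType).
Variable P : 'M[R]_#|A| -> 'M[R]_#|B| -> Prop.
Hypothesis P_lin : forall a X Y X' Y', P X Y -> P X' Y' ->
  P (a *: X + X') (a *: Y + Y').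
Hypothesis P_1 : P 1%:M 1%:M.
Hypothesis P_J : P (const_mx 1) (const_mx 1).
Hypothesis P_mul : forall X Y X' Y', P X Y -> P X' Y' -> P (X *m X') (Y *m Y').
Hypothesis P_schur : forall X Y X' Y', P X Y -> P X' Y' ->
  P (schur X X') (schur Y Y').
Hypothesis P_tr : forall X Y, P X Y -> P X^T Y^T.
Hypothesis P_sum : forall X Y, P X Y ->
  \sum_x \sum_y entry X x y = \sum_x \sum_y entry Y x y.

(** Positions of both matrices live in one sum type, so that a single equivalence compares them
    within [A], within [B] and across. *)
Definition pair_entry X Y (w : A * A + B * B) : R :=
  match w with inl p => entry X p.1 p.2 | inr q => entry Y q.1 q.2 end.

Definition pair_eqv (w w' : A * A + B * B) : bool :=
  `[< forall X Y, P X Y -> pair_entry X Y w = pair_entry X Y w' >].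

Lemma pair_eqvP w w' : reflect
  (forall X Y, P X Y -> pair_entry X Y w = pair_entry X Y w') (pair_eqv w w').
Proof. exact: asboolP. Qed.

Lemma pair_eqv_refl w : pair_eqv w w.
Proof. exact/pair_eqvP. Qed.

Lemma pair_eqv_sym w w' : pair_eqv w w' = pair_eqv w' w.
Proof. by apply/pair_eqvP/pair_eqvP => E X Y /E. Qed.

Lemma pair_eqv_trans w w' w'' : pair_eqv w w' -> pair_eqv w' w'' ->
  pair_eqv w w''.
Proof. by move=> /pair_eqvP E /pair_eqvP E'; apply/pair_eqvP => X Y XY;
  rewrite E ?E'. Qed.

Lemma pair_eqv_eq w w' : pair_eqv w w' -> pair_eqv w =1 pair_eqv w'.
Proof.
move=> ww' z; apply/idP/idP; apply: pair_eqv_trans => //.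
by rewrite pair_eqv_sym.
Qed.

Lemma pair_entry_lin a X Y X' Y' w :
  pair_entry (a *: X + X') (a *: Y + Y') w = a * pair_entry X Y w + pair_entry
    X' Y' w.
Proof. by case: w => p /=; rewrite entry_lin. Qed.

Lemma pair_entry_schur X Y X' Y' w :
  pair_entry (schur X X') (schur Y Y') w = pair_entry X Y w * pair_entry X' Y'
    w.
Proof. by case: w => p /=; rewrite entry_schur. Qed.

Lemma pair_entry_const a w : pair_entry (const_mx a) (const_mx a) w = a.
Proof. by case: w => p /=; rewrite entry_const. Qed.

(* Interpolation: products of affine functions separating [w] from the other
   classes. *)
Lemma class_indicator w : exists X Y, P X Y /\
  forall w', pair_entry X Y w' = (pair_eqv w w')%:R.
Proof.
have [X [Y [XY w1 w0]]] : exists X Y, [/\ P X Y, pair_entry X Y w = 1 &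
    forall w', w' \in enum {: A * A + B * B} -> ~~ pair_eqv w w' ->
      pair_entry X Y w' = 0].
  elim: (enum _) => [|w' s [X [Y [XY w1 w0]]]].
    by exists (const_mx 1), (const_mx 1); split; rewrite ?pair_entry_const.
  have [ww'|/pair_eqvP] := boolP (pair_eqv w w').
    exists X, Y; split=> // z; rewrite inE => /orP[/eqP ->|]; last exact: w0.
    by rewrite ww'.
  move=> /existsNP[X' /existsNP[Y' /not_implyP[XY' /eqP ww']]].
  pose d := pair_entry X' Y' w - pair_entry X' Y' w'.
  have d0 : d != 0 by rewrite subr_eq0.
  (* The affine function with value 1 at [w] and 0 at [w']. The coefficient of [J] is split with a
     final 1 because [P_lin] leaves its second summand unscaled. *)
  pose aff n (U : 'M[R]_n) := d^-1 *: U + ((- (pair_entry X' Y' w' / d) - 1) *: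
    const_mx 1 + const_mx 1).
  have affP : P (aff _ X') (aff _ Y') by do 2![apply: P_lin => //].
  have affE z : pair_entry (aff _ X') (aff _ Y') z =
      (pair_entry X' Y' z - pair_entry X' Y' w') / d.
    by rewrite /aff !pair_entry_lin !pair_entry_const; ring.
  exists (schur X (aff _ X')), (schur Y (aff _ Y')); split.
  - exact: P_schur.
  - by rewrite pair_entry_schur w1 affE mul1r divff.
  - move=> z; rewrite inE pair_entry_schur affE => /orP[/eqP -> _|zs wz].
      by rewrite subrr mul0r mulr0.
    by rewrite (w0 _ zs wz) mul0r.
exists X, Y; split=> // w'; case ww': (pair_eqv w w').
  by rewrite -w1; apply/esym; move/pair_eqvP: ww'; apply.
by rewrite w0 ?mem_enum // ww'.
Qed.

Definition class_size w : R := \sum_a \sum_a' (pair_eqv w (inl (a, a')))%:R.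

(** The class indicator lies in [P], and [P_sum] equates its two totals; this is where equality of
    homomorphism counts acts. *)
Lemma class_sizeE w : class_size w = \sum_b \sum_b' (pair_eqv w (inr (b,
  b')))%:R.
Proof.
have [X [Y [XY E]]] := class_indicator w; transitivity (\sum_x \sum_y entry X x
  y).
  by apply: eq_bigr => x _; apply: eq_bigr => y _; rewrite -E.
by rewrite (P_sum XY); apply: eq_bigr => x _; apply: eq_bigr => y _; rewrite -E.
Qed.

(** A class contains [w] on the side of [w], hence by [class_sizeE] it also meets the other side. *)
Lemma class_size_gt0 w : 0 < class_size w.
Proof.
have ge1 (C : finType) (e : C -> C -> bool) c c' : e c c' ->
    0 < \sum_x \sum_y (e x y)%:R :> R.
  move=> ec; rewrite (bigD1 c) //= (bigD1 c') //= ec -addrA ltr_pwDl //.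
  by rewrite addr_ge0 ?sumr_ge0 // => x _; rewrite ?sumr_ge0.
case: w => -[c c']; [|rewrite class_sizeE]; apply: (ge1 _ _ c c');
  exact: pair_eqv_refl.
Qed.

Lemma class_size_eqv w w' : pair_eqv w w' -> class_size w = class_size w'.
Proof.
by move=> /pair_eqv_eq E; apply: eq_bigr => a _; apply: eq_bigr => a' _;
  rewrite E.
Qed.

Definition pair_kernel (x y : A * B) : R :=
  (pair_eqv (inl (x.1, y.1)) (inr (x.2, y.2)))%:R / class_size (inr (x.2, y.2)).

Lemma pair_kernel_sizeA x y : pair_kernel x y =
  (pair_eqv (inl (x.1, y.1)) (inr (x.2, y.2)))%:R / class_size (inl (x.1, y.1)).
Proof.
rewrite /pair_kernel; have [E|_] := boolP (pair_eqv _ _);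
  last by rewrite !mul0r.
by rewrite (class_size_eqv E).
Qed.

Lemma pair_kernel_ge0 x y : 0 <= pair_kernel x y.
Proof. by rewrite divr_ge0 ?ler0n // ltW ?class_size_gt0. Qed.

Lemma pair_kernel_sumA b b' : \sum_a \sum_a' pair_kernel (a, b) (a', b') = 1.
Proof.
rewrite -[RHS](divff (lt0r_neq0 (class_size_gt0 (inr (b, b'))))) mulr_suml.
apply: eq_bigr => a _; rewrite mulr_suml; apply: eq_bigr => a' _.
by rewrite /pair_kernel pair_eqv_sym.
Qed.

Lemma pair_kernel_sumB a a' : \sum_b \sum_b' pair_kernel (a, b) (a', b') = 1.
Proof.
rewrite -[RHS](divff (lt0r_neq0 (class_size_gt0 (inl (a, a'))))).
rewrite {1}class_sizeE mulr_suml.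
apply: eq_bigr => b _; rewrite mulr_suml; apply: eq_bigr => b' _.
by rewrite pair_kernel_sizeA.
Qed.

Definition pair_swap (w : A * A + B * B) : A * A + B * B :=
  match w with inl p => inl (p.2, p.1) | inr q => inr (q.2, q.1) end.

Lemma pair_eqv_swap w w' : pair_eqv (pair_swap w) (pair_swap w') = pair_eqv w
  w'.
Proof.
have le z z' : pair_eqv z z' -> pair_eqv (pair_swap z) (pair_swap z').
  move=> /pair_eqvP E; apply/pair_eqvP => X Y /P_tr/E.
  by case: z z' {E} => p [] p' /=; rewrite !entry_tr.
apply/idP/idP; last exact: le.
by move/le; case: w w' => -[? ?] [] [? ?].
Qed.

Lemma class_size_swap w : class_size (pair_swap w) = class_size w.
Proof.
rewrite /class_size exchange_big; apply: eq_bigr => a _; apply: eq_bigr => a' _.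
by rewrite -[in RHS]pair_eqv_swap.
Qed.

Lemma pair_kernel_sym x y : pair_kernel x y = pair_kernel y x.
Proof.
rewrite /pair_kernel -(class_size_swap (inr (x.2, y.2))).
by rewrite -[in LHS]pair_eqv_swap.
Qed.

(** Members of [P] are constant on classes, so pairing with a class indicator reads off the value on
    that class, on either side. *)
Lemma entry_class X Y w : P X Y -> forall U V, P U V ->
  (forall w', pair_entry U V w' = (pair_eqv w w')%:R) ->
  \sum_a \sum_a' entry X a a' * entry U a a' = pair_entry X Y w * class_size w
    /\
  \sum_b \sum_b' entry Y b b' * entry V b b' = pair_entry X Y w * class_size w.
Proof.
move=> XY U V UV E.
have term w' : pair_entry X Y w' * pair_entry U V w' =
    pair_entry X Y w * (pair_eqv w w')%:R.
  rewrite E; case: pair_eqvP => [ww'|_]; last by rewrite !mulr0.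
  by rewrite (ww' _ _ XY).
split; [|rewrite class_sizeE]; rewrite mulr_sumr; apply: eq_bigr => c _;
  rewrite mulr_sumr; apply: eq_bigr => c' _.
  exact: (term (inl (c, c'))).
exact: (term (inr (c, c'))).
Qed.

(** Both sides are entries of products with class indicators, divided by a class size. After
    cross-multiplication, [entry_class] turns each into the same trace, that of [Y F] against [F'],
    equally of [Y^T F'] against [F]. *)
Lemma pair_kernel_intertwined X Y a b y : P X Y ->
  \sum_a1 entry X a a1 * pair_kernel (a1, b) y =
  \sum_b1 entry Y b1 b * pair_kernel (a, b1) y.
Proof.
case: y => a' b' XY.
set k := inr (b, b') : A * A + B * B; set l := inl (a, a') : A * A + B * B.
have [E [F [EF kE]]] := class_indicator k.
have [E' [F' [EF' lE]]] := class_indicator l.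
have XEF := P_mul XY EF; have XEF' := P_mul (P_tr XY) EF'.
have -> : \sum_a1 entry X a a1 * pair_kernel (a1, b) (a', b') =
    pair_entry (X *m E) (Y *m F) l / class_size k.
  rewrite /= entry_mul mulr_suml; apply: eq_bigr => a1 _.
  by rewrite /pair_kernel /= -mulrA pair_eqv_sym -kE.
have -> : \sum_b1 entry Y b1 b * pair_kernel (a, b1) (a', b') =
    pair_entry (X^T *m E') (Y^T *m F') k / class_size l.
  rewrite /= entry_mul mulr_suml; apply: eq_bigr => b1 _.
  by rewrite pair_kernel_sizeA /= -mulrA entry_tr -lE.
have ck := lt0r_neq0 (class_size_gt0 k); have cl := lt0r_neq0 (class_size_gt0
  l).
apply/eqP; rewrite eqr_div //; apply/eqP.
rewrite -(entry_class XEF EF' lE).2 -(entry_class XEF' EF kE).2.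
transitivity (\sum_b2 \sum_b3 \sum_b1 entry Y b2 b1 * entry F b1 b3 * entry F'
  b2 b3).
  apply: eq_bigr => b2 _; apply: eq_bigr => b3 _.
  by rewrite entry_mul mulr_suml.
rewrite exchange_big.
transitivity (\sum_b3 \sum_b1 \sum_b2 entry Y b2 b1 * entry F b1 b3 * entry F'
  b2 b3).
  by apply: eq_bigr => b3 _; rewrite exchange_big.
rewrite exchange_big; apply: eq_bigr => b1 _; apply: eq_bigr => b3 _.
rewrite entry_mul mulr_suml; apply: eq_bigr => b2 _; rewrite entry_tr; ring.
Qed.

Definition col_eqv b' b b1 : bool := pair_eqv (inr (b, b')) (inr (b1, b')).

(** The [B] part of the matrix [Z]; its [A] part is the identity. *)
Definition square_coef b b1 : R :=
  \sum_b' (col_eqv b' b b1)%:R / class_size (inr (b, b')).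

Lemma square_coef_sym b b1 : square_coef b b1 = square_coef b1 b.
Proof.
apply: eq_bigr => b' _; rewrite /col_eqv pair_eqv_sym.
by have [/class_size_eqv ->|_] := boolP (pair_eqv _ _); rewrite ?mul0r.
Qed.

(** For a fixed [B] component [b'] of [z], the first factor is a class indicator over [a'] up to
    scaling. Intertwining moves it to the [B] side and leaves the [A] component of [x] in place,
    hence the delta. *)
Lemma pair_kernel_square x y : \sum_z pair_kernel x z * pair_kernel z y =
  \sum_z ((x.1 == z.1)%:R * square_coef x.2 z.2) * pair_kernel z y.
Proof.
case: x => a b; rewrite sum_pair [RHS]sum_pair exchange_big /=.
rewrite (bigD1 a) //= [X in _ = _ + X]big1 ?addr0; last first.
  by move=> a1 aa1; rewrite big1 // => b1 _; rewrite eq_sym (negbTE aa1) !mul0r.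
rewrite eqxx; under [RHS]eq_bigr do rewrite mul1r /square_coef mulr_suml.
rewrite [RHS]exchange_big; apply: eq_bigr => b' _ /=.
have [E [F [EF kE]]] := class_indicator (inr (b, b')).
transitivity ((\sum_a' entry E a a' * pair_kernel (a',
  b') y) / class_size (inr (b, b'))).
  rewrite mulr_suml; apply: eq_bigr => a' _.
  by rewrite {1}/pair_kernel /= pair_eqv_sym -kE /=; ring.
rewrite (pair_kernel_intertwined _ _ _ EF) mulr_suml; apply: eq_bigr => b1 _.
by rewrite /col_eqv -kE /=; ring.
Qed.

Lemma col_eqv_refl b' b : col_eqv b' b b.
Proof. exact: pair_eqv_refl. Qed.

(** The identity belongs to [P], so diagonal positions are never equivalent to others. *)
Lemma col_eqv_diag b b1 : col_eqv b b b1 -> b = b1.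
Proof.
move=> /pair_eqvP/(_ _ _ P_1) /=; rewrite !entry_1 eqxx => E.
by apply/eqP; rewrite eq_sym; case: eqP E => // _ /eqP; rewrite oner_eq0.
Qed.

(* For an equivalence relation [e] with classes of size [n],
   [e b b1] is the sum of [e b0 b * e b0 b1 / n b0] over [b0]. *)
Lemma square_coef_pos (c : B -> R) b : c b != 0 ->
  0 < \sum_b1 \sum_b2 c b1 * square_coef b1 b2 * c b2.
Proof.
move=> cb.
pose n b' b0 : R := \sum_b1 (col_eqv b' b0 b1)%:R.
have n_gt0 b' b0 : 0 < n b' b0.
  by rewrite /n (bigD1 b0) //= col_eqv_refl ltr_pwDl ?ltr01 ?sumr_ge0.
pose s b' b0 := (\sum_b1 (col_eqv b' b0 b1)%:R * c b1) ^+ 2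
  / (class_size (inr (b0, b')) * n b' b0).
have s0 b' b0 : 0 <= s b' b0.
  by rewrite divr_ge0 ?sqr_ge0 // mulr_ge0 // ltW ?class_size_gt0.
have -> : \sum_b1 \sum_b2 c b1 * square_coef b1 b2 * c b2 =
    \sum_b' \sum_b0 s b' b0.
  transitivity (\sum_b' \sum_b1 \sum_b2 c b1 * ((col_eqv b' b1 b2)%:R
      / class_size (inr (b1, b'))) * c b2).
    rewrite [RHS]exchange_big; apply: eq_bigr => b1 _ /=.
    rewrite [RHS]exchange_big; apply: eq_bigr => b2 _ /=.
    by rewrite mulr_sumr mulr_suml.
  apply: eq_bigr => b' _.
  transitivity (\sum_b0 \sum_b1 \sum_b2 (col_eqv b' b0 b1)%:R * c b1 *
      ((col_eqv b' b0 b2)%:R * c b2) / (class_size (inr (b0, b')) * n b' b0)).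
    rewrite [RHS]exchange_big; apply: eq_bigr => b1 _ /=.
    rewrite [RHS]exchange_big; apply: eq_bigr => b2 _ /=.
    transitivity (c b1 * c b2 * (col_eqv b' b1 b2)%:R / class_size (inr (b1,
      b'))
        * ((\sum_b0 (col_eqv b' b1 b0)%:R) / n b' b1)).
      rewrite -/(n b' b1) divff ?gt_eqF // mulr1; move: (_%:R) => e; ring.
    rewrite mulr_suml mulr_sumr; apply: eq_bigr => b0 _.
    rewrite /col_eqv (pair_eqv_sym (inr (b1, b')) (inr (b0, b'))).
    have [e01|_] := boolP (pair_eqv (inr (b0, b')) (inr (b1, b'))); last first.
      by rewrite !mul0r mulr0.
    rewrite (class_size_eqv e01) (pair_eqv_eq e01).
    have -> : n b' b0 = n b' b1.
      by apply: eq_bigr => b3 _; rewrite /col_eqv (pair_eqv_eq e01).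
    by rewrite invfM; ring.
  apply: eq_bigr => b0 _; rewrite /s expr2 !mulr_suml; apply: eq_bigr => b1 _.
  by rewrite mulr_sumr mulr_suml.
(* The square for column [b] and representative [b] is positive: in that column the class of [b] is
   a singleton by [col_eqv_diag], so the squared sum is just [c b]. *)
rewrite (bigD1 b) //= (bigD1 b) //= -addrA ltr_pwDl //; last first.
  rewrite addr_ge0 ?sumr_ge0 // => b' _; rewrite ?sumr_ge0 // => b0 _;
    exact: s0.
apply: divr_gt0; last by rewrite mulr_gt0 ?class_size_gt0.
rewrite exprn_even_gt0 //=.
rewrite (bigD1 b) //= big1 ?addr0 ?col_eqv_refl ?mul1r // => b1 b1b.
have [/col_eqv_diag E|_] := boolP (col_eqv b b b1); last by rewrite mul0r.
by rewrite E eqxx in b1b.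
Qed.

Lemma pair_kernel_psd : fpsd pair_kernel.
Proof.
apply: (fpsd_of_square pair_kernel_sym
  (Z := fun x y => (x.1 == y.1)%:R * square_coef x.2 y.2)).
- by move=> x y; rewrite eq_sym square_coef_sym.
- exact: pair_kernel_square.
move=> c [[a b] cab].
(* [Z] is block diagonal with one copy of [square_coef] for each element of [A]. *)
have -> : \sum_x \sum_y c x * ((x.1 == y.1)%:R * square_coef x.2 y.2) * c y =
    \sum_a1 \sum_b1 \sum_b2 c (a1, b1) * square_coef b1 b2 * c (a1, b2).
  rewrite sum_pair; apply: eq_bigr => a1 _; apply: eq_bigr => b1 _ /=.
  rewrite sum_pair (bigD1 a1) //= [X in _ + X]big1 ?addr0; last first.
    move=> a2 a2a; apply: big1 => b2 _; rewrite eq_sym (negbTE a2a).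
    by rewrite mul0r mulr0 mul0r.
  by apply: eq_bigr => b2 _; rewrite eqxx mul1r.
rewrite (bigD1 a) //= ltr_pwDl ?(square_coef_pos (c := fun b =>
  c (a, b)) cab) //.
apply: sumr_ge0 => a1 _.
have [/existsP[b1 c1]|/existsPn c0] := boolP [exists b1, c (a1, b1) != 0].
  exact: ltW (square_coef_pos (c := fun b => c (a1, b)) c1).
rewrite big1 // => b1 _; rewrite big1 // => b2 _.
by rewrite (eqP (negbNE (c0 b1))) !mul0r.
Qed.
End PairAlgebra.

(** * The span of the pairs of homomorphism tensors *)

Section HomSpan.
Variables (R : realType) (t : nat) (G H : graph).
Local Notation MG := 'M[R]_#|{ffun 'I_t -> G}|.
Local Notation MH := 'M[R]_#|{ffun 'I_t -> H}|.

(** A relation and not a map: a linear dependence among tensors over [G] need not, a priori, hold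
    over [H]. *)
Inductive hom_span : MG -> MH -> Prop :=
| hom_span0 : hom_span 0 0
| hom_span_cons a F X Y of Lplus F & hom_span X Y :
    hom_span (a *: htensor R F G + X) (a *: htensor R F H + Y).

Lemma hom_span_htensor F : Lplus F -> hom_span (htensor R F G) (htensor R F H).
Proof.
move=> FL; have := hom_span_cons 1 FL hom_span0.
by rewrite !scale1r !addr0.
Qed.

Lemma hom_span_lin a X Y X' Y' : hom_span X Y -> hom_span X' Y' ->
  hom_span (a *: X + X') (a *: Y + Y').
Proof.
move=> XY XY'; elim: XY => [|b F X0 Y0 FL _ IH];
  first by rewrite !scaler0 !add0r.
by rewrite !scalerDr !scalerA -!addrA; apply: hom_span_cons.
Qed.

Lemma hom_span_mul X Y X' Y' : hom_span X Y -> hom_span X' Y' ->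
  hom_span (X *m X') (Y *m Y').
Proof.
move=> XY XY'; elim: XY => [|a F X0 Y0 FL _ IH].
  by rewrite !mul0mx; apply: hom_span0.
rewrite !mulmxDl -!scalemxAl; apply: hom_span_lin => //.
elim: XY' => [|b F' X1 Y1 FL' _ IH']; first by rewrite !mulmx0;
  apply: hom_span0.
rewrite !mulmxDr -!scalemxAr; apply: hom_span_lin => //.
by rewrite -!htensor_series; apply/hom_span_htensor/Lplus_series.
Qed.

Lemma schurC (n : nat) (X Y : 'M[R]_n) : schur X Y = schur Y X.
Proof. by apply/matrixP => i j; rewrite !mxE mulrC. Qed.

Lemma schur_lin (n : nat) a (X Y Z : 'M[R]_n) :
  schur (a *: X + Y) Z = a *: schur X Z + schur Y Z.
Proof. by apply/matrixP => i j; rewrite !mxE mulrDl mulrA. Qed.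

Lemma schur0 (n : nat) (Z : 'M[R]_n) : schur 0 Z = 0.
Proof. by apply/matrixP => i j; rewrite !mxE mul0r. Qed.

Lemma hom_span_schur X Y X' Y' : hom_span X Y -> hom_span X' Y' ->
  hom_span (schur X X') (schur Y Y').
Proof.
move=> XY XY'; elim: XY => [|a F X0 Y0 FL _ IH].
  by rewrite !schur0; apply: hom_span0.
rewrite !schur_lin; apply: hom_span_lin => //.
rewrite ![schur (htensor _ _ _) _]schurC.
elim: XY' => [|b F' X1 Y1 FL' _ IH']; first by rewrite !schur0;
  apply: hom_span0.
rewrite !schur_lin; apply: hom_span_lin => //.
by rewrite -!htensor_parallel; apply/hom_span_htensor/Lplus_parallel.
Qed.

Lemma hom_span_act s X Y : hom_span X Y -> hom_span (tact s X) (tact s Y).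
Proof.
have tact_lin (K : graph) a (U V : 'M[R]_#|{ffun 'I_t -> K}|) :
    tact s (a *: U + V) = a *: tact s U + tact s V.
  by apply: entry_inj => x y; rewrite entry_lin !entry_mx_of /= entry_lin.
elim=> [|a F X0 Y0 FL _ IH].
  have tact0 (K : graph) : tact s (0 : 'M[R]_#|{ffun 'I_t -> K}|) = 0.
    by apply: entry_inj => x y; rewrite entry_mx_of /= /entry !mxE.
  by rewrite !tact0; apply: hom_span0.
rewrite !tact_lin; apply: hom_span_lin => //.
by rewrite -!htensor_act; apply/hom_span_htensor/Lplus_act.
Qed.

Lemma hom_span_1 : hom_span 1%:M 1%:M.
Proof.
have E (K : graph) : 1%:M = htensor R (@I_atom t) K.
  by apply: entry_inj => x y; rewrite entry_1 entry_htensor hcount_I.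
by rewrite !E; apply/hom_span_htensor/Lplus_atomic/atom_atomic.
Qed.

Lemma hom_span_J : hom_span (const_mx 1) (const_mx 1).
Proof.
have E (K : graph) : const_mx 1 = htensor R (@J_atom t) K.
  by apply: entry_inj => x y; rewrite entry_const entry_htensor hcount_J.
by rewrite !E; apply/hom_span_htensor/Lplus_atomic/atom_atomic.
Qed.

Lemma split_shift m n (i : 'I_m) (j : 'I_n) :
  (split (lshift n i) = inl i) * (split (rshift m j) = inr j).
Proof. by split; [exact: (unsplitK (inl i)) | exact: (unsplitK (inr j))]. Qed.

Lemma half_swap_inj :
  injective (fun k : 'I_(t + t) => match split k with
    inl i => rshift t i | inr i => lshift t i end).
Proof.
apply: inv_inj => k; have [j ->|j ->] := split_ordP k.
  by rewrite !split_shift.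
by rewrite !split_shift.
Qed.

Definition half_swap : 'S_(t + t) := perm half_swap_inj.

Lemma fperm_half_swap (T : Type) (w : {ffun 'I_(t + t) -> T}) :
  (flsub (fperm half_swap^-1 w) = frsub w) * (frsub (fperm half_swap^-1 w) =
    flsub w).
Proof.
split; apply/ffunP => i; rewrite !(flsubE, frsubE) fpermE; congr (w _);
  apply: (canLR (permK half_swap)); rewrite permE.
  by rewrite split_shift.
by rewrite split_shift.
Qed.

(** Transposition is the action of the permutation exchanging in-labels and out-labels. *)
Lemma hom_span_tr X Y : hom_span X Y -> hom_span X^T Y^T.
Proof.
have E (K : graph) (U : 'M[R]_#|{ffun 'I_t -> K}|) : U^T = tact half_swap U.
  by apply: entry_inj_cat => w; rewrite entry_tact entry_tr !fperm_half_swap.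
by rewrite !E; apply: hom_span_act.
Qed.

Hypothesis GH : hom_indistinguishable (@Lplus t) G H.

Lemma hom_span_sum X Y : hom_span X Y ->
  \sum_x \sum_y entry X x y = \sum_x \sum_y entry Y x y.
Proof.
have sum_lin (K : graph) a (U V : 'M[R]_#|{ffun 'I_t -> K}|) :
    \sum_x \sum_y entry (a *: U + V) x y =
    a * (\sum_x \sum_y entry U x y) + \sum_x \sum_y entry V x y.
  rewrite mulr_sumr -big_split; apply: eq_bigr => x _ /=.
  by rewrite mulr_sumr -big_split; apply: eq_bigr => y _; rewrite entry_lin.
elim=> [|a F X0 Y0 FL _ IH].
  have sum0 (K : graph) : \sum_x \sum_y entry (0 : 'M[R]_#|{ffun 'I_t ->
    K}|) x y = 0.
    by rewrite big1 // => x _; rewrite big1 // => y _; rewrite /entry mxE.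
  by rewrite !sum0.
by rewrite !sum_lin IH !sum_htensor (GH FL).
Qed.

Lemma hom_indistinguishable_coupling :
  exists N : {ffun 'I_t -> G * H} -> {ffun 'I_t -> G * H} -> R, coupling N.
Proof.
pose p (x : {ffun 'I_t -> G * H}) := (ffst x, fsnd x).
exists (fun x y => pair_kernel hom_span (p x) (p y)); split.
- apply: fpsd_pull; apply: pair_kernel_psd.
  + exact: hom_span_lin.
  + exact: hom_span_1.
  + exact: hom_span_J.
  + exact: hom_span_mul.
  + exact: hom_span_schur.
  + exact: hom_span_tr.
  + exact: hom_span_sum.
- by move=> x y; apply: pair_kernel_ge0 hom_span_lin hom_span_J hom_span_schur
    hom_span_sum _ _.
- move=> h h'; rewrite -[RHS](pair_kernel_sumA hom_span_lin hom_span_J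
    hom_span_schur
    hom_span_sum h h').
  apply: eq_bigr => g _; apply: eq_bigr => g' _.
  by rewrite /p !ffst_fpair !fsnd_fpair.
- move=> g g'; rewrite -[RHS](pair_kernel_sumB hom_span_lin hom_span_J
    hom_span_schur
    hom_span_sum g g').
  apply: eq_bigr => h _; apply: eq_bigr => h' _.
  by rewrite /p !ffst_fpair !fsnd_fpair.
- move=> w watp; rewrite /pair_kernel; have [/pair_eqvP E|_] := boolP (pair_eqv
    _ _ _).
    case: watp; apply: same_atp_atomic => A Aat.
    have := E _ _ (hom_span_htensor (Lplus_atomic Aat)).
    rewrite /= !entry_htensor !ffst_fcat !fsnd_fcat => /eqP.
    by rewrite eqr_nat => /eqP.
  by rewrite mul0r.
pose q (w : {ffun 'I_(t + t) -> G}) (w' : {ffun 'I_(t + t) -> H}) (b : bool) :=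
  if b then inl (flsub w, frsub w) else inr (flsub w', frsub w').
(* The span is closed under the action, so permuting labels preserves equivalence of positions;
   class sizes are then equal by reindexing. *)
have eqv_perm s w w' v v' b c : pair_eqv hom_span (q (fperm s w) (fperm s w') b)
    (q (fperm s v) (fperm s v') c) = pair_eqv hom_span (q w w' b) (q v v' c).
  have le r u u' x x' : pair_eqv hom_span (q u u' b) (q x x' c) ->
      pair_eqv hom_span (q (fperm r u) (fperm r u') b) (q (fperm r x) (fperm r
        x') c).
    move=> /pair_eqvP E; apply/pair_eqvP => X Y /(hom_span_act r^-1)/E.
    by case: b c {E} => [] [] /=; rewrite !entry_tact !invgK.
  apply/idP/idP; last exact: le.
  move=> /(le s^-1%g).
  by rewrite !fpermM mulVg !fperm1.
move=> s w; rewrite /pair_kernel /p /= !ffst_fcat !fsnd_fcat !ffst_fperm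
  !fsnd_fperm.
have E := eqv_perm s (ffst w) (fsnd w) (ffst w) (fsnd w) true false.
rewrite /q in E; rewrite E; congr (_ / _).
pose F (u' : {ffun 'I_(t + t) -> H}) (v : {ffun 'I_(t + t) -> G}) : R :=
  (pair_eqv hom_span (q v u' false) (q v u' true))%:R.
have sizeE u' : class_size hom_span (inr (flsub u', frsub u')) = \sum_v F u' v.
  rewrite sum_fcat; apply: eq_bigr => g _; apply: eq_bigr => g' _.
  by rewrite /F /q flsub_fcat frsub_fcat.
rewrite !sizeE -(sum_fperm s); apply: eq_bigr => v _.
by rewrite /F eqv_perm.
Qed.
End HomSpan.

(** * The Lasserre relaxation *)

Lemma sum_ffun_const (M : nmodType) (T : finType) n (F : {ffun 'I_n.+1 ->
  T} -> M) :
  (forall f : {ffun 'I_n.+1 -> T}, (exists i j, f i != f j) -> F f = 0) ->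
  \sum_f F f = \sum_a F [ffun=> a].
Proof.
move=> F0; rewrite (partition_big (fun f : {ffun 'I_n.+1 ->
  T} => f ord0) xpredT) //=.
apply: eq_bigr => a _; rewrite (bigD1 [ffun=> a]) ?ffunE //= big1 ?addr0 //.
move=> f /andP[/eqP <- /ffun_neq[i fi]]; apply: F0; exists i, ord0.
by move: fi; rewrite ffunE.
Qed.

(** * From a coupling to a Lasserre solution *)

Section CouplingLasserre.
Variables (R : realType) (t' : nat) (G H : graph).
Local Notation t := t'.+1.
Local Notation T := (G * H)%type.
Local Notation tup := {ffun 'I_t -> G * H}.
Variable N : tup -> tup -> R.
Hypothesis NP : coupling N.
Variable p0 : T.

Lemma cpl_conflict_at (w : {ffun 'I_(t + t) -> G * H}) i j :
  ((w i).1 == (w j).1) != ((w i).2 == (w j).2) -> N (flsub w) (frsub w) = 0.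
Proof.
move=> wij; apply: (cpl_atp NP) => /(_ i j)[+ _].
rewrite !ffstE !fsndE => E.
by case/negP: wij; apply/eqP; apply/idP/idP => /eqP/E/eqP.
Qed.

Lemma cpl_conflict_l (x y : tup) i j :
  ((x i).1 == (x j).1) != ((x i).2 == (x j).2) -> N x y = 0.
Proof.
move=> xij; rewrite -[x](flsub_fcat x y) -[y in N _ y](frsub_fcat x y).
by apply: (@cpl_conflict_at _ (lshift t i) (lshift t j)); rewrite !fcat_lshift.
Qed.

(** Against a constant [H] tuple every non-constant [G] tuple conflicts with itself, so the margin
    runs over repetitions of one pair. *)
Lemma cpl_margin_constG h x : \sum_g N [ffun=> (g, h)] x = N x x.
Proof.
rewrite -(cpl_marginG NP [ffun=> h]) sum_ffun_const.
  by apply: eq_bigr => g _; congr (N _ _); apply/ffunP => i; rewrite !ffunE.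
move=> f [i [j fij]]; apply: (@cpl_conflict_l _ _ i j).
by rewrite !ffunE /= eqxx (negbTE fij).
Qed.

Lemma cpl_margin_constH g x : \sum_h N [ffun=> (g, h)] x = N x x.
Proof.
rewrite -(cpl_marginH NP [ffun=> g]) sum_ffun_const.
  by apply: eq_bigr => h _; congr (N _ _); apply/ffunP => i; rewrite !ffunE.
move=> f [i [j fij]]; apply: (@cpl_conflict_l _ _ i j).
by rewrite !ffunE /= eqxx (negbTE fij).
Qed.

Lemma cpl_sum_constH g : \sum_h N [ffun=> (g, h)] [ffun=> (g, h)] = 1.
Proof.
rewrite -(cpl_diag_sumH NP [ffun=> g]) sum_ffun_const.
  by apply: eq_bigr => h _; congr (N _ _); apply/ffunP => i; rewrite !ffunE.
move=> f [i [j fij]]; apply: (@cpl_conflict_l _ _ i j).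
by rewrite !ffunE /= eqxx (negbTE fij).
Qed.

Lemma cpl_sum_constG h : \sum_g N [ffun=> (g, h)] [ffun=> (g, h)] = 1.
Proof.
rewrite -(cpl_diag_sumG NP [ffun=> h]) sum_ffun_const.
  by apply: eq_bigr => g _; congr (N _ _); apply/ffunP => i; rewrite !ffunE.
move=> f [i [j fij]]; apply: (@cpl_conflict_l _ _ i j).
by rewrite !ffunE /= eqxx (negbTE fij).
Qed.

(** Expand [N x x] as the margin at the [H] part of [y]: a term other than [y] differs from it at
    some position, and there conflicts with the pair of [x] equal to that of [y]. *)
Lemma cpl_subset (x y : tup) : (forall i, exists j, y i = x j) -> N y x = N x x.
Proof.
move=> yx; rewrite -(cpl_marginG NP (fsnd y)) (bigD1 (ffst y)) //= fpair_eta.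
rewrite big1 ?addr0 // => g /ffun_neq[k gk]; have [j yj] := yx k.
apply: (@cpl_conflict _ _ _ _ _ NP _ _ k j).
by move: gk; rewrite -yj !ffunE /= eqxx => /negbTE ->.
Qed.

Definition tupf n (s : seq T) : {ffun 'I_n -> T} := [ffun i : 'I_n =>
  nth p0 s i].
Definition mu (s : seq T) : R := N (flsub (tupf (t + t) s)) (frsub (tupf (t + t)
  s)).

Lemma mu_ge0 s : 0 <= mu s.
Proof. exact: (cpl_ge0 NP). Qed.

Lemma mu_cat s r : size s = t -> mu (s ++ r) = N (tupf t s) (tupf t r).
Proof.
move=> st; congr (N _ _); apply/ffunP => i; rewrite ?flsubE ?frsubE !ffunE
  nth_cat st.
  by rewrite /= ltn_ord.
by rewrite /= ltnNge leq_addr /= addKn.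
Qed.

Lemma mu_perm s r : size s = (t + t)%N -> perm_eq s r -> mu s = mu r.
Proof.
move=> st sr; have rt : size r == (t + t)%N by rewrite -(perm_size sr) st.
have : perm_eq s (Tuple rt) by [].
case/tuple_permP => q sE; have qE := cpl_perm NP q (tupf _ r).
rewrite -[RHS]qE; congr (N _ _); congr (_ _); apply/ffunP => i;
  rewrite !ffunE sE -tnth_nth tnth_mktuple (tnth_nth p0) //.
Qed.

Lemma mu_conflict s p q : size s = (t + t)%N -> p \in s -> q \in s ->
  (p.1 == q.1) != (p.2 == q.2) -> mu s = 0.
Proof.
move=> st ps qs pq.
have ip : (index p s < t + t)%N by rewrite -st index_mem.
have iq : (index q s < t + t)%N by rewrite -st index_mem.
by apply: (@cpl_conflict_at _ (Ordinal ip) (Ordinal iq));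
  rewrite !ffunE /= !nth_index.
Qed.

Lemma tupf_subset s r : size s = t -> size r = t -> {subset s <= r} ->
  N (tupf t s) (tupf t r) = N (tupf t r) (tupf t r).
Proof.
move=> st rt sr; apply: cpl_subset => i; rewrite !ffunE.
have ir : nth p0 s i \in r by apply/sr/mem_nth; rewrite st.
have jr : (index (nth p0 s i) r < t)%N by rewrite -[X in (_ < X)%N]rt index_mem.
by exists (Ordinal jr); rewrite ffunE /= nth_index.
Qed.

(** With at most [t] distinct pairs, a permutation brings all of them into the first half; the
    second half is then contained in it and [cpl_subset] applies. *)
Lemma mu_support s : size s = (t + t)%N -> (size (undup s) <= t)%N ->
  exists x, [/\ size x = t, x =i s & mu s = N (tupf t x) (tupf t x)].
Proof.
move=> st ut; have [r sr] := perm_to_subseq (undup_subseq s).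
have urt : size (undup s ++ r) = (t + t)%N by rewrite -(perm_size sr).
pose x := take t (undup s ++ r); pose y := drop t (undup s ++ r).
have xt : size x = t by rewrite size_takel // urt leq_addr.
have yt : size y = t by rewrite size_drop urt addnK.
have xyE : x ++ y = undup s ++ r by apply: cat_take_drop.
have memE : x ++ y =i s by move=> z; rewrite xyE -(perm_mem sr).
have ux : {subset s <= x}.
  move=> z; rewrite -mem_undup => zs; rewrite /x take_cat.
  move: ut; rewrite leq_eqVlt => /orP[/eqP ut|ut].
    by rewrite -ut ltnn subnn take0 cats0.
  by rewrite ltnNge ltnW //= mem_cat zs.
have xs : {subset x <= s} by move=> z zx; rewrite -memE mem_cat zx.
exists x; split=> //; first by move=> z; apply/idP/idP => [/xs|/ux].
rewrite (mu_perm st sr) -xyE mu_cat // (cpl_sym NP) tupf_subset //.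
by move=> z zy; apply: ux; rewrite -memE mem_cat zy orbT.
Qed.

Lemma mu_small s r : size s = (t + t)%N -> size r = (t + t)%N -> s =i r ->
  (size (undup s) <= t)%N -> mu s = mu r.
Proof.
move=> st rt sr ut; have [x [xt xs ->]] := mu_support st ut.
have [|y [yt yr ->]] := mu_support rt.
  by rewrite -(perm_size (_ : perm_eq (undup s) (undup r))) // uniq_perm
    ?undup_uniq //;
    move=> z; rewrite !mem_undup.
have xy : x =i y by move=> z; rewrite xs yr sr.
rewrite -(@tupf_subset y x) //; last by move=> z; rewrite xy.
rewrite (cpl_sym NP) tupf_subset // => z; by rewrite xy.
Qed.

Lemma size_undup_le (s r : seq T) : {subset s <= r} ->
  (size (undup s) <= size r)%N.
Proof.
by move=> sr; apply: uniq_leq_size (undup_uniq s) _ => z;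
  rewrite mem_undup => /sr.
Qed.

Lemma tupf_nseq p : tupf t (nseq t p) = [ffun=> p].
Proof. by apply/ffunP => i; rewrite !ffunE nth_nseq ltn_ord. Qed.

(* The vectors of the tuples [(g, h) :: s] sum up to the vector of [q :: s] for
   any [q] in [s], and to the common marginal vector if [s] is empty. *)
Lemma mu_margin_cat s : size s = t' -> forall r, size r = t -> exists c,
  (forall h, \sum_g mu ((g, h) :: s ++ r) = c) /\
  (forall g, \sum_h mu ((g, h) :: s ++ r) = c).
Proof.
move=> st r rt; have consE p : mu (p :: s ++ r) = N (tupf t (p :: s)) (tupf t
  r).
  by rewrite -cat_cons mu_cat //= st.
case: s st consE => [|q s] st consE.
  have t1 p : tupf t [:: p] = [ffun=> p].
    by apply/ffunP => i; rewrite !ffunE; case: i => -[|i] //=; rewrite -st.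
  exists (N (tupf t r) (tupf t r)); split=> [h|g].
    by under eq_bigr do rewrite consE t1; apply: cpl_margin_constG.
  by under eq_bigr do rewrite consE t1; apply: cpl_margin_constH.
move: (q :: s) (mem_head q s) st consE => {}s qs st consE.
have sz p : size (p :: s) = t by rewrite /= st.
have qsE (p z : T) : (z \in nseq t p ++ q :: s) = (z \in p :: s).
  rewrite mem_cat mem_nseq !inE /=; case: (z == p) => //=.
  by case: eqP => // ->; rewrite qs.
(* The inner products needed below either vanish by conflict or mention at most [t] distinct pairs,
   where [mu_small] applies; the [q] in front of [s] only fills up the length. *)
have small p x y : size x = t -> size y = t -> x ++ y =i p :: s ->
    N (tupf t x) (tupf t y) = N [ffun=> p] (tupf t (q :: s)).
  move=> xt yt xy; rewrite -tupf_nseq -!mu_cat ?size_nseq //.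
  apply: mu_small; rewrite ?size_cat ?size_nseq ?xt ?yt ?sz //.
    by move=> z; rewrite xy qsE.
  by rewrite -(sz p); apply: size_undup_le => z; rewrite xy.
have step (K : finType) (f : K -> T) :
    (forall k k', k != k' -> ((f k).1 == (f k').1) != ((f k).2 == (f k').2)) ->
    \sum_k N [ffun=> f k] (tupf t (q :: s)) = N (tupf t (q :: s)) (tupf t (q ::
      s)) ->
    \sum_k mu (f k :: s ++ r) = N (tupf t (q :: s)) (tupf t r).
  move=> fconf fsum; under eq_bigr do rewrite consE.
  apply: (fpsd_family_single (cpl_psd NP)
    (c := N (tupf t (q :: s)) (tupf t (q :: s)))) => //.
    rewrite -fsum; apply: eq_bigr => k _; rewrite (bigD1 k) //= big1 ?addr0.
      by apply: small => // z; rewrite mem_cat orbb.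
    move=> k' kk'; rewrite -mu_cat //.
    apply: (@mu_conflict _ (f k) (f k')); rewrite ?size_cat ?sz //.
    - by rewrite mem_head.
    - by rewrite mem_cat mem_head orbT.
    - by apply: fconf; rewrite eq_sym.
  rewrite -fsum; apply: eq_bigr => k _; apply: small => // z.
  rewrite mem_cat !inE; case: (z =P q) => [->|_]; rewrite ?qs ?orbT //=.
  by rewrite -orbA orbb.
exists (N (tupf t (q :: s)) (tupf t r)); split=> [h|g]; apply: step.
- by move=> g g' /negbTE gg; rewrite /= gg eqxx.
- exact: cpl_margin_constG.
- by move=> h h' /negbTE hh; rewrite /= hh eqxx.
- exact: cpl_margin_constH.
Qed.

Lemma mu_margin r : size r = (t' + t)%N -> exists c,
  (forall h, \sum_g mu ((g, h) :: r) = c) /\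
  (forall g, \sum_h mu ((g, h) :: r) = c).
Proof.
move=> rt; rewrite -(cat_take_drop t' r); apply: mu_margin_cat.
  by rewrite size_takel // rt leq_addr.
by rewrite size_drop rt addKn.
Qed.

(** The margin does not depend on [h], and at [h = p.2] every pair but [p] conflicts with the copy
    of [p] in [r]. *)
Lemma mu_marginG r h p : size r = (t' + t)%N -> p \in r ->
  \sum_g mu ((g, h) :: r) = mu (p :: r).
Proof.
move=> rt pr; have [c [cG cH]] := mu_margin rt.
rewrite cG -(cG p.2) (bigD1 p.1) //= big1 ?addr0 -?surjective_pairing // =>
  g gp.
apply: (@mu_conflict _ (g, p.2) p); rewrite /= ?rt ?mem_head ?inE ?pr ?orbT //.
by rewrite (negbTE gp) eqxx.
Qed.

Lemma mu_marginH r g p : size r = (t' + t)%N -> p \in r ->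
  \sum_h mu ((g, h) :: r) = mu (p :: r).
Proof.
move=> rt pr; have [c [cG cH]] := mu_margin rt.
by rewrite cH -(cG p.2) (mu_marginG _ rt pr).
Qed.

Lemma mu_replace p q r : size r = (t' + t)%N -> p \in r -> q \in r ->
  mu (p :: r) = mu (q :: r).
Proof.
by move=> rt pr qr; rewrite -(mu_marginG p.2 rt pr) (mu_marginG p.2 rt qr).
Qed.

(** The surplus entries are brought to the front one by one, where [mu_replace] turns them into
    [q]. *)
Lemma mu_pad u r q k : (size u + k + size r)%N = (t + t)%N -> q \in u ->
  {subset r <= u} -> mu (u ++ nseq k q ++ r) = mu (u ++ nseq (k + size r) q).
Proof.
elim: r k => [|p r IHr] k szE qu ru; first by rewrite cats0 addn0.
have mid a : perm_eq (u ++ nseq k q ++ a :: r) (a :: u ++ nseq k q ++ r).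
  by apply/seq.permP => f; rewrite /= !count_cat /=; lia.
have sz a : size (u ++ nseq k q ++ a :: r) = (t + t)%N.
  by rewrite !size_cat size_nseq addnA.
rewrite (mu_perm (sz p) (mid p)) (@mu_replace p q).
- rewrite addnS -addSn -IHr //.
  + apply: mu_perm; first by rewrite -szE /= !size_cat size_nseq /=; lia.
    apply/seq.permP => f; by rewrite /= !count_cat /= count_cat; lia.
  + by rewrite -szE /=; lia.
  + by move=> z zr; apply: ru; rewrite inE zr orbT.
- by apply: succn_inj; have := perm_size (mid p); rewrite sz /= => <-.
- by rewrite mem_cat ru ?mem_head.
- by rewrite mem_cat qu.
Qed.

(** Both lists reduce to one normal form: the distinct entries of [s] followed by copies of one of
    them. *)
Lemma mu_eq_mem s r : size s = (t + t)%N -> size r = (t + t)%N -> s =i r ->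
  mu s = mu r.
Proof.
move=> st rt sr.
have [s' ss'] := perm_to_subseq (undup_subseq s).
have [r' rr'] := perm_to_subseq (undup_subseq r).
have us : perm_eq (undup r) (undup s).
  by apply: uniq_perm; rewrite ?undup_uniq // => z; rewrite !mem_undup sr.
have {}rr' : perm_eq r (undup s ++ r').
  by apply: (perm_trans rr'); rewrite perm_cat2r.
case uE : (undup s) => [|q u].
  by move: st; rewrite (undup_nil uE).
have qs : q \in undup s by rewrite uE mem_head.
have sz x x' : size x = (t + t)%N -> perm_eq x (undup s ++ x') ->
    (size (undup s) + 0 + size x')%N = (t + t)%N.
  by move=> xt /perm_size; rewrite xt size_cat addn0.
rewrite (mu_perm st ss') (mu_perm rt rr').
rewrite (mu_pad (k := 0) (sz _ _ st ss') qs) ?(mu_pad (k := 0) (sz _ _ rt rr')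
  qs).
- by congr (mu (_ ++ nseq _ _)); have := sz _ _ st ss'; have := sz _ _ rt rr';
    lia.
- by move=> z zr; rewrite mem_undup sr (perm_mem rr') mem_cat zr orbT.
- by move=> z zs; rewrite mem_undup (perm_mem ss') mem_cat zs orbT.
Qed.
Definition pad n (S : {set T}) : seq T :=
  enum S ++ nseq (n - #|S|) (head p0 (enum S)).

Lemma size_pad n (S : {set T}) : (#|S| <= n)%N -> size (pad n S) = n.
Proof. by move=> Sn; rewrite size_cat size_nseq -cardE subnKC. Qed.

Lemma mem_pad n (S : {set T}) : S != set0 -> pad n S =i S.
Proof.
move=> /set0Pn[p pS] z; rewrite mem_cat mem_enum mem_nseq.
have : head p0 (enum S) \in S.
  rewrite -mem_enum; case E: (enum S) => [|q s]; last exact: mem_head.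
  by move: pS; rewrite -mem_enum E.
by move=> hS; case: (z =P head p0 (enum S)) => [->|_]; rewrite ?hS ?andbF ?orbF.
Qed.

(** The empty set is treated apart, since padding repeats a member of the set. *)
Definition lasserre_of (S : {set T}) : R :=
  if S == set0 then 1 else mu (pad (t + t) S).

Lemma lasserre_ofE s (S : {set T}) : size s = (t + t)%N -> s =i S ->
  lasserre_of S = mu s.
Proof.
move=> st sS; have S0 : S != set0.
  by apply/set0Pn; exists (nth p0 s 0); rewrite -sS mem_nth // st.
have cS : (#|S| <= t + t)%N.
  by rewrite -st -(eq_card sS) (leq_trans (card_size s)).
rewrite /lasserre_of (negbTE S0); apply: mu_eq_mem; rewrite ?size_pad //.
by move=> z; rewrite mem_pad.
Qed.

(** The vector of the empty set is the common margin, a sum of vectors of [N] over [h]. The extra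
    index in [H] produces this sum; for a non-empty set the weight [a] keeps a single value of that
    index. *)
Lemma lasserre_of_psd : fpsd (fun I J : {I : {set T} | (#|I| <= t)%N} =>
  lasserre_of (val I :|: val J)).
Proof.
pose idx := ({I : {set T} | (#|I| <= t)%N} * H)%type.
pose a (i : idx) : R := if val i.1 == set0 then 1 else (i.2 == p0.2)%:R.
pose e (i : idx) : tup :=
  if val i.1 == set0 then [ffun=> (p0.1, i.2)] else tupf t (pad t (val i.1)).
have := fpsd_sum_snd (fpsd_schur (fpsd_rank1 a) (fpsd_pull e (cpl_psd NP))).
congr fpsd; apply/funext => I; apply/funext => J; rewrite /a /e /=.
have pick (F : H -> R) : \sum_h (h == p0.2)%:R * F h = F p0.2.
  rewrite (bigD1 p0.2) //= eqxx mul1r big1 ?addr0 // => h /negbTE ->.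
  by rewrite mul0r.
have diag (K : {I : {set T} | (#|I| <= t)%N}) : val K != set0 ->
    N (tupf t (pad t (val K))) (tupf t (pad t (val K))) = lasserre_of (val K).
  move=> K0; have Kt := size_pad (valP K); rewrite -mu_cat //.
  apply/esym/lasserre_ofE; first by rewrite size_cat Kt.
  by move=> z; rewrite mem_cat orbb mem_pad.
have [I0|I0] := eqVneq (val I) set0; have [J0|J0] := eqVneq (val J) set0.
- rewrite I0 J0 setU0 /lasserre_of eqxx -[RHS](cpl_sum_constH p0.1).
  rewrite exchange_big; apply: eq_bigr => h _ /=.
  rewrite -[RHS](cpl_margin_constH p0.1); apply: eq_bigr => h' _.
  by rewrite !mul1r.
- rewrite I0 set0U -diag // -[RHS](cpl_margin_constH p0.1).
  apply: eq_bigr => h _; under eq_bigr do rewrite mul1r.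
  exact: (pick (fun=> _)).
- rewrite J0 setU0 -diag // -[RHS](cpl_margin_constH p0.1).
  rewrite exchange_big; apply: eq_bigr => h _; under eq_bigr do rewrite mulr1.
  by rewrite (pick (fun=> _)) (cpl_sym NP).
- transitivity (N (tupf t (pad t (val I))) (tupf t (pad t (val J)))).
    set C := N _ _; transitivity (\sum_h (h == p0.2)%:R * C);
      last exact: (pick (fun=> C)).
    apply: eq_bigr => h _; rewrite -(pick (fun=> (h == p0.2)%:R * C)).
    by apply: eq_bigr => h' _; rewrite mulrA; congr (_ * _); rewrite mulrC.
  rewrite -mu_cat ?size_pad ?(valP I) //; apply/esym/lasserre_ofE.
    by rewrite size_cat !size_pad ?(valP I) ?(valP J).
  by move=> z; rewrite mem_cat !mem_pad // inE.
Qed.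

Lemma lasserre_of_partial_iso (S : {set T}) : (#|S| <= t + t)%N ->
  ~ partial_iso S ->
  lasserre_of S = 0.
Proof.
move=> St Siso; have S0 : S != set0.
  apply: contra_not_neq Siso => ->.
  exists 0%N, (ffun0 (card_ord 0)), (ffun0 (card_ord 0)); split; first by case.
  by apply/setP => z; rewrite inE; apply/esym/imsetP => -[[]].
rewrite /lasserre_of (negbTE S0); apply: (cpl_atp NP).
set w := tupf _ _ => watp; apply: Siso.
exists (t + t)%N, (ffst w), (fsnd w); split=> //; apply/setP => z.
rewrite -(mem_pad (t + t) S0); apply/idP/imsetP => [zS|[k _ ->]].
  have kS : (index z (pad (t + t) S) < t + t)%N.
    by rewrite -[X in (_ < X)%N](size_pad St) index_mem.
  exists (Ordinal kS) => //; rewrite ffstE fsndE -surjective_pairing !ffunE /=.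
  by rewrite nth_index.
by rewrite ffstE fsndE -surjective_pairing ffunE mem_nth // size_pad.
Qed.

(** The bound is [2 t - 1], leaving room for the added pair; a non-empty [S] is padded to exactly
    this length. *)
Lemma lasserre_of_sums (S : {set T}) : (#|S| <= t' + t)%N ->
  (forall g, \sum_h lasserre_of (S :|: [set (g, h)]) = lasserre_of S) /\
  (forall h, \sum_g lasserre_of (S :|: [set (g, h)]) = lasserre_of S).
Proof.
move=> St; have [->|S0] := eqVneq S set0.
  have single p : lasserre_of (set0 :|: [set p]) = N [ffun=> p] [ffun=> p].
    rewrite (@lasserre_ofE (nseq t p ++ nseq t p)).
    - by rewrite mu_cat ?size_nseq // tupf_nseq.
    - by rewrite size_cat size_nseq.
    - by move=> z; rewrite mem_cat mem_nseq set0U inE orbb.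
  have -> : lasserre_of set0 = 1 by rewrite /lasserre_of eqxx.
  split=> [g|h]; under eq_bigr do rewrite single.
    exact: cpl_sum_constH.
  exact: cpl_sum_constG.
have rt := size_pad St; have rS := mem_pad (t' + t) S0;
  move: (pad _ _) rt rS => r rt rS.
have addE p : lasserre_of (S :|: [set p]) = mu (p :: r).
  by apply: lasserre_ofE => [|z]; rewrite /= ?rt // !inE rS orbC.
have [p pS] := set0Pn _ S0.
have pr : p \in r by rewrite rS.
have -> : lasserre_of S = mu (p :: r).
  by rewrite -addE (setUidPl _) // sub1set.
split=> [g|h]; under eq_bigr do rewrite addE.
  exact: mu_marginH.
exact: mu_marginG.
Qed.

Lemma coupling_lasserre : lasserre_nonneg_feasible R t G H.
Proof.
have tE : (2 * t = t + t)%N by rewrite mul2n addnn.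
have tE' : (2 * t - 2 = t' + t')%N by lia.
exists lasserre_of; split.
- exact/psd_mx_of/lasserre_of_psd.
- have le (S : {set T}) : (#|S| <= 2 * t - 2)%N -> (#|S| <= t' + t)%N.
    by rewrite tE' => St; apply: leq_trans St _; rewrite leq_add2l.
  by split=> S z /le St; have [sH sG] := lasserre_of_sums St.
- by move=> S; rewrite tE; apply: lasserre_of_partial_iso.
- by rewrite /lasserre_of eqxx.
- by move=> S _; rewrite /lasserre_of; case: ifP => // _; apply: mu_ge0.
Qed.
End CouplingLasserre.

(** * From a Lasserre solution to a level-t isomorphism *)

Section LasserreLevel.
Variables (R : realType) (t : nat) (G H : graph).
Hypothesis t_gt0 : (0 < t)%N.
Local Notation T := (G * H)%type.
Local Notation tup := {ffun 'I_t -> G * H}.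

Lemma not_partial_iso (S : {set T}) p q : p \in S -> q \in S ->
  (p.1 == q.1) != (p.2 == q.2) -> ~ partial_iso S.
Proof.
move=> pS qS pq [l [g [h [gh SE]]]].
move: pS qS; rewrite SE => /imsetP[i _ pE] /imsetP[j _ qE].
case/negP: pq; rewrite pE qE /=; have [E _] := gh i j.
by apply/eqP; apply/idP/idP => /eqP/E/eqP.
Qed.

Lemma partial_iso_same_atp n (g : {ffun 'I_n -> G}) (h : {ffun 'I_n -> H}) :
  partial_iso [set (g i, h i) | i : 'I_n] -> same_atp g h.
Proof.
case=> l [g' [h' [gh' E]]] i j.
have idx k : exists k', (g k = g' k') /\ (h k = h' k').
  have : (g k, h k) \in [set (g i, h i) | i : 'I_n] by apply: imset_f.
  by rewrite E => /imsetP[k' _ [-> ->]]; exists k'.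
by have [i' [-> ->]] := idx i; have [j' [-> ->]] := idx j.
Qed.

Variable y : {set T} -> R.
Hypothesis y_psd : fpsd (fun I J : {I : {set T} | (#|I| <= t)%N} =>
  y (val I :|: val J)).
Hypothesis y_sumH : forall (I : {set T}) g, (#|I| <= 2 * t - 2)%N ->
  \sum_h y (I :|: [set (g, h)]) = y I.
Hypothesis y_sumG : forall (I : {set T}) h, (#|I| <= 2 * t - 2)%N ->
  \sum_g y (I :|: [set (g, h)]) = y I.
Hypothesis y_iso : forall I : {set T}, (#|I| <= 2 * t)%N ->
  ~ partial_iso I -> y I = 0.
Hypothesis y_set0 : y set0 = 1.
Hypothesis y_ge0 : forall I : {set T}, (#|I| <= 2 * t)%N -> 0 <= y I.

(* Positive semidefiniteness extends the marginal equations to [2 t - 1]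
   pairs: for [#|A| < t], the vectors of the sets [A :|: [set f k]] sum up to
   the vector of [A]. *)
Lemma lasserre_margin (K : finType) (f : K -> T) :
  (forall k k', k != k' -> ((f k).1 == (f k').1) != ((f k).2 == (f k').2)) ->
  (forall I : {set T}, (#|I| <= 2 * t - 2)%N -> \sum_k y (I :|: [set f k]) = y
    I) ->
  forall I : {set T}, (#|I| < 2 * t)%N -> \sum_k y (I :|: [set f k]) = y I.
Proof.
move=> fconf fsum I It.
(* [A] has at most [t - 1] pairs, so it can take one more and stay a row index; the remaining pairs,
   at most [t], form the column index [B]. *)
pose A := [set x in take t.-1 (enum I)]; pose B := [set x in drop t.-1 (enum
  I)].
have IE : I = A :|: B.
  by apply/setP => x; rewrite !inE -mem_cat cat_take_drop mem_enum.
have At : (#|A| < t)%N.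
  rewrite cardsE (leq_ltn_trans (card_size _)) // size_take_min.
  by rewrite (leq_ltn_trans (geq_minl _ _)) // prednK.
have Bt : (#|B| <= t)%N.
  by rewrite cardsE (leq_trans (card_size _)) // size_drop -cardE; lia.
have Akt k : (#|A :|: [set f k]| <= t)%N.
  by rewrite (leq_trans (leq_card_setU _ _)) // cards1 addn1.
have := fpsd_family_single y_psd (c := y A)
  (p := fun k => exist (fun I : {set T} => (#|I| <= t)%N) _ (Akt k))
  (q := exist (fun I : {set T} => (#|I| <= t)%N) A (ltnW At)) _ _ _
  (exist (fun I : {set T} => (#|I| <= t)%N) B Bt).
rewrite /= setUid -IE => <- //.
- by apply: eq_bigr => k _; rewrite IE setUAC.
- rewrite -[RHS]fsum; last by lia.
  apply: eq_bigr => k _; rewrite (bigD1 k) //= setUid big1 ?addr0 // => k' kk'.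
  apply: y_iso.
    rewrite setUACA setUid (leq_trans (leq_card_setU _ _)) //.
    rewrite (leq_trans (leq_add (leqnn _) (leq_card_setU _ _))) //.
    by rewrite !cards1; lia.
  apply: (@not_partial_iso _ (f k) (f k')); rewrite ?inE ?eqxx ?orbT //.
  by apply: fconf; rewrite eq_sym.
- rewrite -[RHS]fsum; last by lia.
  by apply: eq_bigr => k _; rewrite setUAC setUid.
Qed.

Lemma lasserre_marginH (I : {set T}) g : (#|I| < 2 * t)%N ->
  \sum_h y (I :|: [set (g, h)]) = y I.
Proof.
apply: (@lasserre_margin _ (fun h => (g, h))) => [h h' hh|J /y_sumH -> //].
by rewrite /= eqxx (negbTE hh).
Qed.

Lemma lasserre_marginG (I : {set T}) h : (#|I| < 2 * t)%N ->
  \sum_g y (I :|: [set (g, h)]) = y I.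
Proof.
apply: (@lasserre_margin _ (fun g => (g, h))) => [g g' gg|J /y_sumG -> //].
by rewrite /= eqxx (negbTE gg).
Qed.

Definition pairset n (w : {ffun 'I_n -> T}) : {set T} := [set w i | i : 'I_n].

Lemma card_pairset n (w : {ffun 'I_n -> T}) : (#|pairset w| <= n)%N.
Proof. by rewrite (leq_trans (leq_imset_card _ _)) // card_ord. Qed.

Lemma pairset_sub m n (w : {ffun 'I_(m + n) -> T}) :
  pairset (flsub w) :|: pairset (frsub w) = pairset w.
Proof.
apply/setP => z; rewrite inE; apply/orP/imsetP => [[] /imsetP[i _ ->]|[k _ ->]].
- by exists (lshift n i); rewrite ?flsubE.
- by exists (rshift m i); rewrite ?frsubE.
have [j ->|j ->] := split_ordP k; [left|right]; apply/imsetP; exists j => //.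
  by rewrite flsubE.
by rewrite frsubE.
Qed.

Lemma pairset_fperm n (s : 'S_n) (w : {ffun 'I_n -> T}) :
  pairset (fperm s w) = pairset w.
Proof.
apply/setP => z; apply/imsetP/imsetP => -[i _ ->].
  by exists (s i); rewrite ?fpermE.
by exists (s^-1%g i); rewrite ?fpermE ?permKV.
Qed.

Lemma sum_ffun1 (M : nmodType) (U : finType) (F : {ffun 'I_1 -> U} -> M) :
  \sum_f F f = \sum_u F [ffun=> u].
Proof.
by apply: sum_ffun_const => f [i [j]]; rewrite !ord1 eqxx.
Qed.

(** Pairs are summed out one at a time by the extended marginal equations; [I] empty and [n = 2 t]
    give half of condition (b). *)
Lemma lasserre_sum_tuplesH n (g : {ffun 'I_n -> G}) (I : {set T}) :
  (#|I| + n <= 2 * t)%N -> \sum_h y (I :|: pairset (fpair g h)) = y I.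
Proof.
elim: n g I => [|n IHn] g I In.
  rewrite (big_pred1 (ffun0 (card_ord 0))); last first.
    by move=> f; apply/esym/eqP/ffunP => -[].
  by congr y; apply/setP => z; rewrite inE; case: imsetP => [[[]]|];
    rewrite ?orbF.
rewrite (@sum_fcat _ _ 1 n) sum_ffun1 -[RHS](lasserre_marginH (g ord0));
  last by lia.
apply: eq_bigr => u _; rewrite -[RHS](IHn (frsub (g : {ffun 'I_(1 + n) -> G}))).
  apply: eq_bigr => v _; congr y; rewrite -(@pairset_sub 1 n) fpair_fcat.
  rewrite fpair_fcat flsub_fcat frsub_fcat setUA; congr (_ :|: _ :|: _).
  apply/setP => z; rewrite inE; apply/imsetP/eqP => [[i _ ->]|->].
    by rewrite ord1 !ffunE /=; congr (g _, _); apply: val_inj.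
  by exists ord0 => //; rewrite !ffunE /=; congr (g _, _); apply: val_inj.
rewrite (leq_trans _ In) // addnS -addSn leq_add2r.
by rewrite (leq_trans (leq_card_setU _ _)) // cards1 addn1.
Qed.

Lemma lasserre_sum_tuplesG n (h : {ffun 'I_n -> H}) (I : {set T}) :
  (#|I| + n <= 2 * t)%N -> \sum_g y (I :|: pairset (fpair g h)) = y I.
Proof.
elim: n h I => [|n IHn] h I In.
  rewrite (big_pred1 (ffun0 (card_ord 0))); last first.
    by move=> f; apply/esym/eqP/ffunP => -[].
  by congr y; apply/setP => z; rewrite inE; case: imsetP => [[[]]|];
    rewrite ?orbF.
rewrite (@sum_fcat _ _ 1 n) sum_ffun1 -[RHS](lasserre_marginG (h ord0));
  last by lia.
apply: eq_bigr => u _; rewrite -[RHS](IHn (frsub (h : {ffun 'I_(1 + n) -> H}))).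
  apply: eq_bigr => v _; congr y; rewrite -(@pairset_sub 1 n) fpair_fcat.
  rewrite fpair_fcat flsub_fcat frsub_fcat setUA; congr (_ :|: _ :|: _).
  apply/setP => z; rewrite inE; apply/imsetP/eqP => [[i _ ->]|->].
    by rewrite ord1 !ffunE /=; congr (_, h _); apply: val_inj.
  by exists ord0 => //; rewrite !ffunE /=; congr (_, h _); apply: val_inj.
rewrite (leq_trans _ In) // addnS -addSn leq_add2r.
by rewrite (leq_trans (leq_card_setU _ _)) // cards1 addn1.
Qed.

Lemma pairset_fset_at n (w : {ffun 'I_n -> T}) i p :
  pairset (fset_at w i p) = [set w j | j in [set~ i]] :|: [set p].
Proof.
apply/setP => z; rewrite !inE; apply/imsetP/orP =>
  [[j _ ->]|[/imsetP[j]|/eqP ->]].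
- rewrite ffunE; case: eqP => [_|/eqP ji]; first by right.
  by left; apply/imsetP; exists j; rewrite ?inE.
- by rewrite !inE => /negbTE ji ->; exists j => //; rewrite ffunE ji.
- by exists i => //; rewrite ffunE eqxx.
Qed.

Lemma lasserre_level_isomorphic : level_isomorphic t G H (@DNN R).
Proof.
have tE : (2 * t = t + t)%N by rewrite mul2n addnn.
pose N (x z : tup) := y (pairset x :|: pairset z).
have NE g h : ghentry (mx_of (fun x z : tup => (N x z)%:C)) g h =
    (y (pairset (fpair g h)))%:C by rewrite ghentry_real /N pairset_sub.
exists (mx_of (fun x z : tup => (N x z)%:C)); split.
- apply: DNN_mx_of => [|x z]; last first.
    apply: y_ge0; rewrite tE (leq_trans (leq_card_setU _ _)) //.
    by rewrite leq_add ?card_pairset.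
  exact: (fpsd_pull (fun x : tup =>
    exist (fun I : {set T} => (#|I| <= t)%N) _ (card_pairset x)) y_psd).
(* [S] collects the other pairs, up to [2 t - 1] of them, which is beyond the range of the original
   marginal equations. *)
- move=> g h i; pose S := [set fpair g h j | j in [set~ i]].
  have St : (#|S| < 2 * t)%N.
    rewrite (leq_ltn_trans (leq_imset_card _ _)) // cardsC1 card_ord tE.
    by rewrite prednK // addn_gt0 t_gt0.
  under eq_bigr do rewrite NE; under [RHS]eq_bigr do rewrite NE.
  transitivity ((y S)%:C).
    rewrite -(lasserre_marginG (h i) St) rmorph_sum; apply: eq_bigr => x _.
    rewrite -pairset_fset_at; congr (y (pairset _))%:C; apply/ffunP => j.
    by rewrite !ffunE; case: eqP => [->|].
  rewrite -(lasserre_marginH (g i) St) rmorph_sum; apply: eq_bigr => x _.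
  rewrite -pairset_fset_at; congr (y (pairset _))%:C; apply/ffunP => j.
  by rewrite !ffunE; case: eqP => [->|].
- have t0 : (#|@set0 T| + (t + t) <= 2 * t)%N by rewrite cards0 tE.
  split=> [h|g]; under eq_bigr do rewrite NE -[pairset _]set0U;
    rewrite -rmorph_sum.
    by rewrite lasserre_sum_tuplesG ?y_set0.
  by rewrite lasserre_sum_tuplesH ?y_set0.
- move=> g h atp; rewrite NE y_iso //; first by rewrite tE card_pairset.
  move=> iso; apply: atp; apply: partial_iso_same_atp; move: iso.
  by congr partial_iso; apply: eq_imset => i; rewrite ffunE.
- by move=> g h s; rewrite !NE -fperm_fpair pairset_fperm.
Qed.
End LasserreLevel.

(** * The cycle of implications through couplings *)

Theorem theorem3p2 (R : realType) (t : nat) (G H : graph)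
    (ht : (1 <= t)%N) (Gsimple : simple G) (Hsimple : simple H)
    (Gnonempty : (0 < #|G|)%N) (Hnonempty : (0 < #|H|)%N) :
  [<-> lasserre_nonneg_feasible R t G H;
       level_isomorphic t G H (@DNN R);
       exists Phi : {linear 'M[R[i]]_#|{ffun 'I_t -> G}| ->
                            'M[R[i]]_#|{ffun 'I_t -> H}|},
         is_isomorphism_map (@DNN R) Phi;
       t_equivalent R t G H;
       hom_indistinguishable (@Lplus t) G H ].
Proof.
have [/card_gt0P[g0 _] /card_gt0P[h0 _]] := (Gnonempty, Hnonempty).
tfae.
- case=> y [/psd_mx_of y_psd [y_sumH y_sumG] y_iso y_set0 y_ge0].
  exact: lasserre_level_isomorphic y_sumH y_sumG y_iso y_set0 y_ge0.
- case/level_isomorphic_coupling => N NP.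
  by exists (coupling_map N); apply: coupling_map_isomorphism.
- by case=> Phi /isomorphism_map_coupling[N /coupling_t_equivalent]; apply.
- exact: t_equivalent_hom.
- case/(hom_indistinguishable_coupling R) => N NP.
  (* Non-emptiness of both graphs supplies the default pair [(g0, h0)] for reading lists as
     tuples. *)
  by case: t ht N NP => // t' _ N NP; apply: coupling_lasserre NP (g0, h0).
Qed.
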